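(* Let $(a_n)_{n \geq 1}$ be a strictly increasing sequence of positive integers, and let $\varepsilon > 0$. Then for almost all $\alpha \in [0,1]$ (with respect to Lebesgue measure) we have $$\delta_{\min}^{\alpha}(N) \leq \frac{1}{C_N}\,\frac{\log_2 a_N}{\log N \,\log_2 N} \qquad \text{for infinitely many } N,$$ as well as $$\delta_{\min}^{\alpha}(N) \geq \frac{1}{C_N \log N\, (\log_2 N)^{1+\varepsilon}} \qquad \text{for all sufficiently large } N.$$ Moreover, for almost all $\alpha \in [0,1]$ we also have $\delta_{\min}^{\alpha}(N) \leq \frac{1}{C_N}$ for infinitely many $N$.
   Context: For $\alpha \in [0,1]$ and $N \geq 2$, $\delta_{\min}^{\alpha}(N) = \min\{\|(a_m - a_n)\alpha\| : 1 \leq m,n \leq N,\ m \neq n\}$, where $\|x\|$ denotes the distance from $x$ to the nearest integer. Let $A_N = \{a_1,\dots,a_N\}$, $A_N - A_N = \{a-b : a,b \in A_N\}$, and $C_N = \#(A_N - A_N)$. Conventions: $\log x$ means $\max\{1, \log x\}$, $\log_2 x = \log\log x$ (with the same convention applied at each step), so all these quantities are positive for integers $\geq 1$. *)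

(* Defs.v *)
From HB Require Import structures.
From mathcomp Require Import all_boot all_order all_algebra.
From mathcomp Require Import all_classical all_reals all_analysis.
Set Implicit Arguments. Unset Strict Implicit. Unset Printing Implicit Defensive.
Import Order.TTheory GRing.Theory Num.Theory.
Local Open Scope ring_scope.

Definition dist_int {R : realType} (x : R) : R :=
  Num.min (x - (Num.floor x)%:~R) ((Num.floor x + 1)%:~R - x).

(* delta_min^alpha(N) = min_{1<=m,n<=N, m<>n} || (a_m - a_n) alpha ||.
   The default value 1 of the fold is irrelevant for N >= 2 (there is at least
   one admissible pair and every ||.|| is <= 1/2). *)
Definition delta_min {R : realType} (a : nat -> nat) (alpha : R) (N : nat) : R :=
  \big[Num.min/1]_(1 <= m < N.+1)
    \big[Num.min/1]_(1 <= n < N.+1 | m != n)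
      dist_int (((a m)%:Z - (a n)%:Z)%:~R * alpha).

Definition C_N (a : nat -> nat) (N : nat) : nat :=
  size (undup [seq ((a i)%:Z - (a j)%:Z)%R | i <- iota 1 N, j <- iota 1 N]).

(* log with the convention log x := max{1, log x} *)
Definition Log {R : realType} (x : R) : R := Num.max 1 (ln x).
Definition Log2 {R : realType} (x : R) : R := Log (Log x).

(* Main.v *)
(** The differences of [a_1, ..., a_N] are treated as denominators in a
    Duffin-Schaeffer type problem: a positive difference [d] first occurring at
    stage [N = lab d] is given the intervals [[p/d, (p + psi d)/d]] with
    [psi d] at most [tau N = min(1, theta N)/C_N].

    Upper bound.  Only numerators [p] sharing no prime [q <= Y] with [d] are
    kept; this costs a factor [phi_ratio d >> 1 / log log d], by Mertens.  A
    sieve bounds the overlap of the arcs of [d] and [e] by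
    [psi d * psi e * phi_ratio d * phi_ratio e * exp (2 L)], where [L] sums [1/q]
    over the primes [q > z] at which [d] and [e] have different valuations.  The
    pairs with large [L] are rare: this is the Koukoulopoulos-Maynard overlap
    estimate, proved here by induction on the primes, a prime contributing a
    factor [kap p = 1 + O(p^(-5/4))] up to the gain coming from [L].
    Bonferroni's inequality then bounds the measure of the union from below as
    soon as the total mass is bounded below; the mass is found in a single
    stretch [N, N^4] if [theta N >= 1] infinitely often, and in several such
    stretches, whose contributions form a harmonic series, otherwise.  Hence the
    limsup set has positive measure.  By Lebesgue's density theorem it changes
    only by a null set when [tau] is multiplied by a constant (Cassels), and it is
    then stable under [x -> M x] up to a null set, hence of full measure.

    Lower bound.  [d] contributes [4 beta (lab d)] to a Borel-Cantelli series,
    which telescopes against a potential in [log log C_N]. *)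
Require Import Defs.
From HB Require Import structures.
From mathcomp Require Import all_boot all_order all_algebra.
From mathcomp Require Import ring lra zify.
From mathcomp Require Import all_classical all_reals all_analysis.
Set Implicit Arguments. Unset Strict Implicit. Unset Printing Implicit Defensive.
Import Order.TTheory GRing.Theory Num.Theory.
Import numFieldNormedType.Exports.
Local Open Scope classical_set_scope.
Local Open Scope ring_scope.

(** * The contribution of one prime *)

(** Fourth roots enter because an edge sum T is estimated through T^4 = T^2 T^2: one factor by a
    degree argument, giving the product of the two masses, the other by the trivial bound, giving
    its square. This leaves (mass A * mass B)^(3/4); with weights written a^4 and b^4 it is the cube
    in every one-prime estimate. The obstacle in the induction is a loss of order 1/p at each prime,
    whose product diverges: when the weights concentrate on a valuation k >= 1, the valuations below
    k can still gain h^4/2, where h = p^(-1/4). This is cancelled to that order by the factor (1 -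
    1/p)^(1/2) that the sieved numerators supply when p divides both pinned divisors; for k = 0
    there is nothing below. A prime beyond Y supplies no such factor, and there every single
    difference must carry a proportion rho of the mass, so Y has to be large in terms of rho. The
    numerator log log a_N of the upper bound pays for phi_ratio d >> 1 / log log d. Where theta N >=
    1 the truncation by 1 removes this payment; there Y is a power of C_M, M = N^4, and phi_ratio >>
    1 / log Y is balanced by a mass of size log C_M. *)

Definition root4 {R : rcfType} (x : R) : R := Num.sqrt (Num.sqrt x).

Lemma root4_ge0 (R : rcfType) (x : R) : 0 <= root4 x.
Proof. exact: sqrtr_ge0. Qed.

Lemma root4K (R : rcfType) (x : R) : 0 <= x -> root4 x ^+ 4 = x.
Proof. by move=> x0; rewrite (exprM _ 2 2) !sqr_sqrtr ?sqrtr_ge0. Qed.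

Lemma root4M (R : rcfType) (x y : R) : 0 <= x -> root4 (x * y) = root4 x * root4 y.
Proof. by move=> x0; rewrite /root4 sqrtrM // sqrtrM ?sqrtr_ge0. Qed.

Lemma root4_exp4 (R : rcfType) (x : R) : 0 <= x -> root4 (x ^+ 4) = x.
Proof. by move=> x0; rewrite /root4 (exprM _ 2 2) sqrtr_sqr ger0_norm ?sqr_ge0 // sqrtr_sqr ger0_norm. Qed.

Lemma ler_root4 (R : rcfType) (x y : R) : x <= y -> root4 x <= root4 y.
Proof. by move=> xy; rewrite ler_wsqrtr ?ler_wsqrtr. Qed.

Lemma ler_pow4 (R : rcfType) (x y : R) : 0 <= y -> x ^+ 4 <= y ^+ 4 -> x <= y.
Proof.
move=> y0 xy; rewrite leNgt; apply/negP => yx; move: xy; rewrite leNgt => /negP; apply.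
by rewrite ltrXn2r //; apply: le_trans (ltW yx).
Qed.

Definition natdist (i j : nat) : nat := ((i - j) + (j - i))%N.

Lemma natdist_btw (i k j : nat) : (i < k < j)%N -> natdist i j = (natdist i k + natdist j k)%N.
Proof. by rewrite /natdist => /andP[ik kj]; lia. Qed.

Lemma geom_below (R : realFieldType) (h : R) k : 0 <= h <= 1 ->
  (1 - h) * \sum_(i < k) h ^+ (k - i) <= h.
Proof.
move=> /andP[h0 h1]; elim: k => [|k IH]; first by rewrite big_ord0 mulr0.
rewrite big_ord_recr /= subSnn expr1.
under eq_bigr => i _ do rewrite subSn ?(ltnW (ltn_ord i)) // exprS.
rewrite -mulr_sumr; move: IH; set s := \sum_(i < k) _ => IH; nra.
Qed.

Lemma geom_above (R : realFieldType) (h : R) k K : 0 <= h <= 1 ->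
  (1 - h) * \sum_(i < K | (k < i)%N) h ^+ (i - k) <=
    h - (if (k < K)%N then h ^+ (K - k) else h).
Proof.
move=> /andP[h0 h1]; elim: K => [|K IH]; first by rewrite big_ord0 mulr0 ltn0 subrr.
rewrite big_mkcond big_ord_recr -big_mkcond /= mulrDr.
move: IH; set s := \sum_(i < K | _) _; rewrite ltnS.
have [kK|Kk] := ltnP k K.
  rewrite (ltnW kK) subSn ?(ltnW kK) // exprS => IH.
  lra.
move=> IH.
have [kK|/negbTE kK] := boolP (k <= K)%N; last by lra.
have -> : k = K by apply/eqP; rewrite eqn_leq kK.
rewrite subSnn expr1; lra.
Qed.

(** Bookkeeping for a large mass above the dominant valuation [k]. The letters [x], [z] stand for
    the weight of the first variable below and above [k], [y], [u] for that of the second, the digit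
    being the exponent; [f] is the entry at (k, k), [rk], [Rk], [ck], [Ck] the rest of its row and
    column, [LL] to [GG] the four corners. Half of each quartic loss survives and is left to fight
    the cubic terms. *)
Lemma hard_combine (R : realFieldType) (h e eta x3 x4 z3 z4 y3 y4 u3 u4 q1 q2 q3 q4
    f rk Rk ck Ck LL LG GL GG : R) :
  0 <= h -> h * 1000 * 1000 <= 1 -> 0 <= eta <= 3 ->
  0 <= x4 -> 0 <= z4 -> 0 <= y4 -> 0 <= u4 -> 0 <= x3 -> 0 <= z3 -> 0 <= y3 -> 0 <= u3 ->
  x4 + z4 <= 28 * h -> y4 + u4 <= 28 * h -> e <= 6 * h ->
  q1 <= x4 / 100 -> q2 <= z4 / 100 -> q3 <= y4 / 100 -> q4 <= u4 / 100 ->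
  f <= (1 - 3 / 4 * (x4 + z4)) * (1 - 3 / 4 * (y4 + u4)) ->
  rk <= e * y3 -> Rk <= e * u3 -> ck <= e * x3 -> Ck <= e * z3 ->
  LL <= eta * (q1 + q3) -> LG <= eta * (q1 + q4) -> GL <= eta * (q2 + q3) -> GG <= eta * (q2 + q4) ->
  f + rk + Rk + (ck + LL + LG) + (Ck + GL + GG) <=
  1 + ((12 * h * x3 - x4) / 2 + (12 * h * z3 - z4) / 2 + (12 * h * y3 - y4) / 2 + (12 * h * u3 - u4) / 2).
Proof.
move=> h0 hs /andP[e0 e3] X0 Z0 Y0 U0 x30 z30 y30 u30 xz yu e6 Q1 Q2 Q3 Q4 ff Hrk HRk Hck HCk HLL HLG HGL HGG.
have ez v : 0 <= v -> e * v <= 6 * h * v by move=> v0; rewrite ler_wpM2r.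
have := ez _ x30; have := ez _ z30; have := ez _ y30; have := ez _ u30.
have eq v w : v <= w / 100 -> 0 <= w -> eta * v <= 3 * (w / 100).
  move=> vw w0; apply: (@le_trans _ _ (eta * (w / 100))); first exact: ler_wpM2l.
  by rewrite ler_wpM2r // divr_ge0.
have := eq _ _ Q1 X0; have := eq _ _ Q2 Z0; have := eq _ _ Q3 Y0; have := eq _ _ Q4 U0.
have : (x4 + z4) * (y4 + u4) <= (y4 + u4) / 100.
  by rewrite mulrC ler_wpM2l ?addr_ge0 //; lra.
move: HLL HLG HGL HGG ff; rewrite !(mulrDr eta).
have -> : (1 - 3 / 4 * (x4 + z4)) * (1 - 3 / 4 * (y4 + u4)) =
  1 - 3 / 4 * (x4 + z4) - 3 / 4 * (y4 + u4) + 9 / 16 * ((x4 + z4) * (y4 + u4)) by field.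
clear -X0 Z0 Y0 U0 Hrk HRk Hck HCk.
move: (eta * q1) (eta * q2) (eta * q3) (eta * q4) ((x4 + z4) * (y4 + u4)) => a b c d g.
lra.
Qed.

(** Same bookkeeping when little mass lies above [k]: the entry (k, k) and the row and column beyond
    it are estimated together by the factor [1 - h4 / 2], so only the weights [x], [y] below [k]
    remain. *)
Lemma soft_combine (R : realFieldType) (h h4 e e2 eta x3 x4 x6 y3 y4 y6 A B
    f rk Rk ck Ck LL LG GL GG g : R) :
  0 <= h -> h * 1000 * 1000 <= 1 -> 0 <= h4 <= h -> 0 <= A -> 0 <= B ->
  0 <= x4 <= 28 * h -> 0 <= y4 <= 28 * h ->
  A <= 1 - 3 / 4 * x4 -> B <= 1 - 3 / 4 * y4 ->
  f + Rk + Ck <= (1 - h4 / 2) * (A * B) ->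
  rk <= e * y3 -> ck <= e * x3 -> LG <= e2 * x3 -> GL <= e2 * y3 ->
  LL <= eta * (x6 + y6) -> GG <= g ->
  f + rk + Rk + (ck + LL + LG) + (Ck + GL + GG) <=
  1 - h4 / 2 + ((e + e2) * x3 + eta * x6 - (3 / 4 - 20 * h) * x4) +
  ((e + e2) * y3 + eta * y6 - (3 / 4 - 20 * h) * y4) + g.
Proof.
move=> h0 hs /andP[h40 h4h] A0 B0 /andP[X0 Xh] /andP[Y0 Yh] AX BY HS Hrk Hck HLG HGL HLL HGG.
have AB : A * B <= (1 - 3 / 4 * x4) * (1 - 3 / 4 * y4) by rewrite ler_pM.
have c0 : 0 <= 1 - h4 / 2 by lra.
have := ler_wpM2l c0 AB.
move: HS; move: ((1 - h4 / 2) * (A * B)) => q HS.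
have -> : (1 - h4 / 2) * ((1 - 3 / 4 * x4) * (1 - 3 / 4 * y4)) =
  1 - h4 / 2 - 3 / 4 * x4 - 3 / 4 * y4 + 3 / 8 * (h4 * x4) + 3 / 8 * (h4 * y4) +
  9 / 16 * (x4 * y4) - 9 / 32 * (h4 * (x4 * y4)) by field.
have : 0 <= h4 * (x4 * y4) by rewrite !mulr_ge0.
have : h4 * x4 <= h * x4 by rewrite ler_wpM2r.
have : h4 * y4 <= h * y4 by rewrite ler_wpM2r.
have : x4 * y4 <= 28 * h * y4 by rewrite ler_wpM2r.
have : 0 <= h * x4 by rewrite mulr_ge0.
have : 0 <= h * y4 by rewrite mulr_ge0.
move: HLL; rewrite (mulrDr eta) !(mulrDl e) !mulrBl -!mulrA.
clear -HS Hrk Hck HLG HGL HGG.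
move: (h * x4) (h * y4) (h4 * x4) (h4 * y4) (eta * x6) (eta * y6) (h4 * (x4 * y4)) (x4 * y4).
move: Hrk Hck HLG HGL HGG; move: (e * x3) (e * y3) (e2 * x3) (e2 * y3) => *.
lra.
Qed.

Lemma small_sq (R : realFieldType) (h : R) : 0 <= h -> h * 1000 * 1000 <= 1 ->
  h + 2 * h ^+ 2 <= 2 * h.
Proof. rewrite expr2; nra. Qed.

Lemma small_sq_sum (R : realFieldType) (h g : R) : 0 <= h -> h * 1000 * 1000 <= 1 ->
  0 <= g -> g <= h + 2 * h ^+ 2 -> g + g ^+ 2 <= h + 4 * h ^+ 2.
Proof.
move=> h0 hs g0 gh; have g2 : g ^+ 2 <= 2 * h ^+ 2.
  apply: (@le_trans _ _ ((h + 2 * h ^+ 2) ^+ 2)).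
    by rewrite lerXn2r // nnegrE // (le_trans g0).
  have -> : (h + 2 * h ^+ 2) ^+ 2 = h ^+ 2 * (1 + 2 * h) ^+ 2 by ring.
  rewrite mulrC ler_wpM2r ?sqr_ge0 // sqrrD expr1n mul1r exprMn expr2; nra.
lra.
Qed.

Lemma soft0_combine (R : realFieldType) (f rk Rk ck Ck LL LG GL GG q r g : R) :
  0 <= q -> f + Rk + Ck <= 1 -> rk <= 0 -> ck <= 0 -> LG <= 0 -> GL <= 0 -> LL <= 0 ->
  GG <= g -> g <= r -> f + rk + Rk + (ck + LL + LG) + (Ck + GL + GG) <= 1 + q + r.
Proof. by lra. Qed.

Lemma soft_final (R : realFieldType) (Vx Vy e4 h4 r h5 p : R) :
  Vx <= e4 * h4 / 4 + r -> Vy <= e4 * h4 / 4 + r -> r <= 50 * 81 * h5 ->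
  6 * h5 + 100 * 81 * h5 <= p ->
  1 - h4 / 2 + Vx + Vy + 6 * h5 <= 1 + (e4 - 1) * h4 / 2 + p.
Proof. rewrite mulrBl mul1r; move: (e4 * h4) => q; lra. Qed.

Lemma four_terms (R : realFieldType) (t a b c d : R) : 0 <= t ->
  a <= t / 2 -> b <= t / 2 -> c <= t / 2 -> d <= t / 2 ->
  b <= - (4 * t) \/ d <= - (4 * t) -> a + b + c + d <= 0.
Proof. by move=> t0 ha hb hc hd []; lra. Qed.

Lemma ten5 (R : realFieldType) (h5 : R) : 0 <= h5 -> 6 * h5 + 100 * 81 * h5 <= 10 ^+ 5 * h5.
Proof.
move=> h0; rewrite -mulrDl ler_wpM2r // (_ : 10 ^+ 5 = 10 * (10 * 10) * (10 * 10) :> R); last by ring.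
lra.
Qed.

(** * Bilinear sums over the valuations at one prime *)

Section OnePrime.
Variables (R : rcfType) (K : nat) (a b : 'I_K -> R) (F : 'I_K -> 'I_K -> R) (h eta : R).
Hypotheses (a0 : forall i, 0 <= a i) (b0 : forall i, 0 <= b i).
Hypotheses (sa : \sum_i a i ^+ 4 = 1) (sb : \sum_i b i ^+ 4 = 1).
Hypotheses (h0 : 0 < h) (eta1 : 1 <= eta).

Let g i j := (a i * b j) ^+ 3 * h ^+ natdist i j.

Let g_ge0 i j : 0 <= g i j.
Proof. by rewrite mulr_ge0 ?exprn_ge0 ?mulr_ge0 // ltW. Qed.

Let a1 i : a i <= 1.
Proof.
apply: ler_pow4; rewrite // expr1n -sa (bigD1 i) //= lerDl.
by apply: sumr_ge0 => j _; rewrite exprn_ge0.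
Qed.

Let b1 i : b i <= 1.
Proof.
apply: ler_pow4; rewrite // expr1n -sb (bigD1 i) //= lerDl.
by apply: sumr_ge0 => j _; rewrite exprn_ge0.
Qed.

Lemma geom_row_below (k : 'I_K) : h < 1 ->
  \sum_(i < K | (i < k)%N) h ^+ natdist i k <= h / (1 - h).
Proof.
move=> h1; have d0 : 0 < 1 - h by rewrite subr_gt0.
have hh : 0 <= h <= 1 by rewrite !ltW.
rewrite ler_pdivlMr // mulrC; apply: le_trans (geom_below k hh).
rewrite ler_pM2l // (big_ord_widen K (fun i => h ^+ (k - i))) ?(ltnW (ltn_ord k)) //.
apply: ler_sum => i ik.
by rewrite /natdist (eqP (ltnW ik : (i - k)%N == 0%N)).
Qed.

Lemma geom_row_above (k : 'I_K) : h < 1 ->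
  \sum_(i < K | (k < i)%N) h ^+ natdist i k <= h / (1 - h).
Proof.
move=> h1; have d0 : 0 < 1 - h by rewrite subr_gt0.
have hh : 0 <= h <= 1 by rewrite !ltW.
rewrite ler_pdivlMr // mulrC; apply: le_trans (_ : _ <= h - (if (k < K)%N then h ^+ (K - k) else h)) _.
  apply: le_trans (geom_above k K hh); rewrite ler_pM2l //.
  apply: ler_sum => i ik; by rewrite /natdist (eqP (ltnW ik : (k - i)%N == 0%N)) addn0.
by rewrite ltn_ord gerBl exprn_ge0 // ltW.
Qed.

Lemma sum_ord_split (k : 'I_K) (G : 'I_K -> R) :
  \sum_i G i = G k + \sum_(i < K | (i < k)%N) G i + \sum_(i < K | (k < i)%N) G i.
Proof.
rewrite (bigD1 k) //= -addrA; congr (_ + _).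
rewrite (bigID (fun i : 'I_K => (i < k)%N)) /=; congr (_ + _); apply: eq_bigl => i.
  by rewrite ltn_neqAle -(inj_eq val_inj); case: eqP.
by rewrite -leqNgt -(inj_eq val_inj) ltn_neqAle eq_sym.
Qed.

Lemma geom_row (k : 'I_K) : h < 1 ->
  \sum_(i < K | i != k) h ^+ natdist i k <= 2 * (h / (1 - h)).
Proof.
move=> h1; have := sum_ord_split k (fun i => h ^+ natdist i k).
rewrite (bigD1 k) //= -addrA => /addrI ->.
by rewrite mulr2n mulrDl mul1r lerD ?geom_row_below ?geom_row_above.
Qed.

Lemma cube_le6 (x y : R) : 0 <= x -> 0 <= y -> (x * y) ^+ 3 <= (x ^+ 6 + y ^+ 6) / 2.
Proof.
move=> x0 y0; rewrite exprMn.
have := sqr_ge0 (x ^+ 3 - y ^+ 3); rewrite sqrrB -!exprM => /=; nra.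
Qed.

Lemma natdistC i j : natdist i j = natdist j i.
Proof. by rewrite /natdist addnC. Qed.

(* Schur's test for the kernel h ^ |i - j| *)
Lemma schur_offdiag (P Q : pred 'I_K) : h < 1 ->
  \sum_(i | P i) \sum_(j | Q j && (j != i)) g i j <=
    (\sum_(i | P i) a i ^+ 6 + \sum_(j | Q j) b j ^+ 6) * (h / (1 - h)).
Proof.
move=> h1; have d0 : 0 < 1 - h by rewrite subr_gt0.
have e0 n : 0 <= h ^+ n by rewrite exprn_ge0 // ltW.
apply: (@le_trans _ _ (\sum_(i | P i) \sum_(j | Q j && (j != i))
   ((a i ^+ 6 + b j ^+ 6) / 2) * h ^+ natdist i j)).
  apply: ler_sum => i _; apply: ler_sum => j _.
  by rewrite ler_wpM2r // cube_le6.
under eq_bigr => i _ do (under eq_bigr => j _ do rewrite mulrDl mulrDl; rewrite big_split /=).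
rewrite big_split mulrDl /= lerD //.
  rewrite mulr_suml ler_sum // => i _; rewrite -mulr_sumr -mulrA ler_wpM2l ?exprn_ge0 //.
  rewrite ler_pdivrMl ?ltr0n //; apply: le_trans (geom_row i h1).
  rewrite [leRHS](bigID Q) /= (eq_bigl (fun j => (j != i) && Q j)); last by move=> j; rewrite andbC.
  rewrite (eq_bigr (fun j : 'I_K => h ^+ natdist j i)); last by move=> j _; rewrite natdistC.
  by rewrite lerDl sumr_ge0.
rewrite (exchange_big_dep Q) /=; last by move=> i j _ /andP[].
rewrite mulr_suml ler_sum // => j Qj; rewrite -mulr_sumr -mulrA ler_wpM2l ?exprn_ge0 //.
rewrite ler_pdivrMl ?ltr0n //; apply: le_trans (geom_row j h1).
rewrite [leRHS](bigID P) /= Qj /=.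
rewrite (eq_bigl (fun i => (i != j) && P i)) ?lerDl ?sumr_ge0 //.
by move=> i; rewrite andbC eq_sym.
Qed.

Lemma schur_all (P Q : pred 'I_K) : h < 1 ->
  \sum_(i | P i) \sum_(j | Q j) g i j <=
    (\sum_(i | P i) a i ^+ 6 + \sum_(j | Q j) b j ^+ 6) * (1 / 2 + h / (1 - h)).
Proof.
move=> h1; rewrite mulrDr.
have -> : \sum_(i | P i) \sum_(j | Q j) g i j =
    \sum_(i | P i && Q i) g i i + \sum_(i | P i) \sum_(j | Q j && (j != i)) g i j.
  rewrite big_mkcondr -big_split /=; apply: eq_bigr => i _.
  case: ifP => Qi; first by rewrite (bigD1 i).
  rewrite add0r; apply: eq_bigl => j; case: eqP => [->|]; rewrite ?Qi ?andbT //.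
apply: lerD; last exact: schur_offdiag.
apply: (@le_trans _ _ (\sum_(i | P i && Q i) (a i ^+ 6 + b i ^+ 6) / 2)).
  apply: ler_sum => i _; rewrite /g /natdist subnn expr0 mulr1; exact: cube_le6.
rewrite -mulr_suml mul1r ler_pM2r ?invr_gt0 ?ltr0n // big_split /= lerD //.
  by rewrite big_mkcondr ler_sum // => i _; case: ifP => // _; rewrite exprn_ge0.
rewrite (eq_bigl (fun i => Q i && P i)) 1?big_mkcondr ?ler_sum //; last by move=> i; rewrite andbC.
by move=> i _; case: ifP => // _; rewrite exprn_ge0.
Qed.

Hypothesis hF : forall i j, F i j <= (if i == j then 1 else eta) * g i j.

Let hFe i j : F i j <= eta * g i j.
Proof.
apply: le_trans (hF i j) _; case: ifP => // _.
by rewrite mul1r ler_peMl.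
Qed.

Let sum6 (x : 'I_K -> R) (P : pred 'I_K) : (forall i, 0 <= x i) -> (forall i, x i <= 1) ->
  \sum_(i | P i) x i ^+ 6 <= \sum_(i | P i) x i ^+ 4.
Proof.
move=> x0 x1; apply: ler_sum => i _; rewrite (exprD _ 4 2) ler_piMr ?exprn_ge0 //.
by rewrite exprn_ile1.
Qed.

(** Schur's test alone. A constant loss is affordable at the finitely many primes for which [h] is
    not tiny. *)
Lemma one_prime_crude : h < 1 ->
  \sum_i \sum_j F i j <= eta * (1 + 2 * (h / (1 - h))).
Proof.
move=> h1; apply: (@le_trans _ _ (eta * \sum_i \sum_j g i j)).
  rewrite mulr_sumr ler_sum // => i _; rewrite mulr_sumr ler_sum // => j _.
have /= H := schur_all xpredT xpredT h1.
rewrite ler_wpM2l //; first by apply: le_trans eta1.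
apply: le_trans H _.
have h2 : 0 <= 1 / 2 + h / (1 - h).
  by rewrite addr_ge0 ?divr_ge0 ?subr_ge0 // ltW.
have -> : 1 + 2 * (h / (1 - h)) = 2 * (1 / 2 + h / (1 - h)) by rewrite mulrDr mul1r divff ?pnatr_eq0.
rewrite ler_wpM2r //.
have := sum6 xpredT a0 a1; have := sum6 xpredT b0 b1; rewrite sa sb; lra.
Qed.

(** One factor [a i * b i] is replaced by its maximum, and the remaining square is at most the mean
    of [a i ^+ 4] and [b i ^+ 4], which sums to 1. *)
Lemma diag_le_max : exists k, \sum_i (a i * b i) ^+ 3 <= a k * b k.
Proof.
case: (pickP (@predT 'I_K)) => [i0 _|no]; last first.
  by move/eqP: sa; rewrite big1 => [|i]; [rewrite eq_sym oner_eq0 | have := no i].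
have [k _ Hk] := @Order.TotalTheory.arg_maxP _ _ _ i0 xpredT (fun i => a i * b i) isT.
exists k; apply: (@le_trans _ _ (\sum_i (a k * b k) * ((a i ^+ 4 + b i ^+ 4) / 2))).
  apply: ler_sum => i _; have := Hk i isT; have ai := a0 i; have bi := b0 i => ab.
  have := sqr_ge0 (a i ^+ 2 - b i ^+ 2); rewrite sqrrB -!exprM => /= H.
  have H2 : (a i * b i) ^+ 2 <= (a i ^+ 4 + b i ^+ 4) / 2 by rewrite exprMn; lra.
  rewrite exprS; apply: ler_pM; rewrite ?mulr_ge0 ?exprn_ge0 ?mulr_ge0 //.
by rewrite -mulr_sumr -mulr_suml big_split /= sa sb -mulr2n divff ?mulr1 // pnatr_eq0.
Qed.

Hypotheses (hsmall : h * 10 ^+ 10 <= 1) (eta3 : eta <= 3).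
Let tail x k := root4 (\sum_(i < K | (k <= i)%N) x i ^+ 4 : R).
(** These are the entries with min(i, j) = k. For them the common divisor may be multiplied by the
    full power p^k on both sides, so that one application of the induction covers all of them, with
    the gain [h ^+ 4 / 2] as soon as k > 0. *)
Hypothesis hS : forall k : 'I_K,
  F k k + \sum_(j < K | (k < j)%N) F k j + \sum_(i < K | (k < i)%N) F i k <=
    (if (k : nat) == 0%N then 1 else 1 - h ^+ 4 / 2) * (tail a k * tail b k) ^+ 3.

(** Concavity of t^(3/4) at t = 1, proved by factoring the difference as a square times a positive
    quadratic. *)
Lemma cube_root_bound (r X : R) : r ^+ 4 = 1 - X -> r ^+ 3 <= 1 - 3 / 4 * X.
Proof.
move=> rX; have : 0 <= (r - 1) ^+ 2 * (3 * r ^+ 2 + 2 * r + 1).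
  rewrite mulr_ge0 ?sqr_ge0 //.
  have -> : 3 * r ^+ 2 + 2 * r + 1 = 2 * r ^+ 2 + (r + 1) ^+ 2 by ring.
  by apply: addr_ge0; [apply: mulr_ge0 => //|]; exact: sqr_ge0.
have -> : (r - 1) ^+ 2 * (3 * r ^+ 2 + 2 * r + 1) = 3 * r ^+ 4 - 4 * r ^+ 3 + 1 by ring.
rewrite rX; lra.
Qed.

Lemma amgm4 (x y : R) : 4 * (y * x ^+ 3) <= 3 * x ^+ 4 + y ^+ 4.
Proof.
rewrite -subr_ge0.
have -> : 3 * x ^+ 4 + y ^+ 4 - 4 * (y * x ^+ 3) = (x - y) ^+ 2 * (2 * x ^+ 2 + (x + y) ^+ 2) by ring.
apply: mulr_ge0; first exact: sqr_ge0.
by apply: addr_ge0; [apply: mulr_ge0 => //|]; exact: sqr_ge0.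
Qed.

Lemma quartic_max (t v : R) : 0 <= t -> 0 <= v -> (t * v ^+ 3 - v ^+ 4) / 2 <= t ^+ 4 / 2.
Proof.
move=> t0 v0; rewrite ler_pM2r ?invr_gt0 ?ltr0n //; have v3 : 0 <= v ^+ 3 by rewrite exprn_ge0.
have t4 : 0 <= t ^+ 4 by rewrite exprn_ge0.
have [vt|tv] := lerP v t; last by rewrite (exprSr v 3); nra.
have v3t : v ^+ 3 <= t ^+ 3 by rewrite lerXn2r.
have : t * v ^+ 3 <= t * t ^+ 3 by rewrite ler_wpM2l.
rewrite -exprS; have : 0 <= v ^+ 4 by rewrite exprn_ge0.
lra.
Qed.

Lemma quartic_neg (t v : R) : 0 <= t -> 2 * t <= v -> (t * v ^+ 3 - v ^+ 4) / 2 <= - (4 * t ^+ 4).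
Proof.
move=> t0 tv; have v0 : 0 <= v by apply: le_trans tv; rewrite mulr_ge0.
have v4t : (2 * t) ^+ 4 <= v ^+ 4 by rewrite lerXn2r // nnegrE mulr_ge0.
move: v4t; have -> : (2 * t) ^+ 4 = 16 * t ^+ 4 by ring.
have v3 : 0 <= v ^+ 3 by rewrite exprn_ge0.
have : t * v ^+ 3 <= v ^+ 4 / 2 by rewrite (exprSr v 3); nra.
lra.
Qed.

Let hsmall3 : h * 1000 * 1000 <= 1.
Proof.
apply: le_trans hsmall; rewrite -mulrA ler_pM2l //.
have -> : (10 : R) ^+ 10 = 1000 * 1000 * (1000 * 10) by ring.
lra.
Qed.

Let h1 : h < 1.
Proof. by move: hsmall3 h0; nra. Qed.

Let hh := h / (1 - h).

Let hh0 : 0 <= hh.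
Proof. by rewrite divr_ge0 ?subr_ge0 ?ltW. Qed.

Let hh_le : hh <= h + 2 * h ^+ 2.
Proof.
rewrite /hh ler_pdivrMr ?subr_gt0 // expr2; move: h0 hsmall3 => ? ?; nra.
Qed.

Let hX_ge0 n : 0 <= h ^+ n.
Proof. by rewrite exprn_ge0 // ltW. Qed.

Let rt (P : pred 'I_K) (x : 'I_K -> R) := root4 (\sum_(i | P i) x i ^+ 4).

Let rt4 P x : rt P x ^+ 4 = \sum_(i | P i) x i ^+ 4.
Proof. by rewrite root4K // sumr_ge0 // => i _; rewrite (exprM _ 2 2) sqr_ge0. Qed.

Let le_rt (P : pred 'I_K) x i : P i -> x i <= rt P x.
Proof.
move=> Pi; apply: ler_pow4; first exact: root4_ge0.
rewrite rt4 (bigD1 i) //= lerDl sumr_ge0 // => j _.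
by rewrite (exprM _ 2 2) sqr_ge0.
Qed.

Let col_bound (P : pred 'I_K) (k : 'I_K) : \sum_(i | P i) h ^+ natdist i k <= hh ->
  \sum_(i | P i) F i k <= eta * hh * rt P a ^+ 3.
Proof.
move=> Phh; have e0 : 0 <= eta by apply: le_trans eta1.
have r0 : 0 <= rt P a by exact: root4_ge0.
apply: (@le_trans _ _ (\sum_(i | P i) eta * rt P a ^+ 3 * h ^+ natdist i k)).
  apply: ler_sum => i Pi; apply: le_trans (hFe i k) _.
  rewrite /g mulrA ler_wpM2r // ler_wpM2l // lerXn2r ?nnegrE ?mulr_ge0 //.
  by apply: le_trans (ler_piMr (a0 i) (b1 k)) (le_rt a Pi).
by rewrite -mulr_sumr mulrAC ler_wpM2r ?exprn_ge0 // ler_wpM2l.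
Qed.

Let row_bound (P : pred 'I_K) (k : 'I_K) : \sum_(i | P i) h ^+ natdist i k <= hh ->
  \sum_(j | P j) F k j <= eta * hh * rt P b ^+ 3.
Proof.
move=> Phh; have e0 : 0 <= eta by apply: le_trans eta1.
have r0 : 0 <= rt P b by exact: root4_ge0.
apply: (@le_trans _ _ (\sum_(i | P i) eta * rt P b ^+ 3 * h ^+ natdist i k)).
  apply: ler_sum => i Pi; apply: le_trans (hFe k i) _.
  rewrite /g mulrA natdistC ler_wpM2r // ler_wpM2l // lerXn2r ?nnegrE ?mulr_ge0 //.
  by apply: le_trans (ler_piMl (b0 i) (a1 k)) (le_rt b Pi).
by rewrite -mulr_sumr mulrAC ler_wpM2r ?exprn_ge0 // ler_wpM2l.
Qed.

(** A passage from below [k] to above [k] splits its distance at [k], so both geometric series are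
    available and the corner is of second order in [h]. *)
Let corner_below (k : 'I_K) :
  \sum_(i < K | (i < k)%N) \sum_(j < K | (k < j)%N) F i j <=
    eta * hh ^+ 2 * rt (fun i => (i < k)%N) a ^+ 3.
Proof.
have e0 : 0 <= eta by apply: le_trans eta1.
set r := rt _ _; have r0 : 0 <= r by exact: root4_ge0.
apply: (@le_trans _ _ (\sum_(i < K | (i < k)%N) eta * r ^+ 3 * h ^+ natdist i k * hh)).
  apply: ler_sum => i ik.
  apply: (@le_trans _ _ (\sum_(j < K | (k < j)%N) eta * r ^+ 3 * h ^+ natdist i k * h ^+ natdist j k)).
    apply: ler_sum => j kj; apply: le_trans (hFe i j) _.
    rewrite /g (@natdist_btw i k j) ?ik // exprD.
    set u := (a i * b j) ^+ 3; rewrite (mulrA u) (mulrA eta) (mulrA eta).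
    apply: ler_wpM2r => //; apply: ler_wpM2r => //; apply: ler_wpM2l => //.
    rewrite lerXn2r ?nnegrE ?mulr_ge0 //.
    exact: le_trans (ler_piMr (a0 i) (b1 j)) (le_rt a ik).
  rewrite -mulr_sumr; apply: ler_wpM2l; last exact: geom_row_above.
  by rewrite mulr_ge0 // mulr_ge0 // exprn_ge0.
rewrite -mulr_suml -mulr_sumr (_ : eta * hh ^+ 2 * r ^+ 3 = eta * r ^+ 3 * hh * hh); last by ring.
apply: ler_wpM2r => //; apply: ler_wpM2l; last exact: geom_row_below.
by rewrite mulr_ge0 // exprn_ge0.
Qed.

Let corner_above (k : 'I_K) :
  \sum_(i < K | (k < i)%N) \sum_(j < K | (j < k)%N) F i j <=
    eta * hh ^+ 2 * rt (fun i => (i < k)%N) b ^+ 3.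
Proof.
have e0 : 0 <= eta by apply: le_trans eta1.
set r := rt _ _; have r0 : 0 <= r by exact: root4_ge0.
apply: (@le_trans _ _ (\sum_(i < K | (k < i)%N) eta * r ^+ 3 * h ^+ natdist i k * hh)).
  apply: ler_sum => i ik.
  apply: (@le_trans _ _ (\sum_(j < K | (j < k)%N) eta * r ^+ 3 * h ^+ natdist i k * h ^+ natdist j k)).
    apply: ler_sum => j kj; apply: le_trans (hFe i j) _.
    rewrite /g natdistC (@natdist_btw j k i) ?kj // addnC exprD.
    set u := (a i * b j) ^+ 3; rewrite (mulrA u) (mulrA eta) (mulrA eta).
    apply: ler_wpM2r => //; apply: ler_wpM2r => //; apply: ler_wpM2l => //.
    rewrite lerXn2r ?nnegrE ?mulr_ge0 //.
    exact: le_trans (ler_piMl (b0 j) (a1 i)) (le_rt b kj).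
  rewrite -mulr_sumr; apply: ler_wpM2l; last exact: geom_row_below.
  by rewrite mulr_ge0 // mulr_ge0 // exprn_ge0.
rewrite -mulr_suml -mulr_sumr (_ : eta * hh ^+ 2 * r ^+ 3 = eta * r ^+ 3 * hh * hh); last by ring.
apply: ler_wpM2r => //; apply: ler_wpM2l; last exact: geom_row_above.
by rewrite mulr_ge0 // exprn_ge0.
Qed.

Let block_bound (P Q : pred 'I_K) ea eb : (forall i, P i -> a i ^+ 2 <= ea) ->
    (forall j, Q j -> b j ^+ 2 <= eb) ->
  \sum_(i | P i) \sum_(j | Q j) F i j <=
    eta * (ea * (\sum_(i | P i) a i ^+ 4) + eb * (\sum_(j | Q j) b j ^+ 4)).
Proof.
move=> Pe Qe; have e0 : 0 <= eta by apply: le_trans eta1.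
apply: (@le_trans _ _ (eta * \sum_(i | P i) \sum_(j | Q j) g i j)).
  rewrite mulr_sumr ler_sum // => i _; rewrite mulr_sumr ler_sum // => j _; exact: hFe.
rewrite ler_wpM2l //; apply: le_trans (schur_all P Q h1) _.
have s0 : 0 <= \sum_(i | P i) a i ^+ 6 + \sum_(j | Q j) b j ^+ 6.
  by rewrite addr_ge0 // sumr_ge0 // => i _; rewrite exprn_ge0.
apply: (@le_trans _ _ (\sum_(i | P i) a i ^+ 6 + \sum_(j | Q j) b j ^+ 6)).
  rewrite ler_piMr // -/hh; move: hh_le h0 hsmall3; rewrite expr2 => ? ? ?; nra.
rewrite !mulr_sumr lerD // ler_sum // => i Pi;
  rewrite (exprD _ 2 4) ler_wpM2r ?exprn_ge0 //; by [apply: Pe | apply: Qe].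
Qed.

Let total_split (k : 'I_K) : \sum_i \sum_j F i j =
  (F k k + \sum_(j < K | (j < k)%N) F k j + \sum_(j < K | (k < j)%N) F k j) +
  (\sum_(i < K | (i < k)%N) F i k +
   \sum_(i < K | (i < k)%N) \sum_(j < K | (j < k)%N) F i j +
   \sum_(i < K | (i < k)%N) \sum_(j < K | (k < j)%N) F i j) +
  (\sum_(i < K | (k < i)%N) F i k +
   \sum_(i < K | (k < i)%N) \sum_(j < K | (j < k)%N) F i j +
   \sum_(i < K | (k < i)%N) \sum_(j < K | (k < j)%N) F i j).
Proof.
rewrite (sum_ord_split k (fun i => \sum_j F i j)) (sum_ord_split k (F k)).
congr (_ + _ + _); rewrite -!big_split; apply: eq_bigr => i _; exact: sum_ord_split.
Qed.

(** By Schur's test the off-diagonal part is at most [6 * hh], hence a sum exceeding 1 has a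
    diagonal larger than [1 - 7 * h], and the diagonal is dominated by its largest entry. *)
Let max_large : 1 < \sum_i \sum_j F i j -> exists k, 1 - 7 * h < a k * b k.
Proof.
move=> big; have [k kmax] := diag_le_max; exists k.
have e0 : 0 <= eta by apply: le_trans eta1.
have : \sum_i \sum_j F i j <= \sum_i (a i * b i) ^+ 3 +
    eta * \sum_i \sum_(j | j != i) g i j.
  rewrite mulr_sumr -big_split /=; apply: ler_sum => i _; rewrite (bigD1 i) //= lerD //.
    by apply: le_trans (hF i i) _; rewrite eqxx mul1r /g /natdist subnn expr0 mulr1.
  by rewrite mulr_sumr ler_sum.
have /= := schur_offdiag xpredT xpredT h1; rewrite -/hh.
have := sum6 xpredT a0 a1; have := sum6 xpredT b0 b1; rewrite sa sb /=.
set s6b := \sum_(i < K) b i ^+ 6; set s6a := \sum_(i < K) a i ^+ 6.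
set G := \sum_i \sum_(j | _) g i j; move=> sb6 sa6 HG HT.
have G2 : G <= 2 * hh by apply: le_trans HG _; rewrite ler_wpM2r //; lra.
have eG : eta * G <= 6 * hh.
  by apply: le_trans (ler_wpM2l e0 G2) _; rewrite mulrA ler_wpM2r //; move: eta3; lra.
move: hh_le h0 hsmall3; rewrite expr2; nra.
Qed.

(** The leading part [P * v ^+ 3 - 3 / 4 * v ^+ 4] is at most [P ^+ 4 / 4] by the inequality of the
    means; with [P] close to [eta * h] this is the main term, and everything else is of order
    [h ^+ 5]. For [v] at least [24 * h] the quartic term already makes the expression
    nonpositive. *)
Let one_var P v : 0 <= v -> v ^+ 2 <= 100^-1 -> 0 <= P -> P <= eta * (h + 4 * h ^+ 2) ->
  P * v ^+ 3 + eta * v ^+ 6 - (3 / 4 - 20 * h) * v ^+ 4 <=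
    eta ^+ 4 * h ^+ 4 / 4 + 50 * eta ^+ 4 * h ^+ 5.
Proof.
move=> v0 v100 P0 PE; have h2 : h ^+ 2 * 1000 * 1000 <= h by move: h0 hsmall3; rewrite expr2; nra.
have v3 : 0 <= v ^+ 3 by rewrite exprn_ge0.
have v4 : 0 <= v ^+ 4 by rewrite exprn_ge0.
have e0 : 0 <= eta by apply: le_trans eta1.
have e4 : 0 <= eta ^+ 4 by rewrite exprn_ge0.
have hs := hsmall3; have eta3' := eta3; have h00 := ltW h0.
have P6 : P <= 6 * h by apply: le_trans PE _; nra.
have v6 (c : R) : v ^+ 2 <= c -> eta * v ^+ 6 <= 3 * c * v ^+ 4.
  move=> vc; rewrite (exprD v 2 4) mulrA ler_wpM2r // ler_pM ?sqr_ge0 //.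
have [vh|hv] := lerP (24 * h) v.
  have v6' := v6 _ v100.
  have Pv : P * v ^+ 3 <= v ^+ 4 / 4.
    rewrite (exprSr v 3); have : P * v ^+ 3 <= 6 * h * v ^+ 3 by rewrite ler_wpM2r.
    nra.
  apply: (@le_trans _ _ 0); last first.
    by rewrite addr_ge0 ?divr_ge0 // !mulr_ge0 ?exprn_ge0.
  have : 3 * 100^-1 * v ^+ 4 <= v ^+ 4 / 4 by rewrite mulrC ler_wpM2l //; lra.
  have : 20 * h * v ^+ 4 <= v ^+ 4 / 4 by rewrite mulrC ler_wpM2l //; lra.
  lra.
have v2h : v ^+ 2 <= h.
  have : v ^+ 2 <= (24 * h) ^+ 2 by rewrite lerXn2r ?nnegrE ?mulr_ge0 // ltW.
  rewrite exprMn expr2; lra.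
have v6' := v6 _ v2h.
(* After [eta * v ^+ 6 <= 3 * h * v ^+ 4] the quartic coefficient is 3/4 - 23 h, and 31 is chosen so
   that 3/4 of [w] stays below it. *)
pose w := 1 - 31 * h; have w0 : 0 < w by rewrite /w; lra.
have [y [y0 wy yE]] : exists y, [/\ 0 <= y, w * y = P & y <= eta * (h * (1 + 40 * h))].
  exists (P / w); split; first by rewrite divr_ge0 // ltW.
    by rewrite mulrC divfK // gt_eqF.
  rewrite ler_pdivrMr // (le_trans PE) // -mulrA ler_wpM2l // expr2 /w; nra.
have am := amgm4 v y.
have y4 : y ^+ 4 <= eta ^+ 4 * (h ^+ 4 * (1 + 200 * h)).
  apply: (@le_trans _ _ ((eta * (h * (1 + 40 * h))) ^+ 4)).
    by rewrite lerXn2r // nnegrE !mulr_ge0 ?addr_ge0 // mulr_ge0.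
  rewrite exprMn ler_wpM2l // exprMn ler_wpM2l //.
  have -> : (1 + 40 * h) ^+ 4 = ((1 + 40 * h) ^+ 2) ^+ 2 by rewrite -exprM.
  have : (1 + 40 * h) ^+ 2 <= 1 + 81 * h by rewrite sqrrD expr1n mul1r exprMn expr2; lra.
  move=> H; apply: (@le_trans _ _ ((1 + 81 * h) ^+ 2)).
    by rewrite lerXn2r ?nnegrE ?sqr_ge0 // addr_ge0 ?mulr_ge0.
  rewrite sqrrD expr1n mul1r exprMn expr2; lra.
have wy4 : w * y ^+ 4 <= y ^+ 4 by rewrite ler_piMl ?exprn_ge0 // /w; lra.
have wam : w * (4 * (y * v ^+ 3)) <= w * (3 * v ^+ 4 + y ^+ 4) by rewrite ler_wpM2l // ltW.
have : w * (4 * (y * v ^+ 3)) = 4 * (P * v ^+ 3) by rewrite -wy; ring.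
have -> : eta ^+ 4 * h ^+ 4 / 4 + 50 * eta ^+ 4 * h ^+ 5 = eta ^+ 4 * (h ^+ 4 * (1 + 200 * h)) / 4.
  by field.
move: wam; rewrite mulrDr /w; move: v6' wy4 y4; rewrite /w; nra.
Qed.

(** If the sum exceeds 1, both weights concentrate on one index [k] up to a mass of [28 * h]. A
    large remainder above [k] is ruled out by its quartic loss. Otherwise [hS] handles the entries
    with minimum [k], and the two weights below [k] gain at most [eta ^+ 4 * h ^+ 4 / 4] each,
    against the loss [h ^+ 4 / 2]: without [eta] the terms of order [h ^+ 4] cancel. *)
Lemma one_prime_bound :
  \sum_i \sum_j F i j <= 1 + (eta ^+ 4 - 1) * h ^+ 4 / 2 + 10 ^+ 5 * h ^+ 5.
Proof.
have e0 : 0 <= eta by apply: le_trans eta1.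
have eta41 : 1 <= eta ^+ 4 by rewrite exprn_ege1.
have [small|big] := lerP (\sum_i \sum_j F i j) 1.
  apply: le_trans small _; have h4 := hX_ge0 4; have h5 := hX_ge0 5.
  rewrite -addrA lerDl; apply: addr_ge0; first by rewrite divr_ge0 // mulr_ge0 ?subr_ge0.
  by apply: mulr_ge0 => //; exact: exprn_ge0.
have [k hk] := max_large big.
have ak : 1 - 7 * h <= a k by apply: le_trans (ltW hk) _; rewrite ler_piMr.
have bk : 1 - 7 * h <= b k by apply: le_trans (ltW hk) _; rewrite ler_piMl.
have p0 : 0 <= 1 - 7 * h by move: hsmall3 h0; nra.
have bern : 1 - 28 * h <= (1 - 7 * h) ^+ 4.
  have := sqr_ge0 h; move: h0 hsmall3 => h0' hs hsq.
  have -> : (1 - 7 * h) ^+ 4 = (1 - 14 * h + 49 * h ^+ 2) ^+ 2 by ring.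
  have -> : 1 - 28 * h = (1 - 14 * h) ^+ 2 - 196 * h ^+ 2 by ring.
  rewrite [leRHS]sqrrD; have := sqr_ge0 (49 * h ^+ 2); nra.
have ak4 : 1 - 28 * h <= a k ^+ 4 by apply: le_trans bern _; rewrite lerXn2r ?nnegrE.
have bk4 : 1 - 28 * h <= b k ^+ 4 by apply: le_trans bern _; rewrite lerXn2r ?nnegrE.
pose lo := fun i : 'I_K => (i < k)%N; pose up := fun i : 'I_K => (k < i)%N.
have := sum_ord_split k (fun i => a i ^+ 4); rewrite sa.
have := sum_ord_split k (fun i => b i ^+ 4); rewrite sb.
rewrite -(rt4 lo a) -(rt4 lo b) -(rt4 up a) -(rt4 up b).
have := hS k.
have tl x : \sum_i x i ^+ 4 = 1 -> tail x k ^+ 4 = 1 - rt lo x ^+ 4.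
  move=> sx; rewrite /tail root4K; last first.
    by rewrite sumr_ge0 // => i _; rewrite (exprM _ 2 2) sqr_ge0.
  rewrite rt4 -sx [X in _ = X - _](bigID lo) /= addrAC subrr add0r.
  by apply: eq_bigl => i; rewrite /lo -leqNgt.
have := cube_root_bound (tl a sa); have := cube_root_bound (tl b sb).
have ta0 : 0 <= tail a k by exact: root4_ge0.
have tb0 : 0 <= tail b k by exact: root4_ge0.
have Rlo := row_bound (geom_row_below k h1); have Rup := row_bound (geom_row_above k h1).
have Clo := col_bound (geom_row_below k h1); have Cup := col_bound (geom_row_above k h1).
have LU := corner_below k; have UL := corner_above k.
have lola := @le_rt lo a; have lolb := @le_rt lo b.
have lupa := @le_rt up a; have lupb := @le_rt up b.
have xi0 : 0 <= rt lo a by exact: root4_ge0. have ze0 : 0 <= rt up a by exact: root4_ge0.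
have up0 : 0 <= rt lo b by exact: root4_ge0. have om0 : 0 <= rt up b by exact: root4_ge0.

rewrite (total_split k).
move: Rlo Rup Clo Cup LU UL lola lolb lupa lupb xi0 ze0 up0 om0.
have sq_small (x y z : R) : 0 <= x -> 0 <= z -> y = 1 - z -> x ^+ 4 <= z -> 1 - 28 * h <= y -> x ^+ 2 <= 100^-1.
  move=> x0 z0 yz xz yh; have z28 : z <= 28 * h by lra.
  have : (x ^+ 2) ^+ 2 <= (100^-1 : R) ^+ 2.
    rewrite -exprM; apply: le_trans xz _; apply: le_trans z28 _.
    have -> : (100^-1 : R) ^+ 2 = (100 * 100)^-1 by rewrite invfM expr2.
    by rewrite -[leRHS]div1r ler_pdivlMr; move: h0 hsmall3; nra.
  by rewrite ler_pXn2r ?nnegrE ?sqr_ge0 ?invr_ge0.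
set xi := rt lo a; set ze := rt up a; set up' := rt lo b; set om := rt up b.
move=> Rlo Rup Clo Cup LU UL lola lolb lupa lupb xi0 ze0 up0 om0 tb3 ta3 hSk sumb suma.
have x28 : xi ^+ 4 + ze ^+ 4 <= 28 * h by move: suma ak4; lra.
have y28 : up' ^+ 4 + om ^+ 4 <= 28 * h by move: sumb bk4; lra.
have X0 : 0 <= xi ^+ 4 by rewrite exprn_ge0. have Z0 : 0 <= ze ^+ 4 by rewrite exprn_ge0.
have Y0 : 0 <= up' ^+ 4 by rewrite exprn_ge0. have U0 : 0 <= om ^+ 4 by rewrite exprn_ge0.
have sqs (v : R) : 0 <= v -> v ^+ 4 <= 28 * h -> v ^+ 2 <= 100^-1.
  move=> v0 vh; apply: (@sq_small v (1 - 28 * h) (28 * h)) => //.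
  by rewrite mulr_ge0 // ltW.
have xi2 : xi ^+ 2 <= 100^-1 by apply: sqs => //; lra.
have ze2 : ze ^+ 2 <= 100^-1 by apply: sqs => //; lra.
have up2 : up' ^+ 2 <= 100^-1 by apply: sqs => //; lra.
have om2 : om ^+ 2 <= 100^-1 by apply: sqs => //; lra.
have sqle (x y : R) : 0 <= x -> x <= y -> x ^+ 2 <= y ^+ 2.
  by move=> x0 xy; rewrite lerXn2r // nnegrE // (le_trans x0).
have LL := @block_bound lo lo _ _ (fun i Pi => sqle _ _ (a0 i) (lola i Pi)) (fun i Pi => sqle _ _ (b0 i) (lolb i Pi)).
have LG := @block_bound lo up _ _ (fun i Pi => sqle _ _ (a0 i) (lola i Pi)) (fun i Pi => sqle _ _ (b0 i) (lupb i Pi)).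
have GL := @block_bound up lo _ _ (fun i Pi => sqle _ _ (a0 i) (lupa i Pi)) (fun i Pi => sqle _ _ (b0 i) (lolb i Pi)).
have GG := @block_bound up up _ _ (fun i Pi => sqle _ _ (a0 i) (lupa i Pi)) (fun i Pi => sqle _ _ (b0 i) (lupb i Pi)).
move: LL LG GL GG; rewrite -!rt4 -/xi -/ze -/up' -/om -!exprD.
move: Rlo Rup Clo Cup LU UL hSk; rewrite /lo /up.
move: (hF k k); rewrite eqxx mul1r /g /natdist subnn expr0 mulr1.
move: (\sum_(i < K | (i < k)%N) \sum_(j < K | (j < k)%N) F i j) => LL.
move: (\sum_(i < K | (i < k)%N) \sum_(j < K | (k < j)%N) F i j) => LG.
move: (\sum_(i < K | (k < i)%N) \sum_(j < K | (j < k)%N) F i j) => GL.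
move: (\sum_(i < K | (k < i)%N) \sum_(j < K | (k < j)%N) F i j) => GG.
move: (\sum_(i < K | (k < i)%N) F i k) => Ck; move: (\sum_(i < K | (i < k)%N) F i k) => ck.
move: (\sum_(i < K | (k < i)%N) F k i) => Rk; move: (\sum_(i < K | (i < k)%N) F k i) => rk.
move: (F k k) => f Hf Hrk HRk Hck HCk HLG' HGL' HS HLL HLG HGL HGG.
have eh0 : 0 <= eta * hh by rewrite mulr_ge0.
have hh2 : hh <= 2 * h.
  by apply: le_trans hh_le _; apply: small_sq; [exact: ltW | exact: hsmall3].
have eh6 : eta * hh <= 6 * h.
  have -> : 6 * h = 3 * (2 * h) by rewrite mulrA -natrM.
  exact: ler_pM.
have t0 : 0 <= 12 * h by rewrite mulr_ge0 // ltW.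
(* The threshold is twice the value [12 * h] at which the quartic and the cubic terms balance:
   beyond it one side loses [4 * (12 * h) ^+ 4], more than the three others can gain. *)
have [hard|soft] := boolP ((2 * (12 * h) <= ze) || (2 * (12 * h) <= om)).
  have e3 : 0 <= eta <= 3 by rewrite e0 eta3.
  have fw : f <= (1 - 3 / 4 * (xi ^+ 4 + ze ^+ 4)) * (1 - 3 / 4 * (up' ^+ 4 + om ^+ 4)).
    apply: le_trans Hf _; rewrite exprMn; apply: ler_pM; rewrite ?exprn_ge0 //;
      apply: cube_root_bound; [rewrite suma | rewrite sumb]; ring.
  have v6 (v : R) : 0 <= v -> v ^+ 2 <= 100^-1 -> v ^+ 6 <= v ^+ 4 / 100.
    by move=> v0 v2; rewrite (exprD v 4 2) ler_wpM2l // exprn_ge0.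
  have comb := hard_combine (ltW h0) hsmall3 e3 X0 Z0 Y0 U0 (exprn_ge0 3 xi0) (exprn_ge0 3 ze0)
    (exprn_ge0 3 up0) (exprn_ge0 3 om0) x28 y28 eh6 (v6 _ xi0 xi2) (v6 _ ze0 ze2) (v6 _ up0 up2)
    (v6 _ om0 om2) fw Hrk HRk Hck HCk HLL HLG HGL HGG.
  apply: le_trans comb _; rewrite -[leRHS]addrA lerD2l.
  have qm := @quartic_max (12 * h) _ t0; have qn v := @quartic_neg (12 * h) v t0.
  apply: (@le_trans _ _ 0); last first.
    rewrite addr_ge0 ?divr_ge0 ?mulr_ge0 ?subr_ge0 ?exprn_ge0 //; exact: ltW.
  have t4 : 0 <= (12 * h) ^+ 4 by rewrite exprn_ge0.
  apply: (four_terms t4); rewrite ?qm //.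
  by case/orP: hard => /qn; [left | right].
move: soft; rewrite negb_or -!ltNge => /andP[zs os].
have GGb (v : R) : 0 <= v -> v < 2 * (12 * h) -> eta * v ^+ 6 <= 3 * h ^+ 5.
  move=> v0 vs; apply: ler_pM => //; first exact: exprn_ge0.
  apply: (@le_trans _ _ ((2 * (12 * h)) ^+ 6)).
    by rewrite lerXn2r ?nnegrE // ltW // (le_lt_trans v0).
  rewrite mulrA -natrM exprMn (exprS h 5) mulrA ler_piMl // mulrC.
  apply: le_trans hsmall; rewrite ler_wpM2l ?(ltW h0) //.
  rewrite (exprM _ 2 3) (_ : (2 * 12)%:R ^+ 2 = 576 :> R); last by rewrite -natrX.
  apply: (@le_trans _ _ ((10 ^+ 3) ^+ 3)); last first.
    by rewrite -exprM ler_weXn2l // ler1n.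
  have b576 : 576 <= 10 ^+ 3 :> R by rewrite -natrX ler_nat.
  by rewrite lerXn2r ?b576 ?nnegrE ?exprn_ge0 ?ler0n.
have GG6 : GG <= 6 * h ^+ 5.
  apply: le_trans HGG _; rewrite mulrDr (_ : 6 = 3 + 3 :> R); last by ring.
  by rewrite mulrDl lerD ?GGb.
have T5 := ten5 (hX_ge0 5).
have h40 : 0 <= h ^+ 4 by exact: hX_ge0.
have h50 : 0 <= h ^+ 5 by exact: hX_ge0.
(* At [k = 0] there is no factor [1 - h ^+ 4 / 2], but there is also no index below [k] to
   compensate. *)
move: HS; case: ifP => [/eqP k0|k0] HS.
  have lo0 x : rt lo x = 0.
    by rewrite /rt big1 ?/root4 ?sqrtr0 // => i; rewrite /lo k0.
  have xi00 : xi = 0 by exact: lo0. have up00 : up' = 0 by exact: lo0.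
  have S1 : f + Rk + Ck <= 1.
    apply: le_trans HS _; rewrite mul1r exprMn -[leRHS]mul1r; apply: ler_pM; rewrite ?exprn_ge0 //.
      by apply: le_trans ta3 _; rewrite xi00 expr0n mulr0 subr0.
    by apply: le_trans tb3 _; rewrite up00 expr0n mulr0 subr0.
  move: Hrk Hck HLG' HGL' HLL; rewrite xi00 up00 !expr0n /= !(mulr0, addr0) => Hrk Hck HLG' HGL' HLL.
  apply: soft0_combine S1 Hrk Hck HLG' HGL' HLL GG6 _.
    by rewrite divr_ge0 // mulr_ge0 // subr_ge0.
  by apply: le_trans T5; rewrite lerDl; apply: mulr_ge0 => //; apply: mulr_ge0.
have h4h : 0 <= h ^+ 4 <= h.
  by rewrite h40 /= exprS ler_piMr ?(ltW h0) // exprn_ile1 ?ltW.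
have Xh : 0 <= xi ^+ 4 <= 28 * h by rewrite X0 /= (le_trans _ x28) // lerDl.
have Yh : 0 <= up' ^+ 4 <= 28 * h by rewrite Y0 /= (le_trans _ y28) // lerDl.
move: HS; rewrite exprMn => HS.
have comb := soft_combine (ltW h0) hsmall3 h4h (exprn_ge0 3 ta0) (exprn_ge0 3 tb0) Xh Yh ta3 tb3
  HS Hrk Hck HLG' HGL' HLL GG6.
apply: le_trans comb _.
have P0 : 0 <= eta * hh + eta * hh ^+ 2 by rewrite addr_ge0 // mulr_ge0 ?sqr_ge0.
have hP := small_sq_sum (ltW h0) hsmall3 hh0 hh_le.
have PE : eta * hh + eta * hh ^+ 2 <= eta * (h + 4 * h ^+ 2) by rewrite -mulrDr ler_wpM2l.
have Vx := one_var xi0 xi2 P0 PE; have Vy := one_var up0 up2 P0 PE.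
have e81 : 50 * eta ^+ 4 * h ^+ 5 <= 50 * 81 * h ^+ 5.
  rewrite ler_wpM2r // ler_wpM2l // (_ : 81 = 3 ^+ 4 :> R); last by rewrite -natrX.
  by rewrite lerXn2r // nnegrE.
exact: soft_final Vx Vy e81 T5.
Qed.

End OnePrime.

(** A nonzero weight satisfies [8 * h <= a i ^+ 2], so an off-diagonal entry, which carries a factor
    [h], is at most an eighth of [(a i * b j) ^+ 4]. These add up to at most 1 - w^4 with w the
    largest diagonal product, and (1 - w^4)/8 is less than the defect 1 - w of the diagonal. *)
Lemma one_prime_heavy (R : rcfType) (K : nat) (a b : 'I_K -> R) (F : 'I_K -> 'I_K -> R) (h rho : R) :
  (forall i, 0 <= a i) -> (forall i, 0 <= b i) ->
  \sum_i a i ^+ 4 = 1 -> \sum_i b i ^+ 4 = 1 -> 0 < h < 1 -> 64 * h ^+ 2 <= rho ->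
  (forall i j, F i j <= (a i * b j) ^+ 3 * h ^+ natdist i j) ->
  (forall i, a i = 0 \/ rho <= a i ^+ 4) -> (forall i, b i = 0 \/ rho <= b i ^+ 4) ->
  \sum_i \sum_j F i j <= 1.
Proof.
move=> a0 b0 sa sb /andP[h0 h1] hrho hF ha hb.
have [k hk] := diag_le_max a0 b0 sa sb.
have ab0 i j : 0 <= a i * b j by rewrite mulr_ge0.
have w0 : 0 <= a k * b k by [].
have sq8 x : 0 <= x -> x = 0 \/ rho <= x ^+ 4 -> x = 0 \/ 8 * h <= x ^+ 2.
  move=> x0 [->|xr]; [by left|right].
  have : (8 * h) ^+ 2 <= (x ^+ 2) ^+ 2.
    by rewrite -exprM exprMn (le_trans _ xr) // (le_trans _ hrho) // -natrX.
  by rewrite ler_pXn2r ?nnegrE ?sqr_ge0 // mulr_ge0 // ltW.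
have off i j : i != j -> F i j <= (a i * b j) ^+ 4 / 8.
  move=> ij; apply: le_trans (hF i j) _.
  case: (sq8 _ (a0 i) (ha i)) => [->|ai]; first by rewrite mul0r !expr0n /= !mul0r.
  case: (sq8 _ (b0 j) (hb j)) => [->|bj]; first by rewrite mulr0 !expr0n /= !mul0r.
  rewrite (exprSr (a i * b j) 3) -[leRHS]mulrA.
  apply: ler_wpM2l; first by rewrite exprn_ge0.
  have hd : h ^+ natdist i j <= h.
    have : (0 < natdist i j)%N by move: ij; rewrite -(inj_eq val_inj) /natdist /=; clear; lia.
    case: (natdist i j) => // n _; rewrite exprS ler_piMr ?(ltW h0) //.
    by rewrite exprn_ile1 ?ltW.
  apply: le_trans hd _; rewrite ler_pdivlMr ?ltr0n // mulrC.
  have : (8 * h) ^+ 2 <= (a i * b j) ^+ 2.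
    by rewrite [leRHS]exprMn [leLHS]expr2 ler_pM // mulr_ge0 // ltW.
  by rewrite ler_pXn2r ?nnegrE // mulr_ge0 // ltW.
have F_diag i : F i i <= (a i * b i) ^+ 3.
  by apply: le_trans (hF i i) _; rewrite /natdist subnn mulr1.
have a4 i : 0 <= a i ^+ 4 by rewrite exprn_ge0.
have b4 i : 0 <= b i ^+ 4 by rewrite exprn_ge0.
have prod1 : \sum_i \sum_j (a i * b j) ^+ 4 = 1.
  rewrite -[1]mulr1 -{1}sa -sb mulr_suml; apply: eq_bigr => i _.
  by rewrite mulr_sumr; apply: eq_bigr => j _; rewrite exprMn.
have offsum : \sum_i \sum_(j | j != i) (a i * b j) ^+ 4 <= 1 - (a k * b k) ^+ 4.
  rewrite lerBrDl -prod1.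
  rewrite [leRHS](bigD1 k) //= [X in _ <= X + _](bigD1 k) //= -addrA lerD2l.
  rewrite (bigD1 k) //= lerD2l ler_sum // => i _.
  by rewrite [leRHS](bigD1 i) //= lerDr exprn_ge0.
have tot : \sum_i \sum_j F i j <= \sum_i (a i * b i) ^+ 3 + (\sum_i \sum_(j | j != i) (a i * b j) ^+ 4) / 8.
  rewrite mulr_suml -big_split; apply: ler_sum => i _ /=.
  rewrite (bigD1 i) //= lerD // mulr_suml ler_sum // => j ji.
  by apply: off; rewrite eq_sym.
apply: le_trans tot _.
have w1 : a k * b k <= 1.
  have x1 (x : 'I_K -> R) : (forall i, 0 <= x i) -> \sum_i x i ^+ 4 = 1 -> x k <= 1.
    move=> x0 sx; apply: ler_pow4; rewrite // expr1n -sx (bigD1 k) //= lerDl.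
    by apply: sumr_ge0 => j _; rewrite exprn_ge0.
  by rewrite mulr_ile1 // x1.
have bern : 1 - (a k * b k) ^+ 4 <= 4 * (1 - a k * b k).
  move: w0 w1; move: (a k * b k) => w w0 w1.
  have -> : 1 - w ^+ 4 = (1 - w) * ((1 + w) * (1 + w ^+ 2)) by ring.
  rewrite mulrC ler_wpM2r ?subr_ge0 //.
  have -> : (4 : R) = 2 * 2 by ring.
  by rewrite ler_pM ?addr_ge0 ?sqr_ge0 // -[leRHS](natrD _ 1 1) lerD ?exprn_ile1.
lra.
Qed.

(** Reduction to total weights 1 by dividing by the fourth roots [x], [y] of the masses. If a mass
    or [B] vanishes, the pointwise bound makes the sum nonpositive. The identities for arbitrary [P]
    carry the tails in [hS] through the normalization. *)
Lemma normalized_bound (R : rcfType) (K : nat) (al be : 'I_K -> R) (F : 'I_K -> 'I_K -> R)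
    (B eta h kap : R) :
  (forall i, 0 <= al i) -> (forall i, 0 <= be i) -> 0 <= B -> 0 <= kap ->
  (forall i j, F i j <= B * ((if i == j then 1 else eta) *
     ((root4 (al i) * root4 (be j)) ^+ 3 * h ^+ natdist i j))) ->
  (forall (a b : 'I_K -> R) (x y : R), 0 < B -> 0 < x -> 0 < y ->
     x = root4 (\sum_i al i) -> y = root4 (\sum_i be i) ->
     (forall i, 0 <= a i) -> (forall i, 0 <= b i) ->
     \sum_i a i ^+ 4 = 1 -> \sum_i b i ^+ 4 = 1 ->
     (forall i j, F i j / (B * (x * y) ^+ 3) <=
        (if i == j then 1 else eta) * ((a i * b j) ^+ 3 * h ^+ natdist i j)) ->
     (forall P : pred 'I_K, root4 (\sum_(i | P i) al i) = x * root4 (\sum_(i | P i) a i ^+ 4)) ->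
     (forall P : pred 'I_K, root4 (\sum_(i | P i) be i) = y * root4 (\sum_(i | P i) b i ^+ 4)) ->
     \sum_i \sum_j F i j / (B * (x * y) ^+ 3) <= kap) ->
  \sum_i \sum_j F i j <= B * kap * (root4 (\sum_i al i) * root4 (\sum_i be i)) ^+ 3.
Proof.
move=> al0 be0 B0 kap0 hF H.
set x := root4 (\sum_i al i); set y := root4 (\sum_i be i).
have x0 : 0 <= x by exact: root4_ge0. have y0 : 0 <= y by exact: root4_ge0.
have sal : 0 <= \sum_i al i by exact: sumr_ge0.
have sbe : 0 <= \sum_i be i by exact: sumr_ge0.
have root40 : root4 0 = 0 :> R by rewrite /root4 !sqrtr0.
have rpos (v : R) : root4 v = 0 -> 0 <= v -> v = 0.
  by move=> r0 v0; rewrite -(root4K v0) r0 expr0n.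
have degenerate : B * (x * y) = 0 -> \sum_i \sum_j F i j <= 0.
  move=> /eqP; rewrite !mulf_eq0 => deg.
  apply: sumr_le0 => i _; apply: sumr_le0 => j _; apply: le_trans (hF i j) _.
  case/or3P: deg => /eqP; first by move=> ->; rewrite mul0r.
    move=> /rpos /(_ sal) /eqP; rewrite psumr_eq0 // => /allP /(_ i).
    rewrite mem_index_enum => /(_ isT) /eqP ->.
    by rewrite root40 mul0r expr0n /= mul0r mulr0 mulr0.
  move=> /rpos /(_ sbe) /eqP; rewrite psumr_eq0 // => /allP /(_ j).
  rewrite mem_index_enum => /(_ isT) /eqP ->.
  by rewrite root40 mulr0 expr0n /= mul0r mulr0 mulr0.
have [Bxy|Bxy] := eqVneq (B * (x * y)) 0.
  apply: le_trans (degenerate Bxy) _; apply: mulr_ge0; first exact: mulr_ge0.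
  by apply: exprn_ge0; apply: mulr_ge0.
move: Bxy; rewrite !mulf_eq0 !negb_or => /and3P[Bn xn yn].
have Bp : 0 < B by rewrite lt_def Bn.
have xp : 0 < x by rewrite lt_def xn. have yp : 0 < y by rewrite lt_def yn.
have x4 : x ^+ 4 = \sum_i al i by rewrite root4K.
have y4 : y ^+ 4 = \sum_i be i by rewrite root4K.
have D0 : 0 < B * (x * y) ^+ 3 by rewrite mulr_gt0 // exprn_gt0 // mulr_gt0.
have fac (g : 'I_K -> R) s : 0 < s -> (forall i, 0 <= g i) ->
    forall P : pred 'I_K, root4 (\sum_(i | P i) g i) = s * root4 (\sum_(i | P i) (root4 (g i) / s) ^+ 4).
  move=> s0 g0 P; rewrite -[X in _ = X * _](root4_exp4 (ltW s0)) -root4M ?exprn_ge0 ?ltW //.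
  congr root4; rewrite mulr_sumr; apply: eq_bigr => i _.
  by rewrite expr_div_n root4K // [RHS]mulrC divfK // expf_neq0 // gt_eqF.
have := H (fun i => root4 (al i) / x) (fun i => root4 (be i) / y) x y Bp xp yp erefl erefl.
have nonneg (g : 'I_K -> R) s : 0 < s -> forall i, 0 <= root4 (g i) / s.
  by move=> s0 i; rewrite divr_ge0 ?root4_ge0 // ltW.
have unit (g : 'I_K -> R) s : s ^+ 4 = \sum_i g i -> 0 < s -> (forall i, 0 <= g i) ->
    \sum_i (root4 (g i) / s) ^+ 4 = 1.
  move=> s4 s0 g0; rewrite (eq_bigr (fun i => g i / s ^+ 4)) => [|i _]; last first.
    by rewrite expr_div_n root4K.
  by rewrite -mulr_suml -s4 divff // expf_neq0 // gt_eqF.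
move=> /(_ (nonneg _ _ xp) (nonneg _ _ yp) (unit _ _ x4 xp al0) (unit _ _ y4 yp be0)).
have bnd i j : F i j / (B * (x * y) ^+ 3) <= (if i == j then 1 else eta) *
    ((root4 (al i) / x * (root4 (be j) / y)) ^+ 3 * h ^+ natdist i j).
  rewrite ler_pdivrMr //; apply: le_trans (hF i j) _; rewrite le_eqVlt; apply/orP; left; apply/eqP.
  move: (if _ then _ else _) (h ^+ _) => e hn; field.
  by rewrite xn yn.
move=> /(_ bnd (fac _ _ xp al0) (fac _ _ yp be0)).
under eq_bigr => i _ do rewrite -mulr_suml.
rewrite -mulr_suml ler_pdivrMr // (_ : kap * _ = B * kap * (x * y) ^+ 3) //.
by rewrite (mulrC B kap) -[RHS]mulrA.
Qed.

(** * Vertex removal and anatomy of integers *)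

Lemma bigD1_seq_cond (T : Type) (idx : T) (op : Monoid.com_law idx) (I : eqType) (r : seq I)
    (P : pred I) (F : I -> T) j : j \in r -> uniq r -> P j ->
  \big[op/idx]_(i <- r | P i) F i = op (F j) (\big[op/idx]_(i <- r | P i && (i != j)) F i).
Proof.
move=> jr ur Pj; rewrite big_mkcond (bigD1_seq j) //= Pj -big_mkcondr; congr (op _ _).
by apply: eq_bigl => i; rewrite andbC.
Qed.

(** As a function of the mass M, the bound 2 sqrt(K M N) is concave with derivative sqrt(K N / M).
    The hypothesis on [d] says that the degree is at most this derivative at the larger mass, so
    adding a vertex of mass [m] is paid for. *)
Lemma vertex_removal (R : rcfType) (T' d M' N K m : R) :
  0 <= K -> 0 <= N -> 0 <= M' -> 0 <= m -> 0 <= d ->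
  T' <= 2 * Num.sqrt (K * M' * N) -> d ^+ 2 * (M' + m) <= K * N ->
  T' + m * d <= 2 * Num.sqrt (K * (M' + m) * N).
Proof.
move=> K0 N0 M0 m0 d0; set k := Num.sqrt (K * N).
have kE x : 0 <= x -> Num.sqrt (K * x * N) = k * Num.sqrt x.
  by move=> x0; rewrite mulrAC sqrtrM // mulr_ge0.
rewrite !kE ?addr_ge0 //; set s' := Num.sqrt M'; set s := Num.sqrt (M' + m) => HT Hd.
have s0 : 0 <= s by exact: sqrtr_ge0. have s'0 : 0 <= s' by exact: sqrtr_ge0.
have k0 : 0 <= k by exact: sqrtr_ge0.
have s2 : s ^+ 2 = M' + m by rewrite sqr_sqrtr // addr_ge0.
have s'2 : s' ^+ 2 = M' by rewrite sqr_sqrtr.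
have ds : d * s <= k.
  have : (d * s) ^+ 2 <= k ^+ 2 by rewrite exprMn s2 sqr_sqrtr ?mulr_ge0.
  by rewrite ler_pXn2r // nnegrE // mulr_ge0.
have mE : m = s ^+ 2 - s' ^+ 2 by rewrite s2 s'2 addrC addKr.
have [sz|sn] := eqVneq s 0.
  have m00 : m = 0.
    by apply/eqP; rewrite eq_le m0 andbT mE sz expr0n /= sub0r oppr_le0; exact: sqr_ge0.
  rewrite m00 mul0r addr0 sz mulr0 mulr0; apply: le_trans HT _.
  have -> : s' = 0.
    by apply/eqP; rewrite -sqrf_eq0 s'2 -[M']addr0 -{1}m00 -s2 sz expr0n.
  by rewrite !mulr0.
have sp : 0 < s by rewrite lt_def sn.
rewrite -(ler_pM2r sp) mulrDl.
have h1 : T' * s <= 2 * (k * s') * s by rewrite ler_pM2r.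
have h2 : m * d * s <= m * k by rewrite -mulrA ler_wpM2l.
have h3 : 0 <= k * (s - s') ^+ 2 by rewrite mulr_ge0 ?sqr_ge0.
have h4 : k * (s - s') ^+ 2 = 2 * (k * s) * s - 2 * (k * s') * s - m * k.
  by rewrite mE; ring.
lra.
Qed.

(** * Edge sums of weighted bipartite graphs *)

Section Structured.
Variables (R : rcfType) (S : seq nat) (mu nu r s : nat -> R) (x y : nat -> nat) (E : rel nat).
Variables (K1 K2 C1 C2 : R).
Hypotheses (uS : uniq S) (mu0 : forall v, 0 <= mu v) (nu0 : forall v, 0 <= nu v).
Hypotheses (K10 : 0 <= K1) (K20 : 0 <= K2) (C10 : 0 <= C1) (C20 : 0 <= C2).
Hypotheses (r0 : forall v, 0 <= r v) (s0 : forall v, 0 <= s v).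

Let mass (f : nat -> R) (A : pred nat) := \sum_(v <- S | A v) f v.
Let tot (A B : pred nat) := \sum_(v <- S | A v) \sum_(w <- S | B w && E v w) mu v * nu w.

Let mass_rem (f : nat -> R) (A : pred nat) v : v \in S -> A v ->
  mass f A = mass f (fun u => A u && (u != v)) + f v.
Proof. by move=> vS Av; rewrite /mass (@bigD1_seq_cond _ _ _ _ _ _ _ v) //= addrC. Qed.

Let count_rem (A : pred nat) v : v \in S -> A v ->
  count A S = (count (fun u => A u && (u != v)) S).+1.
Proof.
move=> vS Av; rewrite -!sum1_count (@bigD1_seq_cond _ _ _ _ _ _ _ v) //= add1n; congr _.+1.
Qed.

(** Take [v0] with the largest [x] and [w0] with the largest [y]. The neighbours of [v0] have [y] at
    most [y w0], so the counting hypothesis bounds the degree of [v0] by a multiple of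
    [y w0 / x v0], and symmetrically for [w0]. One of the two vertices has a degree small enough for
    [vertex_removal]; delete it and induct. *)
Lemma structured_bound (A B : pred nat) :
  (forall v, v \in S -> A v -> (0 < x v)%N) -> (forall w, w \in S -> B w -> (0 < y w)%N) ->
  (forall v w, v \in S -> w \in S -> A v -> B w -> E v w -> mu v * (y w)%:R <= K1 * r v) ->
  (forall v w, v \in S -> w \in S -> A v -> B w -> E v w -> nu w * (x v)%:R <= K2 * s w) ->
  (forall X, \sum_(v <- S | A v && (x v <= X)%N) r v <= C1 * X%:R) ->
  (forall X, \sum_(w <- S | B w && (y w <= X)%N) s w <= C2 * X%:R) ->
  tot A B <= 2 * Num.sqrt (K1 * C1 * (K2 * C2) * mass mu A * mass nu B).
Proof.
have [n] := ubnP (count A S + count B S)%N; elim: n A B => // n IH A B cn xp yp H1 H2 HA HB.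
have K0 : 0 <= K1 * C1 * (K2 * C2) by rewrite !mulr_ge0.
have massmu0 (P : pred nat) : 0 <= mass mu P by exact: sumr_ge0.
have massnu0 (P : pred nat) : 0 <= mass nu P by exact: sumr_ge0.
have rhs0 : 0 <= 2 * Num.sqrt (K1 * C1 * (K2 * C2) * mass mu A * mass nu B).
  by rewrite mulr_ge0 ?sqrtr_ge0.
have maxi (P : pred nat) (f : nat -> nat) : has P S ->
    exists v, [/\ v \in S, P v & forall u, u \in S -> P u -> (f u <= f v)%N].
  move=> /hasP[v1 v1S Pv1].
  have : exists k, has (fun v => P v && (f v == k)) S.
    by exists (f v1); apply/hasP; exists v1 => //; rewrite Pv1 /=.
  have bound k : has (fun v => P v && (f v == k)) S -> (k <= \max_(v <- S) f v)%N.
    by move=> /hasP[v vS /andP[_ /eqP <-]]; exact: leq_bigmax_seq.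
  move=> ex; have [k /hasP[v vS /andP[Pv /eqP fv]] kmax] := ex_maxnP ex bound.
  exists v; split=> // u uS' Pu; rewrite fv; apply: kmax; apply/hasP; exists u => //.
  by rewrite Pu /=.
have [hA|nA] := boolP (has A S); last first.
  by rewrite /tot -big_filter (eqP _ : [seq v <- S | A v] = [::]) ?big_nil // -size_eq0 size_filter -leqn0 leqNgt -has_count.
have [hB|nB] := boolP (has B S); last first.
  rewrite /tot big1 // => v _; rewrite big1_seq // => w /andP[/andP[Bw _] wS].
  by move/hasPn: nB => /(_ w wS); rewrite Bw.
have [v0 [v0S Av0 v0max]] := maxi A x hA; have [w0 [w0S Bw0 w0max]] := maxi B y hB.
pose dv := \sum_(w <- S | B w && E v0 w) nu w; pose dw := \sum_(v <- S | A v && E v w0) mu v.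
have dv0 : 0 <= dv by exact: sumr_ge0.
have dw0 : 0 <= dw by exact: sumr_ge0.
have xv0 : 0 < (x v0)%:R :> R by rewrite ltr0n xp.
have yw0 : 0 < (y w0)%:R :> R by rewrite ltr0n yp.
have dvb : dv * (x v0)%:R <= K2 * (C2 * (y w0)%:R).
  apply: le_trans (ler_wpM2l K20 (HB (y w0))); rewrite mulr_suml mulr_sumr.
  rewrite big_seq_cond [leRHS]big_seq_cond.
  apply: (@le_trans _ _ (\sum_(w <- S | [&& w \in S, B w & E v0 w]) K2 * s w)).
    by apply: ler_sum => w /and3P[wS Bw Ew]; apply: H2.
  rewrite [leRHS](bigID (fun w => E v0 w)) /=.
  rewrite [X in _ <= X + _](eq_bigl (fun w => [&& w \in S, B w & E v0 w])); last first.
    move=> w; case wS: (w \in S) => //=; case Bw: (B w) => //=.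
    by rewrite w0max.
  by rewrite lerDl; apply: sumr_ge0 => w _; rewrite mulr_ge0.
have dwb : dw * (y w0)%:R <= K1 * (C1 * (x v0)%:R).
  apply: le_trans (ler_wpM2l K10 (HA (x v0))); rewrite mulr_suml mulr_sumr.
  rewrite big_seq_cond [leRHS]big_seq_cond.
  apply: (@le_trans _ _ (\sum_(v <- S | [&& v \in S, A v & E v w0]) K1 * r v)).
    by apply: ler_sum => v /and3P[vS Av Ev]; apply: H1.
  rewrite [leRHS](bigID (fun v => E v w0)) /=.
  rewrite [X in _ <= X + _](eq_bigl (fun v => [&& v \in S, A v & E v w0])); last first.
    move=> v; case vS: (v \in S) => //=; case Av: (A v) => //=.
    by rewrite v0max.
  by rewrite lerDl; apply: sumr_ge0 => v _; rewrite mulr_ge0.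
(* The ratios [y w0 / x v0] and [x v0 / y w0] cancel in the product of the degrees. *)
have dd : dv * dw <= K1 * C1 * (K2 * C2).
  have := ler_pM (mulr_ge0 dv0 (ltW xv0)) (mulr_ge0 dw0 (ltW yw0)) dvb dwb.
  have xy0 : 0 < (x v0)%:R * (y w0)%:R :> R by rewrite mulr_gt0.
  have -> : dv * (x v0)%:R * (dw * (y w0)%:R) = dv * dw * ((x v0)%:R * (y w0)%:R) by ring.
  have -> : K2 * (C2 * (y w0)%:R) * (K1 * (C1 * (x v0)%:R)) =
     K1 * C1 * (K2 * C2) * ((x v0)%:R * (y w0)%:R) by ring.
  by rewrite ler_pM2r.
set K := K1 * C1 * (K2 * C2) in dd K0 rhs0 IH *.
pose A' u := A u && (u != v0); pose B' u := B u && (u != w0).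
have totA : tot A B = tot A' B + mu v0 * dv.
  by rewrite /tot (@bigD1_seq_cond _ _ _ _ _ _ _ v0) //= addrC; congr (_ + _); rewrite mulr_sumr.
have totB : tot A B = tot A B' + nu w0 * dw.
  rewrite /tot mulr_sumr [X in _ + X]big_mkcondr /= -big_split /=; apply: eq_bigr => v Av.
  case: ifP => Ev; last first.
    rewrite addr0; apply: eq_bigl => w; rewrite /B'; case: eqP => [->|]; last by rewrite andbT.
    by rewrite Ev !andbF.
  rewrite (@bigD1_seq_cond _ _ _ _ _ _ _ w0) //= ?Bw0 // addrC mulrC; congr (_ + _).
  by apply: eq_bigl => w; rewrite /B' -!andbA; congr (_ && _); rewrite andbC.
have [caseA|caseA] := lerP (dv ^+ 2 * mass mu A) (K * mass nu B).
  rewrite totA (mass_rem mu v0S Av0); apply: vertex_removal => //.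
    apply: IH => //.
    - by move: cn; rewrite (count_rem v0S Av0) addSn ltnS.
    - by move=> v vS /andP[Av _]; exact: xp.
    - by move=> v w vS wS /andP[Av _]; exact: H1.
    - by move=> v w vS wS /andP[Av _]; exact: H2.
    - move=> X; apply: le_trans (HA X); rewrite big_mkcond [leRHS]big_mkcond ler_sum // => v _.
      rewrite /A'; case: (A v) => //=; case: (v != v0) => //=; case: ifP => //.
  by rewrite -(mass_rem mu v0S Av0).
(* If both removals failed, multiplying the two strict inequalities would contradict [dd]. *)
have caseB : dw ^+ 2 * mass nu B <= K * mass mu A.
  rewrite leNgt; apply/negP => caseB.
  have := ltr_pM (mulr_ge0 K0 (massnu0 B)) (mulr_ge0 K0 (massmu0 A)) caseA caseB.
  have -> : K * mass nu B * (K * mass mu A) = K ^+ 2 * (mass mu A * mass nu B) by ring.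
  have -> : dv ^+ 2 * mass mu A * (dw ^+ 2 * mass nu B) = (dv * dw) ^+ 2 * (mass mu A * mass nu B) by ring.
  apply/negP; rewrite -leNgt; apply: ler_wpM2r; first exact: mulr_ge0.
  by rewrite lerXn2r ?nnegrE ?mulr_ge0.
rewrite totB (mass_rem nu w0S Bw0) mulrAC.
rewrite (_ : K * (_ + _) * _ = K * (mass nu B' + nu w0) * mass mu A) //.
apply: vertex_removal => //.
  rewrite mulrAC; apply: IH => //.
  - by move: cn; rewrite (count_rem w0S Bw0) addnS ltnS.
  - by move=> v vS /andP[Av _]; exact: yp.
  - by move=> v w vS wS Av /andP[Bw _]; exact: H1.
  - by move=> v w vS wS Av /andP[Bw _]; exact: H2.
  - move=> X; apply: le_trans (HB X); rewrite big_mkcond [leRHS]big_mkcond ler_sum // => v _.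
    rewrite /B'; case: (B v) => //=; case: (v != w0) => //=; case: ifP => //.
by rewrite -(mass_rem nu w0S Bw0).
Qed.

End Structured.

Lemma sum_uniq_sub (R : numDomainType) (I : eqType) (s t : seq I) (f : I -> R) :
  uniq s -> uniq t -> {subset s <= t} -> (forall i, i \in t -> 0 <= f i) ->
  \sum_(i <- s) f i <= \sum_(i <- t) f i.
Proof.
move=> us ut st f0; rewrite [leRHS](bigID (fun i => i \in s)) /=.
have -> : \sum_(i <- t | i \in s) f i = \sum_(i <- s) f i.
  rewrite -big_filter; apply: perm_big; apply: uniq_perm; rewrite ?filter_uniq // => i.
  by rewrite mem_filter; case: (boolP (i \in s)) => //= /st.
rewrite lerDl big_seq_cond sumr_ge0 // => i /andP[it _]; exact: f0.
Qed.

Lemma sum_inv_sq_tail (R : realFieldType) (z : nat) (s : seq nat) : (0 < z)%N -> uniq s ->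
  all (fun q => (z < q)%N) s -> \sum_(q <- s) (q%:R ^- 2 : R) <= z%:R^-1.
Proof.
move=> z0 us /allP sz.
have [N sN] : exists N, {subset s <= iota z.+1 N}.
  exists (\max_(q <- s) q).+1 => q qs; rewrite mem_iota sz // addSn ltnS.
  by apply: leq_trans (leq_addl z _); apply: leqW; exact: leq_bigmax_seq.
apply: (@le_trans _ _ (\sum_(q <- iota z.+1 N) (q%:R ^- 2 : R))).
  by apply: sum_uniq_sub => //; exact: iota_uniq.
suff H : forall N, \sum_(q <- iota z.+1 N) (q%:R ^- 2 : R) <= z%:R^-1 - (z + N)%:R^-1.
  by apply: le_trans (H N) _; rewrite gerBl invr_ge0.
clear N sN s us sz => N; elim: N => [|N IH]; first by rewrite big_nil addn0 subrr.
rewrite -(addn1 N) iotaD big_cat /= big_cons big_nil addr0 addSn.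
set n := (z + N)%N in IH *; have n0 : (0 < n)%N by rewrite addn_gt0 z0.
apply: le_trans (lerD IH (lexx _)) _; rewrite addnA -/n addn1 -addrA lerD2l.
rewrite addrC lerBlDr addrC.
have np : 0 < n%:R :> R by rewrite ltr0n.
have n1p : 0 < n.+1%:R :> R by rewrite ltr0n.
have -> : n.+1%:R = n%:R + 1 :> R by rewrite -natr1.
rewrite -subr_ge0.
have -> : n%:R^-1 - (n%:R + 1)^-1 - (n%:R + 1) ^- 2 = (n%:R * (n%:R + 1) ^+ 2)^-1 :> R.
  by field; rewrite gt_eqF ?addr_gt0 // gt_eqF.
by rewrite invr_ge0 mulr_ge0 ?sqr_ge0.
Qed.

Lemma sum_multiples (R : nmodType) (q X : nat) (f : nat -> R) : (0 < q)%N ->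
  \sum_(k <- iota 1 X | (q %| k)%N) f k = \sum_(u <- iota 1 (X %/ q)) f (q * u)%N.
Proof.
move=> q0; rewrite -big_filter -(big_map (fun u => q * u)%N xpredT f); apply: perm_big.
apply: uniq_perm.
- by rewrite filter_uniq // iota_uniq.
- by rewrite map_inj_uniq ?iota_uniq // => x y /eqP; rewrite eqn_pmul2l // => /eqP.
move=> k; rewrite mem_filter mem_iota add1n ltnS; apply/andP/mapP.
  move=> [/dvdnP[u ->]]; rewrite muln_gt0 mulnC => /andP[/andP[u0 _] uX].
  by exists u => //; rewrite mem_iota u0 add1n ltnS leq_divRL // mulnC.
move=> [u]; rewrite mem_iota add1n ltnS leq_divRL // => /andP[u0 uX] ->.
by rewrite dvdn_mulr // muln_gt0 q0 u0 mulnC uX.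
Qed.

(** The primes are added one at a time: the extra weight [eta q] sits on the multiples of [q], and
    writing k = q u turns it into the same count up to X / q. An error term of size sqrt X is
    divided by sqrt q in this passage, so it stays under control whenever the sum of
    [eta q / sqrt q] does; a constant error would not. *)
Lemma weighted_count (R : rcfType) (Q : seq nat) (eta : nat -> R) (P : pred nat) (c1 c2 : R) :
  all prime Q -> uniq Q -> (forall q, 0 <= eta q) -> 0 <= c1 -> 0 <= c2 ->
  (forall q u, q \in Q -> P (q * u)%N -> P u) ->
  (forall X, \sum_(k <- iota 1 X | P k) 1 <= c1 * X%:R + c2 * Num.sqrt X%:R) ->
  forall X, \sum_(k <- iota 1 X | P k) \prod_(q <- Q | (q %| k)%N) (1 + eta q) <=
    c1 * X%:R * \prod_(q <- Q) (1 + eta q / q%:R) +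
    c2 * Num.sqrt X%:R * \prod_(q <- Q) (1 + eta q / Num.sqrt q%:R).
Proof.
move=> pQ uQ eta0 c10 c20 + base; elim: Q pQ uQ => [_ _ _ X|q Q IH /= /andP[pq pQ] /andP[qQ uQ] down X].
  rewrite !big_nil !mulr1; under eq_bigr => k _ do rewrite big_nil; exact: base.
have {}IH Y := IH pQ uQ (fun r u rQ => down r u (mem_behead (s := q :: Q) rQ)) Y.
have q0 : (0 < q)%N by exact: prime_gt0.
have qR : 0 < q%:R :> R by rewrite ltr0n.
have w0 k : 0 <= \prod_(r <- Q | (r %| k)%N) (1 + eta r).
  by apply: prodr_ge0 => r _; rewrite addr_ge0.
apply: (@le_trans _ _ (\sum_(k <- iota 1 X | P k) \prod_(r <- Q | (r %| k)%N) (1 + eta r) +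
   eta q * \sum_(k <- iota 1 (X %/ q) | P k) \prod_(r <- Q | (r %| k)%N) (1 + eta r))).
  apply: (@le_trans _ _ (\sum_(k <- iota 1 X | P k) \prod_(r <- Q | (r %| k)%N) (1 + eta r) +
   \sum_(k <- iota 1 X | P k && (q %| k)%N) eta q * \prod_(r <- Q | (r %| k)%N) (1 + eta r))).
    rewrite [X in _ <= _ + X]big_mkcondr -big_split /= ler_sum // => k Pk.
    rewrite big_cons; case: ifP => qk; first by rewrite mulrDl mul1r.
    by rewrite addr0.
  rewrite lerD2l mulr_sumr (eq_bigl (fun k => (q %| k)%N && P k)); last by move=> k; rewrite andbC.
  rewrite big_mkcondr sum_multiples // [leRHS]big_mkcond /= ler_sum // => u _.
  case: ifP => [/(down q u (mem_head _ _)) -> |_]; last first.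
    by case: ifP => // _; rewrite mulr_ge0.
  rewrite ler_wpM2l // le_eqVlt; apply/orP; left; apply/eqP.
  rewrite big_seq_cond [RHS]big_seq_cond; apply: eq_bigl => r.
  case rQ: (r \in Q) => //=; have pr := allP pQ _ rQ; rewrite Euclid_dvdM // dvdn_prime2 //.
  by case: eqP => //= rq; move: qQ; rewrite -rq rQ.
rewrite !big_cons; move: (IH X) (IH (X %/ q)%N).
set A := \prod_(r <- Q) _; set B := \prod_(r <- Q) _ => h1 h2.
have A0 : 0 <= A by apply: prodr_ge0 => r _; rewrite addr_ge0 // divr_ge0.
have B0 : 0 <= B by apply: prodr_ge0 => r _; rewrite addr_ge0 // divr_ge0 // sqrtr_ge0.
have Xq : (X %/ q)%:R <= X%:R / q%:R :> R.
  by rewrite ler_pdivlMr // -natrM ler_nat leq_trunc_div.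
have sXq : Num.sqrt (X %/ q)%:R <= Num.sqrt X%:R / Num.sqrt q%:R :> R.
  by rewrite -sqrtrV ?ler0n // -sqrtrM ?ler0n // ler_wsqrtr.
apply: le_trans (lerD h1 (ler_wpM2l (eta0 q) h2)) _.
have e1 : eta q * (c1 * (X %/ q)%:R * A) <= eta q * (c1 * (X%:R / q%:R) * A).
  by rewrite ler_wpM2l // ler_wpM2r // ler_wpM2l.
have e2 : eta q * (c2 * Num.sqrt (X %/ q)%:R * B) <= eta q * (c2 * (Num.sqrt X%:R / Num.sqrt q%:R) * B).
  by rewrite ler_wpM2l // ler_wpM2r // ler_wpM2l.
rewrite mulrDr; apply: le_trans (lerD (lexx _) (lerD e1 e2)) _.
rewrite le_eqVlt; apply/orP; left; apply/eqP; ring.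
Qed.

Section Anatomy.
Variables (R : realType) (Q : seq nat) (z : nat).
Hypotheses (pQ : all prime Q) (uQ : uniq Q) (z0 : (0 < z)%N).

Definition Lsum (n : nat) : R := \sum_(q <- Q | (z < q)%N && (q %| n)%N) q%:R^-1.

Lemma expR_le1Mx (t : R) : 0 <= t -> expR t <= 1 + t * expR t.
Proof.
move=> t0; have := expR_ge1Dx (- t); rewrite expRN => H.
have e0 := expR_gt0 t.
have : (1 - t) * expR t <= 1 by rewrite -ler_pdivlMr // mul1r.
lra.
Qed.

Lemma prod_1D_le_expR (I : Type) (s : seq I) (f : I -> R) :
  (forall i, 0 <= f i) -> \prod_(i <- s) (1 + f i) <= expR (\sum_(i <- s) f i).
Proof.
move=> f0; elim: s => [|i s IH]; first by rewrite !big_nil expR0.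
rewrite !big_cons expRD ler_pM ?expR_ge1Dx ?addr_ge0 // prodr_ge0 // => j _.
by rewrite addr_ge0.
Qed.

(** An exponential moment with parameter [8 * z]. Its weight at [q] is at most [1 + eta q] with
    [eta q] of size z / q, and the sum of z / q^2 over q > z is bounded. The 8 is what is needed
    later: a fourth root reduces it to 2, and splitting an excess between two endpoints halves that
    again. *)
Lemma anatomy (h : R) (X : nat) :
  \sum_(k <- iota 1 X | h <= Lsum k) 1 <= expR (8 * expR 8) * X%:R * expR (- (8 * z%:R * h)).
Proof.
have zR : 0 < z%:R :> R by rewrite ltr0n.
pose eta q : R := 8 * expR 8 * z%:R / q%:R.
have eta0 q : 0 <= eta q by rewrite divr_ge0 // !mulr_ge0 ?expR_ge0.
set Qz := [seq q <- Q | (z < q)%N].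
have wt k : expR (8 * z%:R * Lsum k) <= \prod_(q <- Qz | (q %| k)%N) (1 + eta q).
  rewrite /Lsum mulr_sumr expR_sum /Qz big_filter_cond /=; apply: ler_prod => q /andP[zq _].
  rewrite expR_ge0 /=; have q0 : 0 < q%:R :> R by rewrite ltr0n (leq_ltn_trans _ zq).
  set t := 8 * z%:R / q%:R.
  have t0 : 0 <= t by rewrite divr_ge0 ?mulr_ge0.
  have t8 : t <= 8 by rewrite /t ler_pdivrMr // ler_wpM2l // ler_nat ltnW.
  apply: le_trans (expR_le1Mx t0) _; rewrite lerD2l /eta.
  have -> : 8 * expR 8 * z%:R / q%:R = t * expR 8 by rewrite /t; ring.
  by rewrite ler_wpM2l // ler_expR.
have := @weighted_count R Qz eta xpredT 1 0.
have pQz : all prime Qz by apply/allP => q; rewrite mem_filter => /andP[_]; exact: (allP pQ).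
move=> /(_ pQz (filter_uniq _ uQ) eta0 ler01 (lexx 0) (fun _ _ _ _ => isT)).
have base Y : \sum_(k <- iota 1 Y | xpredT k) 1 <= 1 * Y%:R + 0 * Num.sqrt Y%:R :> R.
  by rewrite mul0r addr0 mul1r big_const_seq count_predT size_iota iter_addr_0.
move=> /(_ base X); rewrite !mul0r addr0 mul1r => W.
have prodE : \prod_(q <- Qz) (1 + eta q / q%:R) <= expR (8 * expR 8).
  apply: le_trans (prod_1D_le_expR Qz (f := fun q => eta q / q%:R) _) _.
    by move=> q; rewrite divr_ge0.
  rewrite ler_expR (eq_bigr (fun q => 8 * expR 8 * z%:R * q%:R ^- 2)); last first.
    by move=> q _; rewrite /eta -[LHS]mulrA -invfM -expr2.
  rewrite -mulr_sumr -ler_pdivlMl ?mulr_gt0 ?expR_gt0 //.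
  rewrite invfM mulrAC mulVf ?mul1r ?gt_eqF ?mulr_gt0 ?expR_gt0 //.
  apply: sum_inv_sq_tail => //; first exact: filter_uniq.
  by apply/allP => q; rewrite mem_filter => /andP[].
set e := expR (8 * expR 8) in prodE *; set s := 8 * z%:R.
apply: (@le_trans _ _ (\sum_(k <- iota 1 X | xpredT k) expR (s * Lsum k) * expR (- (s * h)))).
  rewrite [leLHS]big_mkcond ler_sum // => k _; case: ifP => hk.
    by rewrite -expRD -expR0 ler_expR -mulrBr mulr_ge0 ?subr_ge0 ?mulr_ge0.
  by rewrite mulr_ge0 ?expR_ge0.
rewrite -mulr_suml ler_wpM2r ?expR_ge0 //.
apply: le_trans (ler_sum _ (fun k _ => wt k)) _; apply: le_trans W _.
by rewrite mulrC ler_wpM2r.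
Qed.

End Anatomy.

(** * The overlap estimate *)

Definition phi_ratio {R : realType} (Q : seq nat) (d : nat) : R :=
  \prod_(q <- Q | (q %| d)%N) (1 - q%:R^-1).

(** Multiplicative, with local factor p^(-|i - j|) for valuations i and j; its fourth root is the
    origin of the kernel [h ^+ natdist i j]. *)
Definition gcd_ratio {R : realType} (a b : nat) : R := (gcdn a b)%:R ^+ 2 / (a%:R * b%:R).

Definition Lpair {R : realType} (Q : seq nat) (z : nat) (v w : nat) : R :=
  \sum_(q <- Q | (z < q)%N && (logn q v != logn q w)) q%:R^-1.

Section Arith.
Variables (R : realType) (Q : seq nat).
Hypotheses (pQ : all prime Q) (uQ : uniq Q).

Lemma one_sub_inv_bounds (q : nat) : q \in Q -> 0 < (1 : R) - q%:R^-1 <= 1.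
Proof.
move=> /(allP pQ) /prime_gt1 q1; have q0 : 0 < q%:R :> R by rewrite ltr0n ltnW.
rewrite subr_gt0 invf_lt1 // ltr1n q1 /=.
by rewrite gerBl invr_ge0.
Qed.

Lemma phi_ratio_gt0 d : 0 < phi_ratio Q d :> R.
Proof.
rewrite /phi_ratio big_seq_cond; apply: prodr_gt0 => q /andP[/one_sub_inv_bounds].
by case/andP.
Qed.

Lemma phi_ratio_le1 d : phi_ratio Q d <= 1 :> R.
Proof.
rewrite /phi_ratio big_seq_cond -[leRHS](@big1_eq _ _ *%R _ Q (fun q => (q \in Q) && (q %| d)%N)).
by apply: ler_prod => q /andP[/one_sub_inv_bounds /andP[/ltW -> ->]].
Qed.

Lemma phi_ratio_dvd a v : (a %| v)%N -> phi_ratio Q v <= phi_ratio Q a :> R.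
Proof.
move=> av; rewrite /phi_ratio big_seq_cond [leRHS]big_seq_cond big_mkcond [leRHS]big_mkcond.
apply: ler_prod => q _; case qQ: (q \in Q) => /=; last by rewrite ler01 lexx.
have /andP[f0 f1] := one_sub_inv_bounds qQ.
case qa: (q %| a)%N; first by rewrite (dvdn_trans qa av) (ltW f0) lexx.
by case: ifP => _; rewrite ?ler01 ?lexx ?f1 ?(ltW f0).
Qed.

Lemma phi_ratio_mul_pow a p i : prime p -> ~~ (p %| a)%N ->
  phi_ratio Q (a * p ^ i) =
    phi_ratio Q a * (if (p \in Q) && (0 < i)%N then 1 - p%:R^-1 else 1) :> R.
Proof.
move=> pp pa; rewrite /phi_ratio.
have dvdE q : prime q -> (q %| a * p ^ i)%N = (q %| a)%N || (q == p) && (0 < i)%N.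
  by move=> pq; rewrite Euclid_dvdM // Euclid_dvdX // (dvdn_prime2 pq pp).
case: ifP => [/andP[pinQ i0]|neg].
  rewrite (@bigD1_seq_cond _ _ _ _ _ _ _ p) //=; last by rewrite dvdE // eqxx i0 orbT.
  rewrite mulrC; congr (_ * _); rewrite big_seq_cond [RHS]big_seq_cond; apply: eq_bigl => q.
  case qQ: (q \in Q) => //=; rewrite dvdE ?(allP pQ) //.
  by case: eqP => [->|_] /=; rewrite ?andbF ?andbT ?orbF ?(negPf pa).
rewrite mulr1 big_seq_cond [RHS]big_seq_cond; apply: eq_bigl => q.
case qQ: (q \in Q) => //=; rewrite dvdE ?(allP pQ) //.
by case: eqP neg => [<-|_ _] /=; [rewrite qQ /= => -> |]; rewrite orbF.
Qed.

Lemma gcdn_mul_pow a b p i j : prime p -> ~~ (p %| a)%N -> ~~ (p %| b)%N ->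
  gcdn (a * p ^ i) (b * p ^ j) = (gcdn a b * p ^ minn i j)%N.
Proof.
move=> pp pa pb; wlog ij : a b i j pa pb / (i <= j)%N.
  move=> H; case/orP: (leq_total i j) => ij; first exact: H.
  by rewrite gcdnC H // gcdnC minnC.
have -> : (b * p ^ j = b * p ^ (j - i) * p ^ i)%N by rewrite -mulnA -expnD subnK.
rewrite -muln_gcdl (minn_idPl ij); congr (_ * _)%N.
rewrite Gauss_gcdl // coprimeXr // coprime_sym prime_coprime //.
Qed.

Lemma gcd_ratio_mul_pow a b p i j : prime p -> ~~ (p %| a)%N -> ~~ (p %| b)%N ->
  gcd_ratio (a * p ^ i) (b * p ^ j) = gcd_ratio a b * p%:R^-1 ^+ natdist i j :> R.
Proof.
move=> pp pa pb; rewrite /gcd_ratio gcdn_mul_pow // !natrM !natrX.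
have p0 : p%:R != 0 :> R by rewrite pnatr_eq0 -lt0n prime_gt0.
set P := p%:R in p0 *; set X := P ^+ minn i j.
have -> : a%:R * P ^+ i * (b%:R * P ^+ j) = (a%:R * b%:R) * (X ^+ 2 * P ^+ natdist i j) :> R.
  rewrite /X -exprM -exprD (_ : (minn i j * 2 + natdist i j = i + j)%N).
    by rewrite exprD; ring.
  by rewrite /natdist; clear; lia.
rewrite exprMn -mulf_div; congr (_ * _); rewrite invfM mulrA divff ?mul1r ?exprVn //.
by rewrite !expf_neq0.
Qed.

Lemma gcd_ratio_ge0 a b : 0 <= gcd_ratio a b :> R.
Proof. by rewrite divr_ge0 ?sqr_ge0 // mulr_ge0. Qed.

Lemma logn_mul_pow a p i q : prime p -> (0 < a)%N ->
  logn q (a * p ^ i) = (logn q a + (q == p) * i)%N.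
Proof.
move=> pp a0; case pq: (prime q); last first.
  have l0 n : logn q n = 0%N by rewrite lognE pq.
  by rewrite !l0; case: eqP => // qp; rewrite qp pp in pq.
have pi0 : (0 < p ^ i)%N by rewrite expn_gt0 prime_gt0.
rewrite lognM // lognX (logn_prime q pp).
by rewrite [(i * _)%N]mulnC.
Qed.

Lemma Lpair_mul_pow z a b p i j : prime p -> (0 < a)%N -> (0 < b)%N ->
  ~~ (p %| a)%N -> ~~ (p %| b)%N ->
  Lpair Q z (a * p ^ i) (b * p ^ j) =
    Lpair Q z a b + (if [&& p \in Q, z < p & i != j]%N then p%:R^-1 else 0) :> R.
Proof.
move=> pp a0 b0 pa pb; rewrite /Lpair.
have la : logn p a = 0%N by rewrite lognE pp a0 (negPf pa).
have lb : logn p b = 0%N by rewrite lognE pp b0 (negPf pb).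
rewrite (eq_bigl (fun q => (z < q)%N &&
  (logn q a + (q == p) * i != logn q b + (q == p) * j)%N)); last first.
  by move=> q; rewrite (logn_mul_pow i q pp a0) (logn_mul_pow j q pp b0).
case: ifP => [/and3P[pinQ zp ij]|neg].
  rewrite (@bigD1_seq_cond _ _ _ _ _ _ _ p) //=; last by rewrite zp eqxx la lb !add0n !mul1n.
  rewrite addrC; congr (_ + _); apply: eq_bigl => q.
  by case: (q =P p) => [->|_] /=; rewrite ?la ?lb ?eqxx ?andbF ?mul0n ?addn0 ?andbT.
rewrite addr0 big_seq_cond [RHS]big_seq_cond; apply: eq_bigl => q.
case qQ: (q \in Q) => //=; case: (q =P p) => [qp|_]; last by rewrite !mul0n !addn0.
move: neg; rewrite -qp qQ /= => neg; rewrite qp la lb !add0n !mul1n eqxx andbF -qp.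
exact: neg.
Qed.

End Arith.

(** * Induction on the primes *)

Section Overlaps.
Variables (R : realType) (Q : seq nat) (z : nat) (m T rho : R) (S : seq nat) (psi : nat -> R).
Hypotheses (pQ : all prime Q) (uQ : uniq Q) (z0 : (0 < z)%N) (T0 : 0 <= T).
Hypotheses (uS : uniq S) (posS : all (fun v => (0 < v)%N) S) (psi0 : forall v, 0 <= psi v).

(** Total length of the arcs of [v]: there are [v * phi_ratio Q v] numerators and each arc has
    length [psi v / v]. *)
Definition mu (v : nat) : R := psi v * phi_ratio Q v.

(* The arcs of v and w meet only for numerator differences up to max (w psi v, v psi w) / gcd (v, w), here bounded by T. *)
Definition close_pair (v w : nat) : bool :=
  [&& w%:R * psi v <= T * (gcdn v w)%:R, v%:R * psi w <= T * (gcdn v w)%:R &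
      m <= Lpair Q z v w].

Definition massS (A : pred nat) : R := \sum_(v <- S | A v) mu v.

Definition totS (A B : pred nat) (E : rel nat) : R :=
  \sum_(v <- S | A v) \sum_(w <- S | B w && E v w) mu v * mu w.

Definition base_const : R := 2 * root4 (4 * expR (8 * expR 8)).

(** When p-parts p^i and p^j are adjoined, the three ingredients give [hp p ^+ natdist i j], a gain
    of (1 - 1/p)^(1/2) if p is in [Q] and i, j > 0, and a factor [eta_p p] if i and j differ. *)
Definition bound_at (a b : nat) : R :=
  root4 (gcd_ratio a b * (phi_ratio Q a * phi_ratio Q b)) * expR (z%:R * (Lpair Q z a b - m)).

Lemma mu_ge0 v : 0 <= mu v.
Proof. by rewrite mulr_ge0 // ltW // phi_ratio_gt0. Qed.

Lemma massS_ge0 A : 0 <= massS A.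
Proof. by apply: sumr_ge0 => v _; exact: mu_ge0. Qed.

Lemma totS_ge0 A B E : 0 <= totS A B E.
Proof.
by apply: sumr_ge0 => v _; apply: sumr_ge0 => w _; rewrite mulr_ge0 ?mu_ge0.
Qed.

Lemma totS_le A B E : totS A B E <= massS A * massS B.
Proof.
rewrite /massS mulr_suml; apply: ler_sum => v Av; rewrite mulr_sumr big_mkcondr.
by apply: ler_sum => w Bw; case: ifP => // _; rewrite mulr_ge0 ?mu_ge0.
Qed.

Lemma totS_sym (A B : pred nat) (E : rel nat) : totS A B E = totS B A (fun v w => E w v).
Proof.
rewrite /totS; under eq_bigr => v _ do rewrite big_mkcondr.
rewrite exchange_big /=; apply: eq_bigr => w Bw; rewrite [RHS]big_mkcondr.
by apply: eq_bigr => v Av; rewrite mulrC.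
Qed.

Lemma totS_mono (A B : pred nat) (E E' : rel nat) :
  (forall v w, v \in S -> w \in S -> A v -> B w -> E v w -> E' v w) -> totS A B E <= totS A B E'.
Proof.
move=> EE'; rewrite /totS big_seq_cond [leRHS]big_seq_cond; apply: ler_sum => v /andP[vS Av].
rewrite big_seq_cond [leRHS]big_seq_cond big_mkcond [leRHS]big_mkcond; apply: ler_sum => w _.
case wS: (w \in S) => //=; case Bw: (B w) => //=; case Ew: (E v w) => //=.
  by rewrite EE'.
by case: ifP => // _; rewrite mulr_ge0 ?mu_ge0.
Qed.

Lemma totS_or (A B : pred nat) (E E' : rel nat) :
  totS A B (fun v w => E v w || E' v w) <= totS A B E + totS A B E'.
Proof.
rewrite /totS -big_split; apply: ler_sum => v Av /=.
rewrite big_mkcondr [X in _ <= X + _]big_mkcondr [X in _ <= _ + X]big_mkcondr -big_split.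
apply: ler_sum => w _ /=; have m0 : 0 <= mu v * mu w by rewrite mulr_ge0 ?mu_ge0.
by case: (E v w); case: (E' v w) => /=; rewrite ?addr0 ?add0r // lerDl.
Qed.

(* one side of the dichotomy L(v/a) + L(w/b) >= m - L(a,b) *)
Lemma half_bound (A B : pred nat) (E : rel nat) (a b g : nat) (h : R) :
  (0 < a)%N -> (0 < b)%N -> (0 < g)%N ->
  (forall v, v \in S -> A v -> (a %| v)%N) -> (forall v, v \in S -> B v -> (b %| v)%N) ->
  (forall v w, v \in S -> w \in S -> A v -> B w -> E v w ->
     [/\ w%:R * psi v <= T * g%:R, v%:R * psi w <= T * g%:R & h <= Lsum R Q z (v %/ a)]) ->
  totS A B E <= root4 (4 * expR (8 * expR 8)) * Num.sqrt T *
    root4 (g%:R ^+ 2 / (a%:R * b%:R) * (phi_ratio Q a * phi_ratio Q b)) * expR (- (2 * z%:R * h)) *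
    (root4 (massS A) * root4 (massS B)) ^+ 3.
Proof.
move=> a0 b0 g0 Aa Bb HE.
have aR : 0 < a%:R :> R by rewrite ltr0n. have bR : 0 < b%:R :> R by rewrite ltr0n.
have gR : 0 < g%:R :> R by rewrite ltr0n.
have fa := phi_ratio_gt0 R pQ a; have fb := phi_ratio_gt0 R pQ b.
pose e8 : R := expR (8 * expR 8).
(* Edges only use vertices with a large [Lsum], so counting just these brings in the saving of
   [anatomy]. *)
pose r v : R := if h <= Lsum R Q z (v %/ a) then phi_ratio Q v else 0.
have r0 v : 0 <= r v by rewrite /r; case: ifP => // _; rewrite ltW // phi_ratio_gt0.
have vE (c : nat) v : (0 < c)%N -> (c %| v)%N -> (v %/ c)%:R = v%:R / c%:R :> R.
  move=> c0 cv; rewrite -{2}(divnK cv) natrM mulfK // pnatr_eq0 -lt0n //.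
have edge1 v w : v \in S -> w \in S -> A v -> B w -> E v w ->
    mu v * (w %/ b)%:R <= T * g%:R / b%:R * r v.
  move=> vS wS Av Bw Ew; have [h1 _ h3] := HE _ _ vS wS Av Bw Ew.
  rewrite /r h3 vE ?Bb // /mu.
  have -> : psi v * phi_ratio Q v * (w%:R / b%:R) = w%:R * psi v / b%:R * phi_ratio Q v by ring.
  rewrite ler_wpM2r ?(ltW (phi_ratio_gt0 R pQ v)) //.
  by rewrite ler_pM2r ?invr_gt0.
have edge2 v w : v \in S -> w \in S -> A v -> B w -> E v w ->
    mu w * (v %/ a)%:R <= T * g%:R / a%:R * phi_ratio Q w.
  move=> vS wS Av Bw Ew; have [_ h2 _] := HE _ _ vS wS Av Bw Ew.
  rewrite vE ?Aa // /mu.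
  have -> : psi w * phi_ratio Q w * (v%:R / a%:R) = v%:R * psi w / a%:R * phi_ratio Q w by ring.
  rewrite ler_wpM2r ?(ltW (phi_ratio_gt0 R pQ w)) //.
  by rewrite ler_pM2r ?invr_gt0.
have quot_count (P : pred nat) (c : nat) (f : nat -> R) X (D : R) : (0 < c)%N -> 0 <= D ->
    (forall v, v \in S -> P v -> (c %| v)%N) ->
    (forall k, 0 <= f k <= D) ->
    \sum_(v <- S | P v && (v %/ c <= X)%N) f (v %/ c)%N <= \sum_(k <- iota 1 X) f k.
  move=> c0 D0 Pc f0; rewrite -big_filter -(big_map (fun v => v %/ c)%N xpredT f).
  apply: sum_uniq_sub; rewrite ?iota_uniq //; last by move=> i _; case/andP: (f0 i).
    rewrite map_inj_in_uniq ?filter_uniq // => x y; rewrite !mem_filter.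
    move=> /andP[/andP[Px _] xS] /andP[/andP[Py _] yS] xy.
    by rewrite -(divnK (Pc _ xS Px)) xy divnK // Pc.
  move=> k /mapP[v]; rewrite mem_filter => /andP[/andP[Pv vX] vS] ->.
  by rewrite mem_iota add1n ltnS vX andbT divn_gt0 // dvdn_leq ?Pc // (allP posS).
have cA X : \sum_(v <- S | A v && (v %/ a <= X)%N) r v <=
    phi_ratio Q a * (e8 * expR (- (8 * z%:R * h))) * X%:R.
  apply: (@le_trans _ _ (phi_ratio Q a * \sum_(k <- iota 1 X) (if h <= Lsum R Q z k then 1 else 0))).
    apply: le_trans (_ : _ <= phi_ratio Q a * \sum_(v <- S | A v && (v %/ a <= X)%N)
        (fun k => if h <= Lsum R Q z k then 1 else 0) (v %/ a)%N) _.
      rewrite mulr_sumr big_seq_cond [leRHS]big_seq_cond; apply: ler_sum => v /and3P[vS Av _].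
      rewrite /r; case: ifP => _; rewrite ?mulr0 ?mulr1 //.
      by apply: phi_ratio_dvd => //; exact: Aa.
    apply: ler_wpM2l; first exact: ltW.
    apply: (quot_count A a _ X 1) => // k.
    by case: ifP => _; rewrite ?lexx ler01.
  rewrite -[leRHS]mulrA ler_wpM2l ?(ltW fa) // -big_mkcond /= mulrAC.
  exact: anatomy.
have cB X : \sum_(v <- S | B v && (v %/ b <= X)%N) phi_ratio Q v <= phi_ratio Q b * X%:R :> R.
  apply: (@le_trans _ _ (phi_ratio Q b * \sum_(k <- iota 1 X) 1)).
    apply: le_trans (_ : _ <= phi_ratio Q b * \sum_(v <- S | B v && (v %/ b <= X)%N)
        (fun k => 1) (v %/ b)%N) _.
      rewrite mulr_sumr big_seq_cond [leRHS]big_seq_cond; apply: ler_sum => v /and3P[vS Bv _].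
      by rewrite mulr1; apply: phi_ratio_dvd => //; exact: Bb.
    apply: ler_wpM2l; first exact: (ltW fb).
    have b11 : forall k : nat, 0 <= (1 : R) <= 1.
      by move=> k; rewrite lexx ler01.
    exact: (quot_count B b (fun=> 1) X 1 b0 ler01 Bb b11).
  by rewrite big_const_seq count_predT size_iota iter_addr_0.
have div_pos (P : pred nat) (c : nat) : (0 < c)%N -> (forall v, v \in S -> P v -> (c %| v)%N) ->
    forall v, v \in S -> P v -> (0 < v %/ c)%N.
  by move=> c0 Pc v vS Pv; rewrite divn_gt0 // dvdn_leq ?Pc // (allP posS).
have SB := @structured_bound R S mu mu r (phi_ratio Q) (fun v => v %/ a)%N (fun w => w %/ b)%N E
  (T * g%:R / b%:R) (T * g%:R / a%:R) (phi_ratio Q a * (e8 * expR (- (8 * z%:R * h)))) (phi_ratio Q b)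
  uS mu_ge0 mu_ge0.
have {}SB := SB (divr_ge0 (mulr_ge0 T0 (ltW gR)) (ltW bR)) (divr_ge0 (mulr_ge0 T0 (ltW gR)) (ltW aR))
  (mulr_ge0 (ltW fa) (mulr_ge0 (expR_ge0 _) (expR_ge0 _))) (ltW fb) r0
  (fun v => ltW (phi_ratio_gt0 R pQ v)) A B (div_pos A a a0 Aa) (div_pos B b b0 Bb) edge1 edge2 cA cB.
set t := totS A B E; change (is_true (t <= 2 * Num.sqrt (T * g%:R / b%:R * (phi_ratio Q a * (e8 * expR (- (8 * z%:R * h)))) *
   (T * g%:R / a%:R * phi_ratio Q b) * massS A * massS B))) in SB.
have t0 : 0 <= t by exact: totS_ge0.
have MA := massS_ge0 A; have MB := massS_ge0 B; have tM : t <= massS A * massS B by exact: totS_le.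
have rhs0 : 0 <= root4 (4 * e8) * Num.sqrt T *
    root4 (g%:R ^+ 2 / (a%:R * b%:R) * (phi_ratio Q a * phi_ratio Q b)) * expR (- (2 * z%:R * h)) *
    (root4 (massS A) * root4 (massS B)) ^+ 3.
  by rewrite mulr_ge0 ?exprn_ge0 ?mulr_ge0 ?root4_ge0 ?sqrtr_ge0 ?expR_ge0.
apply: ler_pow4 => //.
have G0 : 0 <= g%:R ^+ 2 / (a%:R * b%:R) * (phi_ratio Q a * phi_ratio Q b) :> R.
  by rewrite mulr_ge0 ?divr_ge0 ?sqr_ge0 ?mulr_ge0 // ltW.
have e80 : 0 <= 4 * e8 by rewrite mulr_ge0 ?expR_ge0.
have -> : (root4 (4 * e8) * Num.sqrt T *
    root4 (g%:R ^+ 2 / (a%:R * b%:R) * (phi_ratio Q a * phi_ratio Q b)) * expR (- (2 * z%:R * h)) *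
    (root4 (massS A) * root4 (massS B)) ^+ 3) ^+ 4 =
  (4 * e8) * T ^+ 2 * (g%:R ^+ 2 / (a%:R * b%:R) * (phi_ratio Q a * phi_ratio Q b)) *
    expR (- (8 * z%:R * h)) * (massS A * massS B) ^+ 3.
  rewrite (_ : - (8 * z%:R * h) = 4%:R * (- (2 * z%:R * h))); last by ring.
  rewrite expRM_natl -{2}(sqr_sqrtr T0) -[in RHS](root4K MA) -[in RHS](root4K MB).
  by rewrite -{2}(root4K e80) -{2}(root4K G0); ring.
have SB2 : t ^+ 2 <= 4 * (T * g%:R / b%:R * (phi_ratio Q a * (e8 * expR (- (8 * z%:R * h)))) *
   (T * g%:R / a%:R * phi_ratio Q b) * massS A * massS B).
  have K10 := divr_ge0 (mulr_ge0 T0 (ltW gR)) (ltW bR).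
  have K20 := divr_ge0 (mulr_ge0 T0 (ltW gR)) (ltW aR).
  have C10 := mulr_ge0 (ltW fa) (mulr_ge0 (expR_ge0 (8 * expR 8)) (expR_ge0 (- (8 * z%:R * h)))).
  have X0 := mulr_ge0 (mulr_ge0 (mulr_ge0 (mulr_ge0 K10 C10) (mulr_ge0 K20 (ltW fb))) MA) MB.
  rewrite -/e8 in X0; move: SB X0.
  move: (T * g%:R / b%:R * _ * _ * _ * _) => X SB X0.
  apply: (@le_trans _ _ ((2 * Num.sqrt X) ^+ 2)).
    by rewrite lerXn2r ?nnegrE // mulr_ge0 ?sqrtr_ge0.
  by rewrite exprMn sqr_sqrtr // -natrX.
(* The fourth power of the edge sum: one square from the degree argument, the other from the product
   of the masses. *)
rewrite (exprM t 2 2) expr2.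
apply: le_trans (ler_pM (sqr_ge0 _) (sqr_ge0 _) SB2 (_ : t ^+ 2 <= (massS A * massS B) ^+ 2)) _.
  by rewrite lerXn2r ?nnegrE ?mulr_ge0.
rewrite le_eqVlt; apply/orP; left; apply/eqP; field.
by rewrite !gt_eqF.
Qed.

(** A prime dividing neither cofactor has the same valuation in [v] as in [a] and in [w] as in
    [b]. *)
Lemma Lpair_le_Lsum (a b v w : nat) : (0 < v)%N -> (0 < w)%N -> (a %| v)%N -> (b %| w)%N ->
  Lpair Q z v w <= Lpair Q z a b + Lsum R Q z (v %/ a) + Lsum R Q z (w %/ b).
Proof.
move=> v0 w0 av bw; rewrite /Lpair /Lsum !big_mkcondr -!big_split /=.
have le0 (q : nat) : 0 <= q%:R^-1 :> R by rewrite invr_ge0.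
rewrite big_seq_cond [leRHS]big_seq_cond; apply: ler_sum => q /andP[qQ _].
have pq := allP pQ _ qQ.
have lE (c n : nat) : (0 < n)%N -> (c %| n)%N -> ~~ (q %| n %/ c)%N -> logn q n = logn q c.
  move=> n0 cn qn; rewrite -{1}(divnK cn) lognM ?(dvdn_gt0 n0 cn) //.
    by rewrite [logn q (n %/ c)]lognE pq (negPf qn) andbF.
  by rewrite divn_gt0 ?(dvdn_leq n0 cn) // (dvdn_gt0 n0 cn).
case: (boolP (q %| v %/ a)%N) => qv; case: (boolP (q %| w %/ b)%N) => qw;
  case: (boolP (logn q v != logn q w)) => vw; case: (boolP (logn q a != logn q b)) => ab;
  rewrite ?addr0 ?add0r ?lexx ?addr_ge0 ?lerDl ?lerDr ?addr_ge0 //.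
by move: vw; rewrite (lE a) // (lE b w) // (negPf ab).
Qed.

(** With all minimal valuations prescribed, every edge has the same gcd as (a, b). The excess of [m]
    over [Lpair Q z a b] must be carried by [v / a] or [w / b], at least half of it by one of them,
    and each alternative is a case of [half_bound]. *)
Lemma base_case (A B : pred nat) (E : rel nat) (a b : nat) : (0 < a)%N -> (0 < b)%N ->
  (forall v, v \in S -> A v -> (a %| v)%N) -> (forall v, v \in S -> B v -> (b %| v)%N) ->
  (forall v w, v \in S -> w \in S -> A v -> B w -> E v w -> close_pair v w) ->
  (forall v w, v \in S -> w \in S -> A v -> B w -> E v w ->
     forall q, prime q -> minn (logn q v) (logn q w) = minn (logn q a) (logn q b)) ->
  totS A B E <= base_const * Num.sqrt T * bound_at a b * (root4 (massS A) * root4 (massS B)) ^+ 3.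
Proof.
move=> a0 b0 Aa Bb HE Hmin; set g := gcdn a b.
have g0 : (0 < g)%N by rewrite gcdn_gt0 a0.
have gE v w : v \in S -> w \in S -> A v -> B w -> E v w -> gcdn v w = g.
  move=> vS wS Av Bw Ew; have v0 := allP posS _ vS; have w0 := allP posS _ wS.
  apply: eqn_from_log; rewrite /g ?gcdn_gt0 ?v0 ?a0 // => q.
  case pq: (prime q); last by rewrite lognE [RHS]lognE pq.
  by rewrite !logn_gcd // (Hmin v w).
pose h := (m - Lpair Q z a b) / 2.
pose E1 v w := E v w && (h <= Lsum R Q z (v %/ a)).
pose E2 v w := E v w && (h <= Lsum R Q z (w %/ b)).
have EE : totS A B E <= totS A B E1 + totS A B E2.
  apply: (le_trans _ (totS_or A B E1 E2)); apply: totS_mono => v w vS wS Av Bw Ew.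
  rewrite /E1 /E2 Ew /=; have /and3P[_ _ mL] := HE _ _ vS wS Av Bw Ew.
  have := Lpair_le_Lsum (allP posS _ vS) (allP posS _ wS) (Aa _ vS Av) (Bb _ wS Bw).
  move=> H; case: (lerP h (Lsum R Q z (v %/ a))) => //= H1.
  by move: (le_trans mL H) H1; rewrite /h; lra.
apply: le_trans EE _.
have D1 := @half_bound A B E1 a b g h a0 b0 g0 Aa Bb.
have D2 := @half_bound B A (fun w v => E2 v w) b a g h b0 a0 g0 Bb Aa.
rewrite [X in _ + X]totS_sym; apply: le_trans (lerD (D1 _) (D2 _)) _.
- move=> v w vS wS Av Bw /andP[Ew hh]; have /and3P[h1 h2 _] := HE _ _ vS wS Av Bw Ew.
  by rewrite -(gE _ _ vS wS Av Bw Ew).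
- move=> w v wS vS Bw Av /andP[Ew hh]; have /and3P[h1 h2 _] := HE _ _ vS wS Av Bw Ew.
  by rewrite -(gE _ _ vS wS Av Bw Ew).
rewrite /base_const /bound_at /gcd_ratio -/g (mulrC b%:R) (mulrC (phi_ratio Q b)) (mulrC (root4 (massS B))).
have -> : - (2 * z%:R * h) = z%:R * (Lpair Q z a b - m) by rewrite /h; field.
rewrite le_eqVlt; apply/orP; left; apply/eqP; ring.
Qed.

Lemma sum_by_value (K : nat) (l : nat -> nat) (A P : pred nat) (f : nat -> R) :
  (forall v, v \in S -> (l v < K)%N) ->
  \sum_(i < K | P i) \sum_(v <- S | A v && (l v == i)) f v = \sum_(v <- S | A v && P (l v)) f v.
Proof.
move=> lK; under eq_bigr => i _ do rewrite big_mkcondr.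
rewrite exchange_big /= [RHS]big_mkcondr big_seq_cond [RHS]big_seq_cond.
apply: eq_bigr => v /andP[vS _]; rewrite -big_mkcondr /=.
case: ifP => Pl; last first.
  by rewrite big_pred0 // => i; case: eqP => [<-|_]; rewrite ?Pl ?andbF.
rewrite (big_pred1 (Ordinal (lK _ vS))) // => i; rewrite /= -(inj_eq val_inj) /= [RHS]eq_sym.
by case: (l v =P i) => [<-|_]; rewrite ?Pl ?andbF.
Qed.

(** The number p^(-1/4), which plays the role of [h] in the one-prime estimates. *)
Definition hp (p : nat) : R := root4 (p%:R^-1).

Definition eta_p (p : nat) : R := if (p \in Q) && (z < p)%N then expR (z%:R / p%:R) else 1.

(* The constants are irrelevant: only the exponent 5 / 4 matters, since it makes the product over p converge. *)
Definition kap (p : nat) : R :=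
  if p \notin Q then 1 else if 1 < hp p * 10 ^+ 10 then 40
  else 1 + (eta_p p ^+ 4 - 1) * hp p ^+ 4 / 2 + 10 ^+ 5 * hp p ^+ 5.

Lemma root4X (x : R) n : 0 <= x -> root4 (x ^+ n) = root4 x ^+ n.
Proof.
move=> x0; elim: n => [|n IH]; last by rewrite !exprS root4M // IH.
by rewrite !expr0 /root4 !sqrtr1.
Qed.

Lemma bound_at_mul_pow p a b i j : prime p -> (0 < a)%N -> (0 < b)%N ->
  ~~ (p %| a)%N -> ~~ (p %| b)%N ->
  bound_at (a * p ^ i) (b * p ^ j) = bound_at a b * (hp p ^+ natdist i j *
    root4 ((if (p \in Q) && (0 < i)%N then 1 - p%:R^-1 else 1) *
           (if (p \in Q) && (0 < j)%N then 1 - p%:R^-1 else 1)) *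
    (if i == j then 1 else eta_p p)).
Proof.
move=> pp a0 b0 pa pb; rewrite /bound_at gcd_ratio_mul_pow // !phi_ratio_mul_pow // Lpair_mul_pow //.
set x := (if _ then _ else _ : R); set y := (if (p \in Q) && (0 < j)%N then _ else _).
have pinv0 : 0 <= p%:R^-1 :> R by rewrite invr_ge0.
have x0 : 0 <= x by rewrite /x; case: ifP => // /andP[/(one_sub_inv_bounds R pQ) /andP[/ltW]].
have y0 : 0 <= y by rewrite /y; case: ifP => // /andP[/(one_sub_inv_bounds R pQ) /andP[/ltW]].
have G0 := gcd_ratio_ge0 R a b.
have fa := ltW (phi_ratio_gt0 R pQ a); have fb := ltW (phi_ratio_gt0 R pQ b).
have -> : gcd_ratio a b * p%:R^-1 ^+ natdist i j * (phi_ratio Q a * x * (phi_ratio Q b * y)) =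
  (gcd_ratio a b * (phi_ratio Q a * phi_ratio Q b)) * (p%:R^-1 ^+ natdist i j * (x * y)) by ring.
have e1 : 0 <= gcd_ratio a b * (phi_ratio Q a * phi_ratio Q b) := mulr_ge0 G0 (mulr_ge0 fa fb).
have pd0 : 0 <= p%:R^-1 ^+ natdist i j :> R by exact: exprn_ge0.
rewrite (root4M _ e1) (root4M _ pd0) root4X // -/(hp p).
set d := (if _ then p%:R^-1 else 0 : R).
have -> : expR (z%:R * (Lpair Q z a b + d - m)) =
    expR (z%:R * (Lpair Q z a b - m)) * (if i == j then 1 else eta_p p).
  have -> : z%:R * (Lpair Q z a b + d - m) = z%:R * (Lpair Q z a b - m) + z%:R * d by ring.
  rewrite expRD; congr (_ * _); rewrite /d /eta_p.
  by case: (p \in Q); case: (z < p)%N; case: (i == j) => /=; rewrite ?mulr0 ?expR0.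
move: (if i == j then _ else _) => e; ring.
Qed.

(* Outside [ps], the minimum of the valuations along an edge is already prescribed by (a, b). *)
Definition overlap_claim (ps : seq nat) : Prop :=
  forall (A B : pred nat) (E : rel nat) (a b : nat), (0 < a)%N -> (0 < b)%N ->
  (forall v, v \in S -> A v -> (a %| v)%N) -> (forall v, v \in S -> B v -> (b %| v)%N) ->
  (forall v w, v \in S -> w \in S -> A v -> B w -> E v w -> close_pair v w) ->
  (forall v w, v \in S -> w \in S -> A v -> B w -> E v w ->
     forall q, prime q -> q \notin ps -> minn (logn q v) (logn q w) = minn (logn q a) (logn q b)) ->
  (forall q, q \in ps -> ~~ (q %| a)%N /\ ~~ (q %| b)%N) ->
  (forall v, v \in S -> A v -> rho * massS A <= mu v) ->
  (forall v, v \in S -> B v -> rho * massS B <= mu v) ->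
  totS A B E <= base_const * \prod_(p <- ps) kap p * Num.sqrt T * bound_at a b *
    (root4 (massS A) * root4 (massS B)) ^+ 3.

Lemma overlap_claim0 : overlap_claim [::].
Proof.
move=> A B E a b a0 b0 Aa Bb HE Hmin _ _ _; rewrite big_nil mulr1.
by apply: base_case => // v w vS wS Av Bw Ew q pq; apply: Hmin.
Qed.

Hypothesis (z3 : expR 1 <= 3 :> R) (rho0 : 0 <= rho).

Lemma eta_p_bounds p : 1 <= eta_p p <= 3.
Proof.
rewrite /eta_p; case: ifP => [/andP[_ zp]|_]; last by rewrite lexx; lra.
have p0 : 0 < p%:R :> R by rewrite ltr0n (leq_ltn_trans _ zp).
apply/andP; split; first by rewrite -[leLHS]expR0 ler_expR divr_ge0.
apply: le_trans z3; rewrite ler_expR.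
by rewrite ler_pdivrMr // mul1r ler_nat ltnW.
Qed.

Lemma hp_gt0 p : prime p -> 0 < hp p.
Proof. by move=> pp; rewrite /hp /root4 !sqrtr_gt0 invr_gt0 ltr0n prime_gt0. Qed.

Lemma hp4 p : hp p ^+ 4 = p%:R^-1.
Proof. by rewrite root4K // invr_ge0. Qed.

Lemma kap_ge1 p : prime p -> 1 <= kap p.
Proof.
move=> pp; rewrite /kap; case: ifP => // _; case: ifP => _; first by lra.
have h0 := ltW (hp_gt0 pp); have /andP[e1 _] := eta_p_bounds p.
rewrite -addrA lerDl addr_ge0 ?divr_ge0 //.
  by apply: mulr_ge0; rewrite ?exprn_ge0 // subr_ge0 exprn_ege1.
by apply: mulr_ge0; apply: exprn_ge0.
Qed.

Lemma massS_sub (A A' : pred nat) : (forall v, v \in S -> A' v -> A v) -> massS A' <= massS A.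
Proof.
move=> sub; rewrite /massS big_seq_cond [leRHS]big_seq_cond big_mkcond [leRHS]big_mkcond.
apply: ler_sum => v _; case vS: (v \in S) => //=; case A'v: (A' v); first by rewrite sub.
by case: ifP => // _; exact: mu_ge0.
Qed.

(** The two sums on the left count disjoint families of edges, and on each of them the smaller value
    of [l] is [k]. *)
Lemma totS_cross (l : nat -> nat) (k : nat) (A B : pred nat) (E : rel nat) :
  totS (fun v => A v && (l v == k)) (fun w => B w && (k <= l w)%N) E +
  totS (fun v => A v && (k < l v)%N) (fun w => B w && (l w == k)) E <=
  totS (fun v => A v && (k <= l v)%N) (fun w => B w && (k <= l w)%N)
    (fun v w => E v w && (minn (l v) (l w) == k)).
Proof.
rewrite /totS !(big_mkcond (fun v => A v && _)) -big_split; apply: ler_sum => v _ /=.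
have m0 w : 0 <= mu v * mu w by rewrite mulr_ge0 ?mu_ge0.
case: (A v) => /=; last by rewrite addr0.
case: ltngtP => kl /=; rewrite ?addr0 ?add0r //.
  rewrite big_mkcond [leRHS]big_mkcond; apply: ler_sum => w _.
  case: (B w) => //=; case: eqP => [lw|_] /=; last by case: ifP.
  by rewrite lw leqnn (minn_idPr (ltnW kl)) eqxx andbT.
rewrite big_mkcond [leRHS]big_mkcond; apply: ler_sum => w _.
case: (B w) => //=; case: (leqP k (l w)) => //= kw.
by rewrite -kl (minn_idPl kw) eqxx andbT.
Qed.

(** Slice both sides by the valuation at [p]. The induction hypothesis bounds the edges between two
    slices through (a p^i, b p^j), and the edges with minimal valuation k all at once through (a
    p^k, b p^k). After normalization these are the hypotheses of the one-prime estimates. *)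
Lemma prime_step p ps : overlap_claim ps -> prime p -> p \notin ps -> all prime ps ->
  (p \notin Q -> 64 * hp p ^+ 2 <= rho) -> overlap_claim (p :: ps).
Proof.
move=> IH pp pps prps heavy A B E a b a0 b0 Aa Bb HE Hmin Hps hA hB.
have [pa pb] := Hps p (mem_head _ _).
pose K := (\max_(v <- S) logn p v).+1.
have lK v : v \in S -> (logn p v < K)%N.
  by move=> vS; rewrite ltnS; exact: leq_bigmax_seq.
pose Ai (i : nat) v := A v && (logn p v == i). pose Bi (i : nat) v := B v && (logn p v == i).
pose al (i : 'I_K) := massS (Ai i). pose be (i : 'I_K) := massS (Bi i).
have sal (P : pred nat) : \sum_(i < K | P i) al i = massS (fun v => A v && P (logn p v)).
  exact: sum_by_value.
have sbe (P : pred nat) : \sum_(i < K | P i) be i = massS (fun v => B v && P (logn p v)).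
  exact: sum_by_value.
pose F (i j : 'I_K) := totS (Ai i) (Bi j) E.
have Fsum (P P' : pred nat) : \sum_(i < K | P i) \sum_(j < K | P' j) F i j =
    totS (fun v => A v && P (logn p v)) (fun w => B w && P' (logn p w)) E.
  rewrite /totS -(sum_by_value A P _ lK); apply: eq_bigr => i Pi.
  rewrite exchange_big /=; apply: eq_bigr => v Av.
  rewrite (eq_bigl (fun w => (B w && E v w) && P' (logn p w))); last by move=> w; rewrite andbAC.
  rewrite -(sum_by_value (fun w => B w && E v w) P' _ lK); apply: eq_bigr => j Pj.
  by apply: eq_bigl => w; rewrite /Bi andbAC.
pose C : R := base_const * \prod_(q <- ps) kap q * Num.sqrt T.
have C0 : 0 <= C.
  rewrite mulr_ge0 ?sqrtr_ge0 // mulr_ge0 //; first by rewrite mulr_ge0 ?root4_ge0.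
  by rewrite big_seq_cond prodr_ge0 // => q /andP[qps _]; rewrite (le_trans ler01) // kap_ge1 // (allP prps).
(* Valuations at least i and j are enough for divisibility, and only the minimum along an edge has
   to be exact; this flexibility is what lets the whole family with minimum k be treated as a single
   graph. *)
have key (A' B' : pred nat) (E' : rel nat) (i j : nat) :
    (forall v, v \in S -> A' v -> A v && (i <= logn p v)%N) ->
    (forall v, v \in S -> B' v -> B v && (j <= logn p v)%N) ->
    (forall v w, v \in S -> w \in S -> A' v -> B' w -> E' v w ->
       E v w && (minn (logn p v) (logn p w) == minn i j)) ->
    totS A' B' E' <= C * bound_at (a * p ^ i) (b * p ^ j) * (root4 (massS A') * root4 (massS B')) ^+ 3.
  move=> A'A B'B E'E.
  have dvdp (c k v : nat) : (0 < v)%N -> (c %| v)%N -> ~~ (p %| c)%N -> (k <= logn p v)%N -> (c * p ^ k %| v)%N.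
    move=> v0 cv pc kv; rewrite Gauss_dvd ?cv ?pfactor_dvdn //.
    by rewrite coprimeXr // coprime_sym prime_coprime.
  have pk0 k : (0 < p ^ k)%N by rewrite expn_gt0 prime_gt0.
  apply: IH; rewrite ?muln_gt0 ?a0 ?b0 ?pk0 //.
  - move=> v vS /(A'A v vS) /andP[Av iv]; apply: dvdp => //; [exact: (allP posS) | exact: Aa].
  - move=> v vS /(B'B v vS) /andP[Bv iv]; apply: dvdp => //; [exact: (allP posS) | exact: Bb].
  - move=> v w vS wS A'v B'w /(E'E v w vS wS A'v B'w) /andP[Evw _].
    have /andP[Av _] := A'A v vS A'v; have /andP[Bw _] := B'B w wS B'w; exact: HE.
  - move=> v w vS wS A'v B'w /(E'E v w vS wS A'v B'w) /andP[Evw /eqP mn] q pq qps.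
    have /andP[Av _] := A'A v vS A'v; have /andP[Bw _] := B'B w wS B'w.
    rewrite (logn_mul_pow i q pp a0) (logn_mul_pow j q pp b0).
    case: (q =P p) => [qp|/eqP qp]; last by rewrite !mul0n !addn0 Hmin // inE negb_or qp.
    have la : logn p a = 0%N by rewrite lognE pp a0 (negPf pa).
    have lb : logn p b = 0%N by rewrite lognE pp b0 (negPf pb).
    by rewrite qp la lb !mul1n !add0n.
  - move=> q qps; have [qa qb] := Hps q (mem_behead (s := p :: ps) qps).
    have pq := allP prps _ qps.
    have qp k : ~~ (q %| p ^ k)%N.
      rewrite Euclid_dvdX // (dvdn_prime2 pq pp); apply/negP => /andP[/eqP qp _].
      by rewrite -qp qps in pps.
    by rewrite !Euclid_dvdM // !negb_or qa qb !qp.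
  - move=> v vS A'v; have /andP[Av _] := A'A v vS A'v; apply: (le_trans _ (hA v vS Av)).
    by rewrite ler_wpM2l // massS_sub // => u uS' /(A'A u uS') /andP[].
  - move=> v vS A'v; have /andP[Av _] := B'B v vS A'v; apply: (le_trans _ (hB v vS Av)).
    by rewrite ler_wpM2l // massS_sub // => u uS' /(B'B u uS') /andP[].
have bnd0 : 0 <= bound_at a b by rewrite mulr_ge0 ?root4_ge0 ?expR_ge0.
have /andP[e1 e3] := eta_p_bounds p.
have h0 := hp_gt0 pp.
have pR : 0 < p%:R :> R by rewrite ltr0n prime_gt0.
have p2 : 2 <= p%:R :> R by rewrite ler_nat prime_gt1.
have pinv : 0 <= (p%:R^-1 : R) <= 2^-1 by rewrite invr_ge0 ltW // lef_pV2 // posrE.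
have f1 i : 0 <= (if (p \in Q) && (0 < i)%N then (1 : R) - p%:R^-1 else 1) <= 1.
  by case: ifP => _; rewrite ?ler01 ?lexx //; lra.
have FB i j : F i j <= C * bound_at a b * ((if i == j then 1 else eta_p p) *
    ((root4 (al i) * root4 (be j)) ^+ 3 * hp p ^+ natdist i j)).
  have := @key (Ai i) (Bi j) E i j.
  have -> : F i j = totS (Ai i) (Bi j) E by [].
  move=> H; apply: le_trans (H _ _ _) _.
  - by move=> v _ /andP[-> /eqP ->] /=.
  - by move=> v _ /andP[-> /eqP ->] /=.
  - by move=> v w _ _ /andP[_ /eqP ->] /andP[_ /eqP ->] ->; rewrite eqxx.
  rewrite bound_at_mul_pow // -/(al i) -/(be j).
  have := f1 i; have := f1 j; set x := (if _ then _ else _ : R); set y := (if _ && (0 < i)%N then _ else _).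
  move=> /andP[x0 x1] /andP[y0 y1].
  have r1 : root4 (y * x) <= 1.
    apply: ler_pow4; rewrite // root4K ?mulr_ge0 // expr1n mulr_ile1 //.
  set e := (if i == j then 1 else eta_p p : R).
  have e0 : 0 <= e by rewrite /e; case: ifP => // _; apply: le_trans e1.
  have eE : (if (i : nat) == j then 1 else eta_p p : R) = e by [].
  set Rt := (root4 (al i) * root4 (be j)) ^+ 3.
  have Rt0 : 0 <= Rt by rewrite exprn_ge0 // mulr_ge0 ?root4_ge0.
  set hd := hp p ^+ natdist i j; have hd0 : 0 <= hd by rewrite exprn_ge0 // ltW.
  rewrite ?eE (_ : C * (bound_at a b * (hd * root4 (y * x) * e)) * Rt =
     (C * bound_at a b * (e * (Rt * hd))) * root4 (y * x)); last by ring.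
  apply: ler_piMr => //; exact: mulr_ge0 (mulr_ge0 C0 bnd0) (mulr_ge0 e0 (mulr_ge0 Rt0 hd0)).
have SK (k : 'I_K) : F k k + \sum_(j < K | (k < j)%N) F k j + \sum_(i < K | (k < i)%N) F i k <=
    C * bound_at a b * (if (k : nat) == 0%N then 1 else if p \in Q then 1 - hp p ^+ 4 / 2 else 1) *
    (root4 (\sum_(i < K | (k <= i)%N) al i) * root4 (\sum_(i < K | (k <= i)%N) be i)) ^+ 3.
  have e_1 : F k k + \sum_(j < K | (k < j)%N) F k j =
      totS (fun v => A v && (logn p v == k)) (fun w => B w && (k <= logn p w)%N) E.
    rewrite -(Fsum (fun i => i == k) (fun i => k <= i)%N) [RHS](big_pred1 k); last by move=> i.
    rewrite [RHS](bigD1 k) //=; congr (_ + _); apply: eq_bigl => j.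
    by rewrite ltn_neqAle andbC eq_sym.
  have e_2 : \sum_(i < K | (k < i)%N) F i k =
      totS (fun v => A v && (k < logn p v)%N) (fun w => B w && (logn p w == k)) E.
    rewrite -(Fsum (fun i => k < i)%N (fun i => i == k)); apply: eq_bigr => i _.
    by rewrite (big_pred1 k).
  rewrite e_1 e_2; apply: le_trans (totS_cross _ _ _ _ _) _.
  rewrite (sal (fun i => k <= i)%N) (sbe (fun i => k <= i)%N).
  apply: le_trans (@key _ _ _ k k _ _ _) _ => //; first by move=> v w _ _ _ _; rewrite minnn.
  apply: ler_wpM2r; first by rewrite exprn_ge0 // mulr_ge0 ?root4_ge0.
  rewrite bound_at_mul_pow // eqxx mulr1 /natdist subnn expr0 mul1r mulrA.
  apply: ler_wpM2l; first exact: mulr_ge0.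
  rewrite lt0n; case: (k =P 0%N :> nat) => [_|_] /=.
    by rewrite andbF mulr1 /root4 !sqrtr1.
  rewrite andbT; case: ifP => pinQ; last by rewrite mulr1 /root4 !sqrtr1.
  rewrite hp4; apply: ler_pow4; first by lra.
  rewrite root4K -?expr2 ?sqr_ge0 // (exprM _ 2 2) lerXn2r ?nnegrE ?sqr_ge0 //; first by lra.
  by rewrite sqrrB expr1n; have := sqr_ge0 (p%:R^-1 / 2 : R); lra.
have massE : massS A = \sum_i al i.
  by rewrite (sal xpredT); apply: eq_bigl => v; rewrite andbT.
have massEB : massS B = \sum_i be i.
  by rewrite (sbe xpredT); apply: eq_bigl => v; rewrite andbT.
have -> : totS A B E = \sum_i \sum_j F i j.
  rewrite (Fsum xpredT xpredT); apply: eq_big => [v|v _]; first by rewrite andbT.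
  by apply: eq_bigl => w; rewrite andbT.
rewrite big_cons massE massEB.
have -> : base_const * (kap p * \prod_(j <- ps) kap j) * Num.sqrt T * bound_at a b =
   C * bound_at a b * kap p by rewrite /C; ring.
have al0 i : 0 <= al i by exact: massS_ge0. have be0 i : 0 <= be i by exact: massS_ge0.
have kap0 : 0 <= kap p by rewrite (le_trans ler01) // kap_ge1.
apply: (normalized_bound al0 be0 (mulr_ge0 C0 bnd0) kap0 FB).
move=> u w x y B0 x0 y0 xE yE u0 w0 su sw hG facu facw.
have h1 : hp p < 1.
  rewrite ltNge; apply/negP => h1; have : 1 <= hp p ^+ 4 by rewrite exprn_ege1.
  rewrite hp4; move: pinv; lra.
rewrite /kap; case: (boolP (p \in Q)) => /= pQ'; last first.
  have eta1 : eta_p p = 1 by rewrite /eta_p (negPf pQ').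
  (* A nonempty slice contains a vertex, and a single vertex already carries the proportion [rho] of
     the mass. *)
  have mass_or (D : pred nat) (g : 'I_K -> R) (t : R) (c : 'I_K -> R) : 0 < t ->
      t = root4 (\sum_i g i) -> massS D = \sum_i g i ->
      (forall v, v \in S -> D v -> rho * massS D <= mu v) ->
      (forall i, g i = massS (fun v => D v && (logn p v == i))) ->
      (forall i, 0 <= c i) ->
      (forall P : pred 'I_K, root4 (\sum_(i | P i) g i) = t * root4 (\sum_(i | P i) c i ^+ 4)) ->
      forall i, c i = 0 \/ rho <= c i ^+ 4.
    move=> t0 tE DE hD gE c0 fac i.
    have sg0 : 0 <= \sum_j g j by rewrite -DE massS_ge0.
    have gi : g i = t ^+ 4 * c i ^+ 4.
      have := fac (pred1 i); rewrite !big_pred1_eq root4_exp4 // => H.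
      by rewrite -exprMn -H root4K // gE massS_ge0.
    have t4 : t ^+ 4 = massS D by rewrite tE root4K // DE.
    have t40 : 0 < t ^+ 4 by rewrite exprn_gt0.
    have [/hasP[v vS /andP[Dv lv]]|/hasPn none] := boolP (has (fun v => D v && (logn p v == i)) S).
      right; rewrite -(ler_pM2l t40) -gi t4 mulrC; apply: le_trans (hD v vS Dv) _.
      rewrite gE /massS (bigD1_seq_cond _ _ vS uS) ?Dv //= lerDl.
      by apply: sumr_ge0 => ? _; exact: mu_ge0.
    left; apply/eqP; have : g i == 0.
      rewrite gE /massS big_seq_cond big_pred0 // => v; apply/negbTE.
      by case vS: (v \in S) => //=; exact: none.
    by rewrite gi mulf_eq0 !expf_eq0 /= (gt_eqF t0).
  apply: (@one_prime_heavy R K u w _ (hp p) rho) => //.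
  - by rewrite h0.
  - exact: heavy.
  - by move=> i j; apply: le_trans (hG i j) _; rewrite eta1 if_same mul1r.
  - exact: (mass_or A al x u).
  - exact: (mass_or B be y w).
case: ltrP => hbig.
  apply: le_trans (one_prime_crude u0 w0 su sw h0 e1 hG h1) _.
  (* Since p >= 2, this is a rational upper bound for 2^(-1/4); it turns the crude bound into 3 (1 +
     34/3) = 37, below 40. *)
  have h85 : hp p <= 17 / 20.
    apply: ler_pow4; first by lra.
    rewrite hp4; apply: (@le_trans _ _ 2^-1); first by case/andP: pinv.
    have -> : (17 / 20 : R) ^+ 4 = (17 * 17 / 400) ^+ 2 by field.
    by rewrite expr2; lra.
  have hd : hp p / (1 - hp p) <= 17 / 3 by rewrite ler_pdivrMr ?subr_gt0 //; lra.
  have hd0 : 0 <= hp p / (1 - hp p) by rewrite divr_ge0 ?subr_ge0 // ltW.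
  apply: (@le_trans _ _ (3 * (1 + 2 * (17 / 3)))); last by lra.
  by apply: ler_pM => //; lra.
apply: (one_prime_bound u0 w0 su sw h0 e1 hG hbig e3) => k.
have xE' : root4 (\sum_(i < K | (k <= i)%N) al i) = x * root4 (\sum_(i < K | (k <= i)%N) u i ^+ 4).
  exact: facu.
have yE' : root4 (\sum_(i < K | (k <= i)%N) be i) = y * root4 (\sum_(i < K | (k <= i)%N) w i ^+ 4).
  exact: facw.
have := SK k; rewrite xE' yE' pQ'.
set c := (if _ then _ else _ : R); set s1 := \sum_(j < K | _) _; set s2 := \sum_(i < K | _) _.
rewrite -!mulr_suml -/s1 -/s2 -!mulrDl ler_pdivrMr => [H|]; last first.
  by rewrite mulr_gt0 // exprn_gt0 // mulr_gt0.
apply: le_trans H _; rewrite le_eqVlt; apply/orP; left; apply/eqP.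
by move: (root4 _) (root4 _) => r1 r2; ring.
Qed.

Lemma overlap_claim_all ps : all prime ps -> uniq ps ->
  (forall p, p \in ps -> p \notin Q -> 64 * hp p ^+ 2 <= rho) -> overlap_claim ps.
Proof.
elim: ps => [|p ps IH] /=; first by move=> *; exact: overlap_claim0.
move=> /andP[pp prps] /andP[pps ups] heavy; apply: prime_step => //.
  by apply: IH => // q qps; apply: heavy; rewrite inE qps orbT.
by apply: heavy; rewrite inE eqxx.
Qed.

End Overlaps.

Lemma sum_hp5 (R : realType) (s : seq nat) : uniq s -> all (fun p => (1 < p)%N) s ->
  \sum_(p <- s) hp R p ^+ 5 <= 4.
Proof.
move=> us /allP s1.
have [N sN] : exists N, {subset s <= iota 2 N}.
  exists (\max_(q <- s) q).+1 => q qs; rewrite mem_iota s1 //=.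
  apply: leq_trans (leq_addl 2 _); rewrite ltnS; exact: leq_bigmax_seq.
have h0 p : 0 <= hp R p by exact: root4_ge0.
apply: (@le_trans _ _ (\sum_(p <- iota 2 N) hp R p ^+ 5)).
  by apply: sum_uniq_sub => //; [exact: iota_uniq | move=> i _; exact: exprn_ge0].
suff H : \sum_(p <- iota 2 N) hp R p ^+ 5 <= 4 * (1 - hp R N.+1).
  by apply: le_trans H _; have := h0 N.+1; lra.
elim: N {sN} => [|N IH].
  by rewrite big_nil /hp invr1 /root4 !sqrtr1 subrr mulr0.
rewrite -(addn1 N) iotaD big_cat /= big_cons big_nil addr0 add2n addn1.
apply: le_trans (lerD IH (lexx _)) _.
set n := N.+1; set x := hp R n; set y := hp R n.+1.
have y0 : 0 < y by rewrite /y /hp /root4 !sqrtr_gt0 invr_gt0 ltr0n.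
have x0 : 0 < x by rewrite /x /hp /root4 !sqrtr_gt0 invr_gt0 ltr0n.
have yx : y <= x by rewrite ler_root4 // lef_pV2 ?posrE ?ltr0n // ler_nat.
have xE : x ^+ 4 = n%:R^-1 by exact: hp4.
have yE : y ^+ 4 = n.+1%:R^-1 by exact: hp4.
(* 1/x and 1/y are consecutive fourth roots: y^-4 - x^-4 = 1, hence x - y >= y^5 / 4 *)
have xy4 : x ^+ 4 - y ^+ 4 = x ^+ 4 * y ^+ 4.
  rewrite xE yE; have -> : n.+1%:R = n%:R + 1 :> R by rewrite -natr1.
  have n0 : n%:R != 0 :> R by rewrite pnatr_eq0.
  have n1 : n%:R + 1 != 0 :> R by rewrite natr1 pnatr_eq0.
  by field; rewrite n0 n1.
suff : y ^+ 5 <= 4 * (x - y) by lra.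
have f : x ^+ 4 - y ^+ 4 = (x - y) * ((x + y) * (x ^+ 2 + y ^+ 2)) by ring.
have x30 : 0 < x ^+ 3 by rewrite exprn_gt0.
have b : (x + y) * (x ^+ 2 + y ^+ 2) <= 4 * x ^+ 3.
  have -> : 4 * x ^+ 3 = (x + x) * (x ^+ 2 + x ^+ 2) by ring.
  apply: ler_pM; [lra | by rewrite addr_ge0 ?sqr_ge0 | lra |].
  by rewrite lerD2l lerXn2r ?nnegrE // ltW.
have c : x ^+ 4 * y ^+ 4 <= (x - y) * (4 * x ^+ 3).
  by rewrite -xy4 f ler_wpM2l // subr_ge0.
have d : x * y ^+ 4 <= 4 * (x - y).
  rewrite -(ler_pM2l x30); apply: le_trans (le_trans _ c) _.
    by rewrite (exprSr x 3) -[leRHS]mulrA.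
  by rewrite le_eqVlt; apply/orP; left; apply/eqP; ring.
by apply: le_trans d; rewrite exprS ler_wpM2r // exprn_ge0 // ltW.
Qed.

(** At most [N0] primes lie below 10^40, each costing a factor 40. For the others, [eta_p ^+ 4 - 1]
    is of size z / p and vanishes for p <= z, so it contributes the sum of z / p^2 over p > z,
    bounded uniformly in [z]; the remaining terms p^(-5/4) are summable. *)
Lemma kap_prod_bound (R : realType) : exists C : R, 0 < C /\
  forall (Q : seq nat) (z : nat) (ps : seq nat), (0 < z)%N -> all prime ps -> uniq ps ->
    expR 1 <= 3 :> R -> \prod_(p <- ps) kap R Q z p <= C.
Proof.
pose N0 := (Num.trunc ((10 ^+ 10) ^+ 4 : R)).+1.
exists (40 ^+ N0 * expR (2 * expR 4 + 10 ^+ 5 * 4)).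
have c40 : 1 <= (40 : R) by lra.
split; first by rewrite mulr_gt0 ?expR_gt0 // exprn_gt0 //; lra.
move=> Q z ps z0 /allP prps ups e3.
have zR : 0 < z%:R :> R by rewrite ltr0n.
pose small p := 1 < hp R p * 10 ^+ 10.
pose g p : R := (if (z < p)%N then 2 * expR 4 * z%:R / p%:R ^+ 2 else 0) + 10 ^+ 5 * hp R p ^+ 5.
have h0 p : 0 <= hp R p by exact: root4_ge0.
have g0 p : 0 <= g p.
  rewrite addr_ge0 //; last by apply: mulr_ge0; exact: exprn_ge0.
  by case: ifP => // _; rewrite divr_ge0 ?exprn_ge0 // !mulr_ge0 ?expR_ge0.
have kapE p : p \in ps -> kap R Q z p <= (if small p then 40 else 1) * (1 + g p).
  move=> pps; rewrite /kap; case: ifP => [_|_].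
    apply: (@le_trans _ _ (1 * (1 + g p))); first by rewrite mul1r lerDl.
    by apply: ler_wpM2r; [rewrite addr_ge0 | case: (small p)].
  rewrite -/(small p); case: (small p); first by rewrite -[leLHS]mulr1 ler_wpM2l ?lerDl.
  rewrite mul1r -addrA lerD2l /g lerD2r.
  have p0 : 0 < p%:R :> R by rewrite ltr0n prime_gt0 // prps.
  have [zp|zp] := boolP (z < p)%N; last first.
    by rewrite /eta_p (negPf zp) andbF expr1n subrr !mul0r.
  pose t : R := z%:R / p%:R.
  have t0 : 0 <= t by rewrite divr_ge0.
  have t1 : t <= 1 by rewrite ler_pdivrMr // mul1r ler_nat ltnW.
  have et : eta_p R Q z p ^+ 4 - 1 <= 4 * t * expR 4.
    rewrite /eta_p zp andbT; case: ifP => _; last first.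
      by rewrite expr1n subrr; apply: mulr_ge0; [exact: mulr_ge0 | exact: expR_ge0].
    rewrite -/t -expRM_natl lerBlDl; have t40 : 0 <= 4 * t by rewrite mulr_ge0.
    apply: le_trans (expR_le1Mx t40) _; rewrite lerD2l ler_wpM2l // ler_expR.
    by rewrite -[leRHS]mulr1 ler_wpM2l.
  rewrite hp4; have -> : 2 * expR 4 * z%:R / p%:R ^+ 2 = (4 * t * expR 4) * p%:R^-1 / 2.
    by rewrite /t; field; rewrite gt_eqF.
  by rewrite ler_pM2r ?invr_gt0 // ler_pM2r ?invr_gt0.
apply: (@le_trans _ _ (\prod_(p <- ps) ((if small p then 40 else 1) * (1 + g p)))).
  rewrite big_seq [leRHS]big_seq; apply: ler_prod => p pps; rewrite kapE // andbT.
  by rewrite (le_trans ler01) // kap_ge1 // prps.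
rewrite big_split /=; apply: ler_pM.
- by apply: prodr_ge0 => p _; case: (small p).
- by apply: prodr_ge0 => p _; rewrite addr_ge0.
- rewrite -big_mkcond big_const_seq iter_mulr_1 ler_weXn2l //.
  rewrite -size_filter -[leqRHS](size_iota 0); apply: uniq_leq_size; first exact: filter_uniq.
  move=> p; rewrite mem_filter mem_iota /= => /andP[sp pps]; rewrite add0n.
  have p0 : 0 < p%:R :> R by rewrite ltr0n prime_gt0 // prps.
  have : p%:R < (10 ^+ 10) ^+ 4 :> R.
    have : 1 ^+ 4 < (hp R p * 10 ^+ 10) ^+ 4 by rewrite ltrXn2r // mulr_ge0 // exprn_ge0.
    by rewrite expr1n exprMn hp4 mulrC ltr_pdivlMr // mul1r.
  have /andP[_ H] := trunc_itv (exprn_ge0 4 (exprn_ge0 10 (ler0n R 10))).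
  move=> pl; have := lt_trans pl H; rewrite ltr_nat; exact.
apply: le_trans (prod_1D_le_expR _ g0) _; rewrite ler_expR /g big_split /= lerD //.
  rewrite -big_mkcond -big_filter /=.
  rewrite (eq_bigr (fun p => 2 * expR 4 * z%:R * p%:R ^- 2)) // -mulr_sumr.
  rewrite -ler_pdivlMl ?mulr_gt0 ?expR_gt0 //.
  rewrite invfM mulrAC mulVf ?mul1r ?gt_eqF ?mulr_gt0 ?expR_gt0 //.
  apply: sum_inv_sq_tail => //; first exact: filter_uniq.
  by apply/allP => q; rewrite mem_filter => /andP[].
rewrite -mulr_sumr ler_wpM2l ?exprn_ge0 // sum_hp5 //.
by apply/allP => p /prps /prime_gt1.
Qed.

Lemma expR1_le3 (R : realType) : expR 1 <= 3 :> R.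
Proof.
have h := expR_ge1Dx (- 6^-1 : R); have e0 := expR_gt0 (6^-1 : R).
have h6 : expR (6^-1 : R) <= 6 / 5.
  move: h; rewrite expRN -[leRHS]div1r ler_pdivlMr // => h.
  by rewrite ler_pdivlMr //; lra.
have -> : (1 : R) = 6%:R * 6^-1 by rewrite divff // pnatr_eq0.
rewrite expRM_natl; apply: (@le_trans _ _ ((6 / 5) ^+ 6)).
  by rewrite lerXn2r ?nnegrE ?expR_ge0 // divr_ge0.
have -> : (6 / 5 : R) ^+ 6 = (6 * 6 * 6 / 125) ^+ 2 by field.
by rewrite expr2; lra.
Qed.

Lemma expR1_ge (R : realType) : 12 / 5 <= expR 1 :> R.
Proof.
have -> : (1 : R) = 4%:R * 4^-1 by rewrite divff // pnatr_eq0.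
rewrite expRM_natl; apply: (@le_trans _ _ ((5 / 4) ^+ 4)); last first.
  rewrite lerXn2r ?nnegrE ?expR_ge0 ?divr_ge0 //.
  by apply: le_trans (expR_ge1Dx _); lra.
have -> : (5 / 4 : R) ^+ 4 = (25 / 16) ^+ 2 by field.
by rewrite expr2; lra.
Qed.

(** The induction is started from the pair (1, 1) with no valuation prescribed. Both sides of the
    graph are [S], whence the exponent 6 = 3 + 3. *)
Lemma overlap_prop (R : realType) : exists C : R, 0 < C /\
  forall (Q : seq nat) (z : nat) (m T rho : R) (S : seq nat) (psi : nat -> R),
    all prime Q -> uniq Q -> (0 < z)%N -> 0 <= T -> uniq S -> all (fun v => (0 < v)%N) S ->
    (forall v, 0 <= psi v) -> 0 <= rho ->
    (forall p, prime p -> p \notin Q -> 64 * hp R p ^+ 2 <= rho) ->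
    (forall v, v \in S -> rho * massS Q S psi xpredT <= mu Q psi v) ->
    totS Q S psi xpredT xpredT (close_pair Q z m T psi) <=
      C * Num.sqrt T * expR (- (z%:R * m)) * root4 (massS Q S psi xpredT) ^+ 6.
Proof.
have [C [C0 HC]] := kap_prod_bound R.
exists (base_const R * C); split.
  by rewrite mulr_gt0 // /base_const mulr_gt0 // /root4 !sqrtr_gt0 mulr_gt0 ?expR_gt0.
move=> Q z m T rho S psi pQ uQ z0 T0 uS posS psi0 rho0 heavy massv.
have e3 := expR1_le3 R.
pose ps := [seq p <- iota 0 (\max_(v <- S) v).+1 | prime p].
have prps : all prime ps by apply/allP => p; rewrite mem_filter => /andP[].
have ups : uniq ps by rewrite filter_uniq // iota_uniq.
have := overlap_claim_all (m := m) pQ uQ z0 T0 uS posS psi0 e3 rho0 prps ups.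
move=> /(_ (fun p pps => heavy p (allP prps p pps))) claim.
have := claim xpredT xpredT (close_pair Q z m T psi) 1%N 1%N isT isT.
move=> H; apply: le_trans (H _ _ _ _ _ _ _) _; rewrite ?dvd1n //.
- move=> v w vS wS _ _ _ q pq qps.
  have out u : u \in S -> logn q u = 0%N.
    move=> uS'; apply/eqP; rewrite -leqn0 leqNgt logn_gt0 mem_primes pq (allP posS) //=.
    apply/negP => /dvdn_leq; rewrite (allP posS) // => /(_ isT) qu.
    move: qps; rewrite mem_filter pq mem_iota /= add0n ltnS => /negP; apply.
    by apply: leq_trans qu _; exact: leq_bigmax_seq.
  by rewrite (out v) // (out w) // logn1.
- by move=> q qps; have := prime_gt1 (allP prps _ qps); rewrite dvdn1; case: q {qps} => [|[]].
- by move=> v vS _; apply: massv.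
- by move=> v vS _; apply: massv.
have -> : bound_at Q z m 1 1 = expR (- (z%:R * m)).
  rewrite /bound_at /gcd_ratio gcd1n /phi_ratio.
  rewrite !big1_seq; first by rewrite expr1n !mulr1 divr1 /root4 !sqrtr1 mul1r /Lpair big1 ?sub0r ?mulrN //;
    move=> q; rewrite logn1 eqxx andbF.
  move=> q /andP[]; rewrite dvdn1 => /eqP -> /(allP pQ) //.
set M := root4 (massS _ _ _ _); rewrite -expr2 -exprM.
apply: ler_wpM2r; first by rewrite exprn_ge0 // root4_ge0.
apply: ler_wpM2r; first exact: expR_ge0.
apply: ler_wpM2r; first exact: sqrtr_ge0.
apply: ler_wpM2l; first by rewrite /base_const mulr_ge0 ?root4_ge0.
exact: HC.
Qed.

(** * Sieve bounds for pairs of arcs *)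

Section Primorial.
Local Open Scope nat_scope.

Lemma prod_primes_dvd (s : seq nat) (n : nat) : all prime s -> uniq s ->
  all (fun q => q %| n) s -> \prod_(q <- s) q %| n.
Proof.
elim: s => [|q s IH] /=; first by rewrite big_nil dvd1n.
move=> /andP[pq ps] /andP[qs us] /andP[qn sn]; rewrite big_cons Gauss_dvd ?qn ?IH //.
rewrite prime_coprime //; apply/negP => qd; move/negP: qs; apply.
elim: s ps qd {us sn IH} => [|r s IH] /=; first by rewrite big_nil dvdn1 => _ /eqP q1; rewrite q1 in pq.
move=> /andP[pr ps]; rewrite big_cons Euclid_dvdM // dvdn_prime2 // inE.
by case/orP => [-> //|/(IH ps) ->]; rewrite orbT.
Qed.

Lemma prime_ndvd_fact q n : prime q -> n < q -> ~~ (q %| n`!).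
Proof.
move=> pq; elim: n => [|n IH] nq; first by rewrite dvdn1 neq_ltn prime_gt1 ?orbT.
by rewrite factS Euclid_dvdM // negb_or IH ?(ltnW nq) // andbT gtnNdvd.
Qed.

(** The expansion of (1 + 1)^(2m+1) contains this binomial coefficient twice. *)
Lemma bin_mid_le m : 'C(m.*2.+1, m) <= 4 ^ m.
Proof.
rewrite -(leq_pmul2l (isT : 0 < 2)).
have -> : 2 * 4 ^ m = 2 ^ (m.*2.+1) by rewrite expnS -mul2n expnM.
have := Pascal 1 1 (m.*2.+1); rewrite addn1 => ->.
have m1 : m.+1 < m.*2.+2 by rewrite -addnn; lia.
rewrite (bigD1 (inord m)) //= (bigD1 (inord m.+1)) //=; last first.
  by rewrite -(inj_eq val_inj) /= !inordK // -?addnn; lia.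
rewrite !inordK // -?addnn ?exp1n; try lia.
rewrite ?exp1n ?muln1 addnA addnn -mul2n.
have -> : 'C((2 * m).+1, m.+1) = 'C((2 * m).+1, m).
  by rewrite -bin_sub; [congr 'C(_, _); lia | lia].
by rewrite [in X in X <= _]mulSn mul1n leq_addr.
Qed.

(** For n = 2m + 1 the primes in (m + 1, n] divide ['C(m.*2.+1, m)], and the others are covered by
    induction; an even n > 2 adds no prime. *)
Lemma primorial_le n : \prod_(q <- iota 0 n.+1 | prime q) q <= 4 ^ n.
Proof.
have [k] := ubnP n; elim: k n => // k IH n nk.
have [n2|n2] := leqP n 2.
  by case: n n2 {nk} => [|[|[]]] // _; rewrite /= !big_cons big_nil.
have [[m nE]|[m nE]] : {m | n = m.*2.+1} + {m | n = m.*2}.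
  by case: (boolP (odd n)) => on; [left|right]; exists n./2; rewrite -{1}(odd_double_half n) ?on // (negPf on).
- have m1n : m.+2 <= n.+1 by rewrite nE -addnn; lia.
  have -> : iota 0 n.+1 = iota 0 m.+2 ++ iota m.+2 (n.+1 - m.+2) by rewrite -iotaD subnKC.
  have mk : m.+1 < k by move: nk n2; rewrite nE -addnn; lia.
  rewrite big_cat (_ : 4 ^ n = 4 ^ m.+1 * 4 ^ m); last first.
    by rewrite nE -expnD; congr (4 ^ _); rewrite -addnn; lia.
  apply: leq_mul; first exact: IH.
  apply: leq_trans (bin_mid_le m); rewrite -big_filter dvdn_leq //.
    by rewrite bin_gt0 -addnn; lia.
  apply: prod_primes_dvd.
  - by apply/allP => q; rewrite mem_filter => /andP[].
  - by rewrite filter_uniq // iota_uniq.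
  apply/allP => q; rewrite mem_filter mem_iota => /and3P[pq mq qn].
  have qn' : q <= m.*2.+1 by move: mq qn; rewrite nE -addnn; lia.
  have : q %| (m.*2.+1)`! by rewrite dvdn_fact // prime_gt0.
  have mle : m <= m.*2.+1 by rewrite -addnn; lia.
  rewrite -(bin_fact mle) (_ : m.*2.+1 - m = m.+1); last by rewrite -addnn; lia.
  rewrite Euclid_dvdM // => /orP[-> //|].
  by rewrite Euclid_dvdM // (negPf (prime_ndvd_fact pq (ltnW mq))) (negPf (prime_ndvd_fact pq mq)).
have -> : iota 0 n.+1 = iota 0 n ++ [:: n] by rewrite -addn1 iotaD.
have pn : prime n = false.
  apply/negbTE; rewrite nE; apply/negP => /primeP[_ /(_ 2)]; rewrite -muln2 dvdn_mull // => /(_ isT).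
  by move: n2; rewrite nE -muln2; lia.
rewrite big_cat /= big_cons pn big_nil muln1.
case: n {pn nE} n2 nk => // n n2 nk.
by apply: leq_trans (IH n nk) _; rewrite leq_exp2l.
Qed.

End Primorial.

(** * Counting by the Chinese remainder theorem *)

Section CRT.
Variable R : realFieldType.

Lemma sum_shift (g : nat) (F : nat -> R) t : (forall j, F (j + g)%N = F j) ->
  \sum_(j <- iota 0 g) F (j + t)%N = \sum_(j <- iota 0 g) F j.
Proof.
move=> per; elim: t => [|t IH]; first by under eq_bigr => j _ do rewrite addn0.
rewrite -IH; case: g per {IH} => [|g] per; first by rewrite !big_nil.
rewrite -[in LHS](addn1 g) iotaD big_cat /= big_cons big_nil addr0.
rewrite [in RHS]/= big_cons addrC; congr (_ + _).
  by rewrite add0n addnS -addSn addnC per.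
rewrite (iotaDl 1 0) big_map; apply: eq_bigr => j _; congr F; lia.
Qed.

Lemma sum_residues (q M j : nat) (F : nat -> R) : (0 < q)%N -> coprime M q ->
  (forall i, F (i %% q)%N = F i) ->
  \sum_(i <- iota 0 q) F (j + i * M)%N = \sum_(i <- iota 0 q) F i.
Proof.
move=> q0 cMq per; under eq_bigr => i _ do rewrite -per.
rewrite -(big_map (fun i => (j + i * M) %% q)%N xpredT F); apply: perm_big.
have [sz sub] : (size (iota 0 q) <= size [seq ((j + i * M) %% q)%N | i <- iota 0 q])%N /\
    {subset [seq ((j + i * M) %% q)%N | i <- iota 0 q] <= iota 0 q}.
  rewrite size_map; split=> // x /mapP[i _ ->].
  by rewrite mem_iota /= add0n ltn_mod.
have um : uniq [seq ((j + i * M) %% q)%N | i <- iota 0 q].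
  rewrite map_inj_in_uniq ?iota_uniq // => x y; rewrite !mem_iota /= !add0n => xq yq /eqP.
  rewrite eqn_modDl => /eqP H; wlog xy : x y xq yq H / (x <= y)%N.
    by move=> W; case/orP: (leq_total x y) => [/W|/W ->] //; apply.
  move/eqP: H; rewrite eq_sym eqn_mod_dvd ?leq_mul2r ?xy ?orbT // -mulnBl Gauss_dvdl 1?coprime_sym //.
  move=> /dvdnP[[|c]] e; first by apply/eqP; rewrite eqn_leq xy -subn_eq0 e.
  by have := leq_ltn_trans (leq_subr x y) yq; rewrite e mulSn ltnNge leq_addr.
have [_ eqm] := uniq_min_size um sub sz.
by apply: uniq_perm; rewrite ?iota_uniq.
Qed.

(* Averaging over the shifts j + i * (prod Q), i < q, decouples the condition mod q from those mod Q. *)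
Lemma crt_count (g : nat) (Q : seq nat) (bad : nat -> pred nat) :
  all prime Q -> uniq Q -> (0 < g)%N -> all (fun q => q %| g)%N Q ->
  (forall q j, bad q (j %% q)%N = bad q j) ->
  \sum_(j <- iota 0 g | all (fun q => ~~ bad q j) Q) 1 =
    g%:R * \prod_(q <- Q) (1 - (count (bad q) (iota 0 q))%:R / q%:R) :> R.
Proof.
move=> + + g0; elim: Q => [_ _ _ _|q Q IH /= /andP[pq pQ] /andP[qQ uQ] /andP[qg Qg] per].
  by rewrite big_nil mulr1 big_const_seq iter_addr_0 count_predT size_iota.
have q0 := prime_gt0 pq.
pose M := (\prod_(r <- Q) r)%N.
have rM r : r \in Q -> (r %| M)%N by move=> rQ; rewrite /M (big_rem r) //= dvdn_mulr.
have cMq : coprime M q.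
  rewrite coprime_sym prime_coprime //; apply/negP => qM.
  have : has (fun r => q %| r)%N Q.
    rewrite /M in qM; elim: (Q) qM => [|r s IHs]; first by rewrite big_nil dvdn1 => /eqP q1; rewrite q1 in pq.
    by rewrite big_cons Euclid_dvdM //= => /orP[->|/IHs ->] //; rewrite orbT.
  move=> /hasP[r rQ]; rewrite (dvdn_prime2 pq (allP pQ _ rQ)) => /eqP qr.
  by rewrite qr rQ in qQ.
pose P j := all (fun r => ~~ bad r j) Q.
have badM r t j : r \in Q -> (r %| t)%N -> bad r (j + t)%N = bad r j.
  by move=> rQ rt; rewrite -per -modnDmr (eqP rt) addn0 per.
have Pshift i j : P (j + i * M)%N = P j.
  by apply: eq_in_all => r rQ; rewrite badM // dvdn_mull ?rM.
pose f j : R := if P j && ~~ bad q j then 1 else 0.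
have fg j : f (j + g)%N = f j.
  rewrite /f; congr (if _ && ~~ _ then _ else _).
    by apply: eq_in_all => r rQ; rewrite badM // (allP Qg).
  by rewrite -per -modnDmr (eqP qg) addn0 per.
have S0 : \sum_(j <- iota 0 g | ~~ bad q j && P j) 1 = \sum_(j <- iota 0 g) f j.
  by rewrite big_mkcond; apply: eq_bigr => j _; rewrite andbC.
rewrite S0 big_cons mulrCA -IH //.
pose c := count (bad q) (iota 0 q).
have cq : \sum_(i <- iota 0 q) (if bad q i then 0 else 1 : R) = q%:R - c%:R.
  rewrite -[q in RHS](size_iota 0) -(count_predC (bad q)) natrD /c addrAC subrr add0r.
  by rewrite -sum1_count natr_sum [RHS]big_mkcond; apply: eq_bigr => i _ /=; case: (bad q i).
have qR : q%:R != 0 :> R by rewrite pnatr_eq0 -lt0n.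
suff H : q%:R * \sum_(j <- iota 0 g) f j = (q%:R - c%:R) * \sum_(j <- iota 0 g | P j) 1.
  apply: (mulfI qR); rewrite H mulrA; congr (_ * _).
  by rewrite mulrBr mulr1 mulrCA divff // mulr1.
have -> : q%:R * \sum_(j <- iota 0 g) f j = \sum_(i <- iota 0 q) \sum_(j <- iota 0 g) f (j + i * M)%N.
  rewrite [RHS](eq_bigr (fun=> \sum_(j <- iota 0 g) f j)) => [|i _]; last exact: sum_shift.
  by rewrite big_const_seq count_predT size_iota iter_addr_0 mulr_natl.
rewrite exchange_big /= mulr_sumr [RHS]big_mkcond; apply: eq_bigr => j _.
rewrite /f; under eq_bigr => i _ do rewrite Pshift.
case: (P j) => /=; last by rewrite big1.
rewrite mulr1 -cq -(sum_residues j q0 cMq (F := fun i => if bad q i then 0 else 1)).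
  by apply: eq_bigr => i _; case: (bad q _).
by move=> i; rewrite per.
Qed.

End CRT.

Definition numer (Q : seq nat) (d : nat) : seq nat :=
  [seq p <- iota 0 d | all (fun q => ~~ ((q %| d) && (q %| p))%N) Q].

(** The pairs of sieved numerators with p/d - r/e = k / lcm(d, e), written without division. *)
Definition sols (Q : seq nat) (d e k : nat) : seq (nat * nat) :=
  [seq x <- [seq (p, r) | p <- numer Q d, r <- numer Q e] |
    (x.1 * (e %/ gcdn d e) == x.2 * (d %/ gcdn d e) + k)%N].

Definition unit_inv (R : realType) (Q : seq nat) (n : nat) : R :=
  \prod_(q <- Q | (q %| n)%N) (1 - q%:R^-1)^-1.

Lemma count_residue (q b c : nat) : prime q -> ~~ (q %| c)%N ->
  count (fun j => q %| b + j * c)%N (iota 0 q) = 1%N.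
Proof.
move=> pq qc; have q0 := prime_gt0 pq.
have cq : coprime c q by rewrite coprime_sym prime_coprime.
have H := @sum_residues rat q c b (fun i => if (q %| i)%N then 1 else 0) q0 cq.
have {}H := H (fun i => congr1 (fun x : bool => if x then 1 else 0) (_ : (q %| i %% q)%N = (q %| i)%N)).
apply/eqP; rewrite -(eqr_nat rat) -sum1_count natr_sum big_mkcond H; last first.
  by move=> i; rewrite /dvdn modn_mod.
case: q q0 {H pq qc cq} => // q _; rewrite /= big_cons dvdn0 big1_seq ?addr0 // => i /=.
by rewrite mem_iota add1n => /andP[i0 iq]; rewrite gtnNdvd.
Qed.

Section Solutions.
Variables (R : realType) (Q : seq nat).
Hypotheses (pQ : all prime Q) (uQ : uniq Q).

Lemma size_numer d : (0 < d)%N -> (size (numer Q d))%:R = d%:R * phi_ratio Q d :> R.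
Proof.
move=> d0; pose Qd := [seq q <- Q | (q %| d)%N].
have pQd : all prime Qd by apply/allP => q; rewrite mem_filter => /andP[_]; exact: (allP pQ).
have := @crt_count R d Qd (fun q j => (q %| j)%N) pQd (filter_uniq _ uQ) d0.
have dQd : all (fun q => q %| d)%N Qd by apply/allP => q; rewrite mem_filter => /andP[].
have per q j : (q %| j %% q)%N = (q %| j)%N by rewrite /dvdn modn_mod.
move=> /(_ dQd per).
rewrite -sum1_size natr_sum => H; rewrite /numer [LHS]big_filter.
rewrite (eq_bigl (fun j => all (fun q => ~~ (q %| j)%N) Qd)); last first.
  by move=> j; rewrite all_filter; apply: eq_in_all => q _ /=; rewrite negb_and implybE.
rewrite H; congr (_ * _); rewrite big_filter /phi_ratio big_seq_cond [RHS]big_seq_cond.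
apply: eq_bigr => q /andP[/(allP pQ) pq _]; congr (1 - _).
have := @count_residue q 0 1 pq; rewrite dvdn1 neq_ltn prime_gt1 ?orbT // => /(_ isT) c1.
rewrite (eq_count (a2 := fun j => q %| 0 + j * 1)%N) ?c1 ?mul1r // => j.
by rewrite add0n muln1.
Qed.

Variables d e : nat.
Hypotheses (d0 : (0 < d)%N) (e0 : (0 < e)%N).
Let g := gcdn d e.
Let d' := (d %/ g)%N.
Let e' := (e %/ g)%N.

Let g0 : (0 < g)%N. Proof. by rewrite gcdn_gt0 d0. Qed.
Let dE : d = (g * d')%N. Proof. by rewrite mulnC divnK // dvdn_gcdl. Qed.
Let eE : e = (g * e')%N. Proof. by rewrite mulnC divnK // dvdn_gcdr. Qed.
Let d'0 : (0 < d')%N. Proof. by move: d0; rewrite dE muln_gt0 => /andP[]. Qed.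
Let e'0 : (0 < e')%N. Proof. by move: e0; rewrite eE muln_gt0 => /andP[]. Qed.
Let cop : coprime d' e'.
Proof.
have : (g * gcdn d' e')%N = (g * 1)%N by rewrite muln_gcdr -dE -eE muln1.
by move=> /eqP; rewrite eqn_pmul2l.
Qed.

Lemma mem_sols k p r : (p, r) \in sols Q d e k ->
  [/\ p \in numer Q d, r \in numer Q e & (p * e' = r * d' + k)%N].
Proof.
rewrite mem_filter /= => /andP[/eqP eq /allpairsP[[x y] /= [xd ye [px ry]]]].
by split; [rewrite px | rewrite ry | exact: eq].
Qed.

Lemma mem_numer n p q : p \in numer Q n -> q \in Q -> (q %| n)%N -> ~~ (q %| p)%N.
Proof. by rewrite mem_filter => /andP[/allP H _] /H; rewrite negb_and => /orP[/negP|]. Qed.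

Lemma numer_lt n p : p \in numer Q n -> (p < n)%N.
Proof. by rewrite mem_filter mem_iota add0n => /andP[_ /andP[]]. Qed.

(** If [q] divides d' and k, it divides p e' and hence p, because d' and e' are coprime; but [q]
    divides d, so p was sieved out. The case of e' is symmetric. *)
Lemma sols_coprime k q : (0 < size (sols Q d e k))%N -> q \in Q -> (q %| d' * e')%N -> ~~ (q %| k)%N.
Proof.
case sE: (sols Q d e k) => [//|[p r] s] _ qQ qm.
have [pd re eq] : [/\ p \in numer Q d, r \in numer Q e & (p * e' = r * d' + k)%N].
  by apply: mem_sols; rewrite sE mem_head.
have pq := allP pQ _ qQ.
have npr : coprime d' e' -> ~~ ((q %| d')%N && (q %| e')%N).
  move=> c; apply/negP => qde; have : (q %| gcdn d' e')%N by rewrite dvdn_gcd.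
  by rewrite (eqP c) dvdn1 => /eqP q1; rewrite q1 in pq.
apply/negP => qk; move: qm; rewrite Euclid_dvdM // => /orP[qd'|qe'].
  have qe' : ~~ (q %| e')%N by move: (npr cop); rewrite qd'.
  have : (q %| p * e')%N by rewrite eq dvdn_add // dvdn_mull.
  rewrite Euclid_dvdM // (negPf qe') orbF; apply/negP.
  by apply: mem_numer pd qQ _; rewrite dE dvdn_mull.
have qd' : ~~ (q %| d')%N by move: (npr cop); rewrite qe' andbT.
have : (q %| r * d' + k)%N by rewrite -eq dvdn_mull.
rewrite dvdn_addl // Euclid_dvdM // (negPf qd') orbF; apply/negP.
by apply: mem_numer re qQ _; rewrite eE dvdn_mull.
Qed.

Lemma uniq_sols k : uniq (sols Q d e k).
Proof.
rewrite filter_uniq // allpairs_uniq ?filter_uniq ?iota_uniq //.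
by move=> [? ?] [? ?] /=.
Qed.

(** Two solutions differ by a multiple of (d', e'). Counted from the one with the smallest p, the
    multiplier stays below g because p < d = g d'. *)
Lemma sols_param k : exists p0 r0, (0 < size (sols Q d e k))%N -> (p0 * e' = r0 * d' + k)%N /\
  (size (sols Q d e k) <= count (fun j => all (fun q => ~~ ((q %| p0 + j * d') || (q %| r0 + j * e'))%N)
      [seq q <- Q | q %| g]) (iota 0 g))%N.
Proof.
have [s0|] := posnP (size (sols Q d e k)); first by exists 0%N, 0%N; rewrite s0.
move=> spos.
have ex : exists n, has (fun x => x.1 == n) (sols Q d e k).
  case: (sols Q d e k) spos => [//|x s] _; exists x.1; by rewrite /= eqxx.
have [n /hasP[[p0 r0] xs /= /eqP p0n] nmin] := ex_minnP ex.
exists p0, r0 => _; have [p0d r0e eq0] := mem_sols xs.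
split=> //.
pose J (x : nat * nat) := ((x.1 - p0) %/ d')%N.
have JP x : x \in sols Q d e k -> x.1 = (p0 + J x * d')%N /\ x.2 = (r0 + J x * e')%N.
  case: x => p r xs'; have [pd re eq] := mem_sols xs'.
  have pp0 : (p0 <= p)%N.
    by rewrite p0n; apply: nmin; apply/hasP; exists (p, r).
  have rr0 : (r0 <= r)%N.
    rewrite -(leq_pmul2r d'0) -(leq_add2r k) -eq0 -eq; exact: leq_mul.
  have eqd : ((p - p0) * e' = (r - r0) * d')%N.
    by rewrite !mulnBl eq eq0; rewrite subnDr.
  have dp : (d' %| p - p0)%N by rewrite -(Gauss_dvdl _ cop) eqd dvdn_mull.
  rewrite /J /=; split; first by rewrite divnK // subnKC.
  have : (r - r0 = (p - p0) %/ d' * e')%N.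
    apply/eqP; rewrite -(eqn_pmul2r d'0) -eqd mulnAC divnK //.
  by move=> <-; rewrite subnKC.
rewrite -size_filter -(size_map J); apply: uniq_leq_size.
  rewrite map_inj_in_uniq ?uniq_sols // => x y xS yS Jxy.
  have [x1 x2] := JP x xS; have [y1 y2] := JP y yS.
  by rewrite (surjective_pairing x) (surjective_pairing y) x1 x2 y1 y2 Jxy.
move=> j /mapP[[p r] xS ->]; have [x1 x2] := JP _ xS; have [pd re _] := mem_sols xS.
rewrite mem_filter mem_iota /= add0n; apply/andP; split; last first.
  rewrite -(ltn_pmul2r d'0) -dE; apply: leq_ltn_trans (numer_lt pd).
  by rewrite [leqRHS]x1 leq_addl.
apply/allP => q; rewrite mem_filter => /andP[qg qQ]; rewrite -x1 -x2 negb_or.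
rewrite (mem_numer pd qQ) ?(mem_numer re qQ) //.
  by rewrite eE dvdn_mulr.
by rewrite dE dvdn_mulr.
Qed.

Lemma size_sols_le k : (size (sols Q d e k) <= g)%N.
Proof.
have [p0 [r0 H]] := sols_param k.
have [->//|/H[_ h]] := posnP (size (sols Q d e k)).
by apply: leq_trans h _; rewrite -[leqRHS](size_iota 0); exact: count_size.
Qed.

(** The solutions are parametrized by j modulo g, and each prime q of [Q] dividing g forbids
    residues of j: at least one, and two if q divides neither d' e' nor k. Comparing local factors,
    [unit_inv] of d' e' and of k repays the primes that forbid only one. *)
Lemma size_sols_bound k : (0 < k)%N ->
  (size (sols Q d e k))%:R <= g%:R * phi_ratio Q d * phi_ratio Q e *
    unit_inv R Q (d' * e') * unit_inv R Q k.
Proof.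
move=> k0; have fpos (q : nat) : q \in Q -> 0 < (1 : R) - q%:R^-1 <= 1.
  exact: one_sub_inv_bounds.
have inv0 n : 0 <= unit_inv R Q n.
  rewrite /unit_inv big_seq_cond prodr_ge0 // => q /andP[/fpos /andP[q0 _] _].
  by rewrite invr_ge0 ltW.
have [p0 [r0 H]] := sols_param k.
have [->|/H[eq0 {H}h]] := posnP (size (sols Q d e k)).
  by rewrite !mulr_ge0 ?inv0 // ltW // phi_ratio_gt0.
pose Qg := [seq q <- Q | (q %| g)%N].
pose bad q j := ((q %| p0 + j * d') || (q %| r0 + j * e'))%N.
have pQg : all prime Qg by apply/allP => q; rewrite mem_filter => /andP[_]; exact: (allP pQ).
have gQg : all (fun q => q %| g)%N Qg by apply/allP => q; rewrite mem_filter => /andP[].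
have per q j : bad q (j %% q)%N = bad q j.
  have dv b c : (q %| b + j %% q * c)%N = (q %| b + j * c)%N.
    by rewrite /dvdn -modnDmr modnMml modnDmr.
  by rewrite /bad !dv.
have crt := @crt_count R g Qg bad pQg (filter_uniq _ uQ) g0 gQg per.
have {}h : (size (sols Q d e k))%:R <= g%:R * \prod_(q <- Qg) (1 - (count (bad q) (iota 0 q))%:R / q%:R) :> R.
  rewrite -crt; apply: le_trans (_ : _ <= (count (fun j => all (fun q => ~~ bad q j) Qg) (iota 0 g))%:R) _.
    by rewrite ler_nat.
  by rewrite -sum1_count natr_sum.
apply: le_trans h _; rewrite -!mulrA ler_wpM2l //.
rewrite /Qg big_filter /phi_ratio /unit_inv big_mkcond.
rewrite (big_mkcond (fun q => q %| d)%N) (big_mkcond (fun q => q %| e)%N).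
rewrite (big_mkcond (fun q => q %| _ * _)%N) (big_mkcond (fun q => q %| k)%N) -!big_split /=.
rewrite big_seq [leRHS]big_seq; apply: ler_prod => q qQ.
have pq := allP pQ _ qQ; have /andP[t0 t1] := fpos q qQ.
have qR : 0 < q%:R :> R by rewrite ltr0n prime_gt0.
set t := 1 - q%:R^-1 in t0 t1 *.
have ti : 1 <= t^-1 by rewrite invf_ge1.
have tn : t != 0 by rewrite gt_eqF.
have npr : ~~ ((q %| d')%N && (q %| e')%N).
  apply/negP => qde; have : (q %| gcdn d' e')%N by rewrite dvdn_gcd.
  by rewrite (eqP cop) dvdn1 => /eqP q1; rewrite q1 in pq.
have qd : (q %| d)%N = (q %| g)%N || (q %| d')%N by rewrite {1}dE Euclid_dvdM.
have qe : (q %| e)%N = (q %| g)%N || (q %| e')%N by rewrite {1}eE Euclid_dvdM.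
have qm : (q %| d' * e')%N = (q %| d')%N || (q %| e')%N by rewrite Euclid_dvdM.
rewrite qd qe qm.
set c := count (bad q) (iota 0 q).
have cle : c%:R / q%:R <= 1 :> R.
  by rewrite ler_pdivrMr // mul1r ler_nat -[leqRHS](size_iota 0); exact: count_size.
have c1 : (1 <= c)%N.
  have [qd'|qd'] := boolP (q %| d')%N.
    have qe' : ~~ (q %| e')%N by move: npr; rewrite qd'.
    by rewrite -(count_residue r0 pq qe'); apply: sub_count => j; rewrite /bad => ->; rewrite orbT.
  by rewrite -(count_residue p0 pq qd'); apply: sub_count => j; rewrite /bad => ->.
(* Each of the two conditions forbids exactly one residue; if they coincided, the equation for p and
   r would make q divide k. *)
have c2 : ~~ (q %| d')%N -> ~~ (q %| e')%N -> ~~ (q %| k)%N -> (2 <= c)%N.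
  move=> qd' qe' qk; have := count_predUI (fun j => q %| p0 + j * d')%N (fun j => q %| r0 + j * e')%N (iota 0 q).
  rewrite (count_residue p0 pq qd') (count_residue r0 pq qe').
  rewrite (@eq_count _ (predI _ _) pred0) ?count_pred0 ?addn0.
    by move=> H; rewrite (_ : c = 2%N) //; exact: H.
  move=> j /=; apply/negbTE/negP => /andP[q1 q2]; move/negP: qk; apply.
  have e1 : ((p0 + j * d') * e' = (r0 + j * e') * d' + k)%N.
    by rewrite !mulnDl eq0 addnAC; congr (_ + _ + _)%N; rewrite mulnAC.
  by rewrite -(dvdn_addr _ (dvdn_mulr d' q2)) -e1 dvdn_mulr.
have b1 : 1 - c%:R / q%:R <= t.
  by rewrite /t lerD2l lerN2 -[leLHS]mul1r ler_pM2r ?invr_gt0 // ler1n.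
have b2 : (2 <= c)%N -> 1 - c%:R / q%:R <= t * t.
  move=> cc; apply: (@le_trans _ _ (1 - 2 / q%:R)).
    by rewrite lerD2l lerN2 ler_pM2r ?invr_gt0 // ler_nat.
  rewrite /t; have := sqr_ge0 (q%:R^-1 : R); rewrite expr2; lra.
have c0 : 0 <= (1 : R) - c%:R / q%:R by rewrite subr_ge0.
have tt : t * t * t^-1 = t by rewrite mulfK.
case: (boolP (q %| g)%N) => qg /=.
  rewrite c0 /=.
  case: (boolP (q %| d')%N) npr c2 => qd'; case: (boolP (q %| e')%N) => qe' //= _ c2;
    case: (boolP (q %| k)%N) c2 => qk c2; rewrite ?mulr1.
  - by rewrite !mulrA tt divff // (le_trans b1).
  - by rewrite mulrA tt.
  - by rewrite !mulrA tt divff // (le_trans b1).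
  - by rewrite mulrA tt.
  - by rewrite mul1r mulrA tt.
  - exact: (b2 (c2 isT isT isT)).
rewrite ler01 /=.
by case: (boolP (q %| d')%N) npr c2 => qd'; case: (boolP (q %| e')%N) => qe' //= _ _;
    case: (boolP (q %| k)%N) => qk; rewrite ?mulr1 ?mul1r ?mulrA ?divff ?mul1r // ?mulr1.
Qed.

End Solutions.

Lemma dvd_quotients_logn (q d e : nat) : prime q -> (0 < d)%N -> (0 < e)%N ->
  (q %| (d %/ gcdn d e) * (e %/ gcdn d e))%N = (logn q d != logn q e).
Proof.
move=> pq d0 e0; have g0 : (0 < gcdn d e)%N by rewrite gcdn_gt0 d0.
have d'0 : (0 < d %/ gcdn d e)%N by rewrite divn_gt0 // dvdn_leq // dvdn_gcdl.
have e'0 : (0 < e %/ gcdn d e)%N by rewrite divn_gt0 // dvdn_leq // dvdn_gcdr.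
rewrite Euclid_dvdM //; have dvdE n : (0 < n)%N -> (q %| n)%N = (logn q n != 0)%N.
  by move=> n0; rewrite -lt0n logn_gt0 mem_primes pq n0.
rewrite !dvdE // !logn_div ?dvdn_gcdl ?dvdn_gcdr // logn_gcd //.
by clear; lia.
Qed.

Section Counting.
Variables (R : realType) (Q : seq nat).
Hypotheses (pQ : all prime Q) (uQ : uniq Q).

Lemma one_sub_inv_le (q : nat) : q \in Q -> ((1 : R) - q%:R^-1)^-1 <= 1 + 2 / q%:R.
Proof.
move=> qQ; have /andP[t0 _] := one_sub_inv_bounds R pQ qQ.
have q2 : 2 <= q%:R :> R by rewrite ler_nat prime_gt1 // (allP pQ).
have qR : 0 < q%:R :> R by apply: lt_le_trans q2.
have x2 : q%:R^-1 <= 2^-1 :> R by rewrite lef_pV2 ?posrE.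
have x0 : 0 <= q%:R^-1 :> R by rewrite invr_ge0 ltW.
rewrite -[leLHS]mul1r ler_pdivrMr //; move: x2 x0 t0; move: (q%:R^-1 : R) => x; nra.
Qed.

Lemma sum_hp5_primes (s : seq nat) : uniq s -> all prime s -> \sum_(q <- s) hp R q ^+ 5 <= 4.
Proof. by move=> us ps; apply: sum_hp5 => //; apply/allP => q /(allP ps) /prime_gt1. Qed.

Variables (d e : nat).
Hypotheses (d0 : (0 < d)%N) (e0 : (0 < e)%N).
Let m := ((d %/ gcdn d e) * (e %/ gcdn d e))%N.
Let small (z : nat) := [seq q <- Q | (q %| m)%N && (q <= z)%N].
Let coprime_small z k := all (fun q => ~~ (q %| k)%N) (small z).
Let rho z : R := \prod_(q <- small z) (1 - q%:R^-1).

Let rho0 z : 0 <= rho z.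
Proof.
rewrite /rho big_seq prodr_ge0 // => q; rewrite mem_filter => /andP[_ qQ].
by have /andP[/ltW] := one_sub_inv_bounds R pQ qQ.
Qed.

Let M z := (\prod_(q <- small z) q)%N.

Let psmall z : all prime (small z).
Proof. by apply/allP => q; rewrite mem_filter => /andP[_]; exact: (allP pQ). Qed.

Let M_gt0 z : (0 < M z)%N.
Proof. by rewrite /M big_seq prodn_cond_gt0 // => q /(allP (psmall z)) /prime_gt0. Qed.

Let M_le z : (M z <= 4 ^ z)%N.
Proof.
apply: leq_trans (primorial_le z); rewrite dvdn_leq //.
  by rewrite prodn_cond_gt0 // => q /prime_gt0.
apply: prod_primes_dvd; rewrite ?filter_uniq //.
apply/allP => q qs; have pq := allP (psmall z) q qs.
move: qs; rewrite mem_filter => /andP[/andP[_ qz] _].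
have qi : q \in iota 0 z.+1 by rewrite mem_iota add0n ltnS.
by rewrite (@bigD1_seq_cond _ _ _ _ _ _ _ q) ?iota_uniq //= dvdn_mulr.
Qed.

(** X is rounded up to a multiple of [M z], over which the count is exact. The resulting error is
    multiplied by sqrt X >= 1 to fit [weighted_count]. *)
Let sieve z X : \sum_(k <- iota 1 X | coprime_small z k) 1 <=
  rho z * X%:R + rho z * (M z)%:R * Num.sqrt X%:R.
Proof.
case: X => [|X]; first by rewrite big_nil addr_ge0 ?mulr_ge0 ?sqrtr_ge0.
pose g := (M z * (X.+1 %/ M z).+1)%N.
have g0 : (0 < g)%N by rewrite muln_gt0 M_gt0.
have dg : all (fun q => q %| g)%N (small z).
  by apply/allP => q qs; rewrite /g dvdn_mulr // /M (big_rem q) //= dvdn_mulr.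
have per q j : (q %| j %% q)%N = (q %| j)%N by rewrite /dvdn modn_mod.
have := @crt_count R g (small z) (fun q j => (q %| j)%N) (psmall z) (filter_uniq _ uQ) g0 dg per.
rewrite (eq_big_seq (fun q => (1 : R) - q%:R^-1)) => [crt|q qs]; last first.
  have pq := allP (psmall z) q qs.
  have := @count_residue q 0 1 pq; rewrite dvdn1 neq_ltn prime_gt1 ?orbT // => /(_ isT) c1.
  rewrite (eq_count (a2 := fun j => q %| 0 + j * 1)%N) ?c1 ?mul1r // => j.
  by rewrite add0n muln1.
apply: (@le_trans _ _ (\sum_(j <- iota 0 g | coprime_small z j) 1)).
  rewrite big_mkcond [leRHS]big_mkcond; apply: sum_uniq_sub; rewrite ?iota_uniq //.
    move=> k; rewrite !mem_iota add1n add0n ltnS /= => /andP[_ kX].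
    by apply: leq_ltn_trans kX _; rewrite /g mulnC; exact: ltn_ceil.
  by move=> k _; case: ifP.
rewrite crt -/(rho z) mulrC -mulrA -mulrDr ler_wpM2l //.
have gX : (g <= X.+1 + M z)%N by rewrite /g mulnS addnC leq_add2r mulnC leq_trunc_div.
apply: (@le_trans _ _ (X.+1 + M z)%:R); first by rewrite ler_nat.
by rewrite natrD lerD2l ler_peMr // -[leLHS](sqrtr1 R) ler_wsqrtr // ler1n ltn0Sn.
Qed.

Lemma Lpair_sieve z : unit_inv R Q m * rho z <= expR (2 * Lpair Q z d e).
Proof.
rewrite /Lpair mulr_sumr expR_sum /unit_inv /rho /small big_filter.
rewrite big_mkcond (big_mkcond (fun q => (q %| m)%N && _)) -big_split /= [leRHS]big_mkcond.
rewrite big_seq [leRHS]big_seq; apply: ler_prod => q qQ.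
have /andP[t0 t1] := one_sub_inv_bounds R pQ qQ.
rewrite -(dvd_quotients_logn (allP pQ _ qQ) d0 e0) -/m.
case: (boolP (q %| m)%N) => qm /=; last by rewrite andbF mulr1 ler01 lexx.
rewrite andbT leqNgt; case: (boolP (z < q)%N) => zq /=; last first.
  by rewrite mulVf ?ler01 ?lexx // gt_eqF.
rewrite mulr1 invr_ge0 ltW //=; apply: le_trans (one_sub_inv_le qQ) _.
exact: expR_ge1Dx.
Qed.

(** Only k coprime to the primes up to z dividing d' e' have solutions; sieving by these primes
    removes their part of [unit_inv], and the larger ones leave [expR (2 * Lpair Q z d e)]. The
    factor [unit_inv R Q k] is averaged by [weighted_count] with weights 1 + 2/q. The condition 16^z
    <= X ensures [M z] <= 4^z <= sqrt X. *)
Lemma near_count z X : (16 ^ z <= X)%N ->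
  \sum_(k <- iota 1 X) (size (sols Q d e k))%:R <=
    2 * expR 8 * ((gcdn d e)%:R * (phi_ratio Q d * phi_ratio Q e)) *
    expR (2 * Lpair Q z d e) * X%:R :> R.
Proof.
move=> zX; set g := gcdn d e.
have fd := ltW (phi_ratio_gt0 R pQ d); have fe := ltW (phi_ratio_gt0 R pQ e).
have inv0 n : 0 <= unit_inv R Q n.
  rewrite /unit_inv big_seq_cond prodr_ge0 // => q /andP[qQ _].
  by have /andP[/ltW] := one_sub_inv_bounds R pQ qQ; rewrite invr_ge0.
pose G : R := g%:R * (phi_ratio Q d * phi_ratio Q e).
have G0 : 0 <= G by rewrite !mulr_ge0.
have eta0 (q : nat) : 0 <= 2 / q%:R :> R by rewrite divr_ge0.
apply: (@le_trans _ _ (G * unit_inv R Q m *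
   \sum_(k <- iota 1 X | coprime_small z k) \prod_(q <- Q | (q %| k)%N) (1 + 2 / q%:R))).
  rewrite mulr_sumr [leRHS]big_mkcond big_seq [leRHS]big_seq; apply: ler_sum => k.
  rewrite mem_iota => /andP[k0 _].
  have wk : unit_inv R Q k <= \prod_(q <- Q | (q %| k)%N) (1 + 2 / q%:R).
    rewrite /unit_inv big_seq_cond [leRHS]big_seq_cond; apply: ler_prod => q /andP[qQ _].
    rewrite one_sub_inv_le // andbT invr_ge0.
    by have /andP[/ltW] := one_sub_inv_bounds R pQ qQ.
  have [s0|spos] := posnP (size (sols Q d e k)).
    rewrite s0; case: ifP => // _; rewrite mulr_ge0 ?mulr_ge0 //.
    by apply: le_trans wk.
  have -> : coprime_small z k.
    apply/allP => q; rewrite mem_filter => /andP[/andP[qm _] qQ].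
    exact: (sols_coprime pQ d0 spos qQ qm).
  apply: le_trans (size_sols_bound R pQ uQ e d0 k0) _.
  by rewrite -/g -/m -(mulrA g%:R) -/G ler_wpM2l // mulr_ge0.
have down q u : q \in Q -> coprime_small z (q * u) -> coprime_small z u.
  by move=> _ /allP H; apply/allP => r /H; apply: contra => ru; rewrite dvdn_mull.
have W := @weighted_count R Q (fun q => 2 / q%:R) (coprime_small z) (rho z) (rho z * (M z)%:R)
  pQ uQ eta0 (rho0 z) (mulr_ge0 (rho0 z) (ler0n _ _)) down (sieve z) X.
have h01 (q : nat) : q \in Q -> 0 <= hp R q <= 1.
  move=> qQ; rewrite root4_ge0 /=; apply: ler_pow4 => //.
  by rewrite hp4 expr1n invf_le1 ?ler1n ?ltr0n prime_gt0 // (allP pQ).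
have e8 : 2 * 4 = 8 :> R by ring.
have P1 : \prod_(q <- Q) (1 + 2 / q%:R / q%:R) <= expR 8 :> R.
  apply: le_trans (prod_1D_le_expR Q (f := fun q => 2 / q%:R / q%:R) _) _.
    by move=> q; rewrite !divr_ge0.
  rewrite ler_expR -e8; apply: (@le_trans _ _ (2 * \sum_(q <- Q) hp R q ^+ 5)); last first.
    by rewrite ler_wpM2l // sum_hp5_primes.
  rewrite mulr_sumr big_seq [leRHS]big_seq; apply: ler_sum => q qQ.
  have /andP[hq0 hq1] := h01 q qQ.
  rewrite -mulrA ler_wpM2l // -hp4 -exprD (exprD _ 5 3) ler_piMr ?exprn_ge0 ?exprn_ile1 //.
have P2 : \prod_(q <- Q) (1 + 2 / q%:R / Num.sqrt q%:R) <= expR 8 :> R.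
  apply: le_trans (prod_1D_le_expR Q (f := fun q => 2 / q%:R / Num.sqrt q%:R) _) _.
    by move=> q; rewrite !divr_ge0 ?sqrtr_ge0.
  rewrite ler_expR -e8; apply: (@le_trans _ _ (2 * \sum_(q <- Q) hp R q ^+ 5)); last first.
    by rewrite ler_wpM2l // sum_hp5_primes.
  rewrite mulr_sumr big_seq [leRHS]big_seq; apply: ler_sum => q qQ.
  have /andP[hq0 hq1] := h01 q qQ.
  have -> : (Num.sqrt q%:R)^-1 = hp R q ^+ 2 :> R.
    by rewrite /hp /root4 sqr_sqrtr ?sqrtr_ge0 // sqrtrV // ler0n.
  rewrite -mulrA ler_wpM2l // -hp4 -exprD (exprD _ 5 1) ler_piMr ?exprn_ge0 //.
have MX : (M z)%:R * Num.sqrt X%:R <= X%:R :> R.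
  have : (M z)%:R <= Num.sqrt X%:R :> R.
    rewrite -(ger0_norm (ler0n R (M z))) -sqrtr_sqr ler_wsqrtr // -natrX ler_nat.
    apply: leq_trans zX; rewrite (_ : 16 = 4 ^ 2)%N // -expnM mulnC expnM leq_exp2r //.
  move=> H; rewrite -{2}(sqr_sqrtr (ler0n R X)) expr2 ler_wpM2r ?sqrtr_ge0 //.
apply: le_trans (ler_wpM2l (mulr_ge0 G0 (inv0 m)) W) _.
have bnd : rho z * X%:R * \prod_(q <- Q) (1 + 2 / q%:R / q%:R) +
   rho z * (M z)%:R * Num.sqrt X%:R * \prod_(q <- Q) (1 + 2 / q%:R / Num.sqrt q%:R) <=
   rho z * (2 * expR 8 * X%:R).
  rewrite -!mulrA -mulrDr ler_wpM2l //.
  have a1 : X%:R * \prod_(q <- Q) (1 + 2 / q%:R / q%:R) <= X%:R * expR 8 :> R by rewrite ler_wpM2l.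
  have a2 : (M z)%:R * Num.sqrt X%:R * \prod_(q <- Q) (1 + 2 / q%:R / Num.sqrt q%:R) <= X%:R * expR 8 :> R.
    apply: ler_pM => //.
    by apply: prodr_ge0 => q _; rewrite addr_ge0 // divr_ge0 ?sqrtr_ge0.
  move: a1 a2; rewrite -!mulrA; move: (X%:R * _) (_ * (_ * _)) => A B; lra.
apply: le_trans (ler_wpM2l (mulr_ge0 G0 (inv0 m)) bnd) _.
rewrite -/G (_ : G * unit_inv R Q m * (rho z * (2 * expR 8 * X%:R)) =
   (2 * expR 8 * G) * (unit_inv R Q m * rho z) * X%:R); last by ring.
by rewrite ler_wpM2r // ler_wpM2l ?Lpair_sieve // !mulr_ge0 ?expR_ge0.
Qed.

End Counting.

Lemma LpairC (R : realType) Q z v w : Lpair Q z v w = Lpair Q z w v :> R.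
Proof. by apply: eq_bigl => q; rewrite eq_sym. Qed.

(** Raising the level to at least 3 discards at most the primes 2 and 3 in addition, and 1/2 + 1/3 <
    1. *)
Lemma Lpair_level (R : realType) Q z v w : all prime Q -> uniq Q ->
  Lpair Q z v w <= Lpair Q (maxn 3 z) v w + 1 :> R.
Proof.
move=> pQ uQ.
have small : \sum_(q <- [seq q <- Q | (q <= 3)%N]) q%:R^-1 <= 1 :> R.
  apply: (@le_trans _ _ (\sum_(q <- [:: 2; 3]%N) q%:R^-1 : R)); last by rewrite !big_cons big_nil; lra.
  apply: sum_uniq_sub; rewrite ?filter_uniq // => q.
  rewrite mem_filter => /andP[q3 /(allP pQ)].
  by move: q q3 => [|[|[|[|]]]].
apply: (@le_trans _ _ (Lpair Q (maxn 3 z) v w + \sum_(q <- Q | (q <= 3)%N) q%:R^-1 : R)); last first.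
  by rewrite lerD2l -big_filter.
rewrite /Lpair !(big_mkcond (fun q => _ && _)) (big_mkcond (fun q => q <= 3)%N) -big_split /=.
apply: ler_sum => q _; have i0 : 0 <= q%:R^-1 :> R by rewrite invr_ge0.
rewrite gtn_max (ltnNge 3); case: (q <= 3)%N; case: (z < q)%N; case: (_ != _) => /=; lra.
Qed.

Lemma geometric_sum_le (R : realType) (x : R) n k : 0 <= x -> x < 1 ->
  \sum_(i <- iota n k) x ^+ i <= (1 - x)^-1.
Proof.
move=> x0 x1; have d0 : 0 < 1 - x by rewrite subr_gt0.
rewrite -[leRHS]mul1r ler_pdivlMr // mulrC.
suff -> : (1 - x) * (\sum_(i <- iota n k) x ^+ i) = x ^+ n - x ^+ (n + k).
  have h1 : x ^+ n <= 1 by apply: exprn_ile1 => //; exact: ltW.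
  have h2 : 0 <= x ^+ (n + k) by apply: exprn_ge0.
  lra.
elim: k n => [|k IH] n; first by rewrite big_nil addn0 mulr0 subrr.
by rewrite big_cons mulrDr IH addnS exprS addSn; ring.
Qed.

(** * Overlap of the arcs of two denominators *)

Section PairOverlap.
Variables (R : realType) (Q : seq nat) (Y : nat) (psi : nat -> R).
Hypotheses (pQ : all prime Q) (uQ : uniq Q) (Y0 : (0 < Y)%N).
Hypothesis (bigQ : forall p, prime p -> p \notin Q -> (Y < p)%N).
Hypotheses (psi0 : forall v, 0 <= psi v) (psi1 : forall v, psi v <= 1).

(** Two arcs meet only if their numerators satisfy |p e' - r d'| <= [reach d e], where d', e' are
    the quotients of d, e by their gcd. *)
Definition reach (d e : nat) : R :=
  Num.max (psi d * (e %/ gcdn d e)%:R) (psi e * (d %/ gcdn d e)%:R).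
Definition steps (d e : nat) : nat := Num.trunc (reach d e).
(** The largest z for which [near_count] applies to [steps d e], raised to at least 3 so that the
    series in [pair_sum] converges. *)
Definition level (d e : nat) : nat := maxn 3 (trunc_log 16 (steps d e)).
Definition over_count (d e : nat) : nat :=
  (size (sols Q d e 0) + (\sum_(k <- iota 1 (steps d e)) size (sols Q d e k) +
   \sum_(k <- iota 1 (steps d e)) size (sols Q e d k)))%N.

Lemma reach_ge0 d e : 0 <= reach d e.
Proof. by rewrite le_max mulr_ge0. Qed.

(** Coinciding left endpoints mean k = 0, which is coprime to no prime; hence d' e' has no prime
    factor up to [Y]. As d and e differ, one of d', e' exceeds [Y], and there are at most gcd(d, e)
    coincidences. *)
Lemma exact_overlap d e : (0 < d)%N -> (0 < e)%N -> d != e ->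
  Num.min (psi d / d%:R) (psi e / e%:R) * (size (sols Q d e 0))%:R <= Y%:R^-1.
Proof.
move=> d0 e0 de; set g := gcdn d e.
have g0 : (0 < g)%N by rewrite gcdn_gt0 d0.
have mn0 : 0 <= Num.min (psi d / d%:R) (psi e / e%:R) by rewrite le_min !divr_ge0.
have [->|spos] := posnP (size (sols Q d e 0)); first by rewrite mulr0 invr_ge0.
have free q : prime q -> (q %| (d %/ g) * (e %/ g))%N -> (Y < q)%N.
  move=> pq qm; apply: bigQ => //; apply/negP => qQ.
  by have := sols_coprime pQ d0 spos qQ qm; rewrite dvdn0.
have sg := size_sols_le Q e d0 0.
apply: (le_trans (ler_wpM2l mn0 (_ : _ <= g%:R))); first by rewrite ler_nat.
have key (x : nat) : (0 < x)%N -> (g %| x)%N -> (Y < x %/ g)%N ->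
    Num.min (psi d / d%:R) (psi e / e%:R) <= psi x / x%:R ->
    Num.min (psi d / d%:R) (psi e / e%:R) * g%:R <= Y%:R^-1.
  move=> x0 gx Yx mx; apply: (le_trans (ler_wpM2r _ mx)) => //.
  have gR : 0 < g%:R :> R by rewrite ltr0n.
  have xE : x%:R = (x %/ g)%:R * g%:R :> R by rewrite -natrM divnK.
  rewrite xE invfM mulrA mulfVK ?gt_eqF //.
  apply: (@le_trans _ _ (1 * (x %/ g)%:R^-1)); first by rewrite ler_wpM2r // invr_ge0.
  by rewrite mul1r lef_pV2 ?posrE ?ltr0n // ?ler_nat ?(ltnW Yx) // (leq_ltn_trans _ Yx).
have big x : (0 < x)%N -> x != 1%N -> (x %| (d %/ g) * (e %/ g))%N -> (Y < x)%N.
  move=> x0 x1 xm; have p2 : (1 < x)%N by rewrite ltn_neqAle eq_sym x1.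
  apply: leq_trans (free (pdiv x) (pdiv_prime p2) _) (pdiv_leq x0).
  exact: dvdn_trans (pdiv_dvd x) xm.
have dg0 : (0 < d %/ g)%N by rewrite divn_gt0 // dvdn_leq // dvdn_gcdl.
have eg0 : (0 < e %/ g)%N by rewrite divn_gt0 // dvdn_leq // dvdn_gcdr.
have [d1|d1] := eqVneq (d %/ g)%N 1%N; last first.
  by apply: (key d) => //; rewrite ?dvdn_gcdl ?big ?dvdn_mulr ?ge_min ?lexx.
have [e1|e1] := eqVneq (e %/ g)%N 1%N; last first.
  by apply: (key e) => //; rewrite ?dvdn_gcdr ?big ?dvdn_mull ?ge_min ?lexx ?orbT.
case/eqP: de; have := divnK (dvdn_gcdr d e); have := divnK (dvdn_gcdl d e).
by rewrite -/g d1 e1 !mul1n => gd ge; exact: etrans (esym gd) ge.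
Qed.

Lemma steps_le d e : (0 < d)%N -> (0 < e)%N ->
  Num.min (psi d / d%:R) (psi e / e%:R) * ((gcdn d e)%:R * (steps d e)%:R) <= psi d * psi e.
Proof.
move=> d0 e0; set g := gcdn d e; set mn := Num.min _ _.
have mn0 : 0 <= mn by rewrite le_min !divr_ge0.
have g0 : 0 < g%:R :> R by rewrite ltr0n gcdn_gt0 d0.
have /andP[X1 _] := truncn_itv (reach_ge0 d e).
have dE : d%:R = (d %/ g)%:R * g%:R :> R by rewrite -natrM divnK // dvdn_gcdl.
have eE : e%:R = (e %/ g)%:R * g%:R :> R by rewrite -natrM divnK // dvdn_gcdr.
apply: (@le_trans _ _ (mn * (g%:R * reach d e))).
  by apply: ler_wpM2l => //; apply: ler_wpM2l => //; exact: ltW.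
have [->|->] : reach d e = psi e * (d %/ g)%:R \/ reach d e = psi d * (e %/ g)%:R.
    by rewrite /reach /Num.max -/g; case: ifP => _; [left | right].
  apply: (@le_trans _ _ (psi d / d%:R * (g%:R * (psi e * (d %/ g)%:R)))).
    by rewrite ler_wpM2r ?mulr_ge0 ?(ltW g0) // ge_min lexx.
  rewrite (_ : g%:R * (psi e * (d %/ g)%:R) = psi e * d%:R); last by rewrite dE; ring.
  by rewrite mulrCA mulfVK ?pnatr_eq0 -?lt0n // mulrC.
apply: (@le_trans _ _ (psi e / e%:R * (g%:R * (psi d * (e %/ g)%:R)))).
  by rewrite ler_wpM2r ?mulr_ge0 ?(ltW g0) // ge_min lexx orbT.
rewrite (_ : g%:R * (psi d * (e %/ g)%:R) = psi d * e%:R); last by rewrite eE; ring.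
by rewrite mulrCA mulfVK ?pnatr_eq0 -?lt0n.
Qed.

Definition pair_weight (d e : nat) : R :=
  if (0 < steps d e)%N then expR (2 * Lpair Q (level d e) d e) else 0.

Lemma pair_overlap d e : (0 < d)%N -> (0 < e)%N -> d != e ->
  Num.min (psi d / d%:R) (psi e / e%:R) * (over_count d e)%:R <=
   Y%:R^-1 + 4 * expR 10 * (mu Q psi d * mu Q psi e * pair_weight d e).
Proof.
move=> d0 e0 de; rewrite /over_count natrD mulrDr; apply: lerD; first exact: exact_overlap.
rewrite /pair_weight; case: posnP => [->|X0]; first by rewrite !big_nil !mulr0.
set X := steps d e in X0 *; set mn := Num.min _ _.
have mn0 : 0 <= mn by rewrite le_min !divr_ge0.
set z := trunc_log 16 X.
have zX : (16 ^ z <= X)%N by apply: trunc_logP.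
have N1 := near_count R pQ uQ d0 e0 zX.
have N2 := near_count R pQ uQ e0 d0 zX.
rewrite natrD !natr_sum.
have fd := ltW (phi_ratio_gt0 R pQ d); have fe := ltW (phi_ratio_gt0 R pQ e).
have {}N : \sum_(k <- iota 1 X) (size (sols Q d e k))%:R + \sum_(k <- iota 1 X) (size (sols Q e d k))%:R <=
   (gcdn d e)%:R * X%:R * (4 * expR 8 * (phi_ratio Q d * phi_ratio Q e) * expR (2 * Lpair Q z d e)) :> R.
  apply: (le_trans (lerD N1 N2)); rewrite (gcdnC e d) (LpairC R Q z e d).
  by rewrite le_eqVlt; apply/orP; left; apply/eqP; ring.
apply: (le_trans (ler_wpM2l mn0 N)); rewrite (mulrA mn).
apply: (le_trans (ler_wpM2r _ (steps_le d0 e0))).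
  by rewrite !mulr_ge0 ?expR_ge0.
have L : expR (2 * Lpair Q z d e) <= expR 2 * expR (2 * Lpair Q (level d e) d e) :> R.
  rewrite -expRD ler_expR; have := Lpair_level R z d e pQ uQ; rewrite -/(level d e); lra.
have pp : 0 <= psi d * psi e * (4 * expR 8 * (phi_ratio Q d * phi_ratio Q e)).
  by rewrite !mulr_ge0 ?expR_ge0.
rewrite (mulrA (psi d * psi e)); apply: (le_trans (ler_wpM2l pp L)).
have -> : expR 10 = expR 8 * expR 2 :> R by rewrite -expRD; congr expR; ring.
rewrite le_eqVlt; apply/orP; left; apply/eqP; rewrite /mu.
move: (expR (2 * Lpair Q (level d e) d e)) => E; ring.
Qed.

End PairOverlap.

Section PairSum.
Variables (R : realType) (Q : seq nat) (psi : nat -> R) (S : seq nat) (C rho : R).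
Hypotheses (pQ : all prime Q) (uQ : uniq Q) (uS : uniq S) (posS : all (fun v => (0 < v)%N) S).
Hypotheses (psi0 : forall v, 0 <= psi v) (psi1 : forall v, psi v <= 1) (C0 : 0 <= C).
Let M := massS Q S psi xpredT.
Hypothesis overlap : forall (z : nat) (m T : R), (0 < z)%N -> 0 <= T ->
  totS Q S psi xpredT xpredT (close_pair Q z m T psi) <=
      C * Num.sqrt T * expR (- (z%:R * m)) * root4 M ^+ 6.

Let close (z k : nat) := close_pair Q z k%:R (16 ^+ z.+1) psi.

Let Lpair_le z v w : Lpair Q z v w <= \sum_(q <- Q) q%:R^-1 :> R.
Proof.
by rewrite /Lpair big_mkcond; apply: ler_sum => q _; case: ifP => // _.
Qed.

(** Either [Lpair] at the level of the pair is at most 2, or its integer part k >= 2 exhibits the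
    pair as close at (level, k). The threshold 16^(z+1) bounds [reach] by the maximality of the
    level. *)
Let pointwise v w (Z K : nat) : (0 < v)%N -> (0 < w)%N -> (level psi v w < 3 + Z)%N ->
  \sum_(q <- Q) q%:R^-1 < (2 + K)%:R :> R ->
  pair_weight Q psi v w <= expR 4 +
    \sum_(x <- [seq (z, k) | z <- iota 3 Z, k <- iota 2 K]) expR (2 * (x.2%:R + 1)) * (close x.1 x.2 v w)%:R.
Proof.
move=> v0 w0 lZ LK; have s0 : 0 <= \sum_(x <- [seq (z, k) | z <- iota 3 Z, k <- iota 2 K])
    expR (2 * (x.2%:R + 1)) * (close x.1 x.2 v w)%:R :> R.
  by apply: sumr_ge0 => x _; rewrite mulr_ge0 ?expR_ge0.
rewrite /pair_weight; case: ifP => [X0|_]; last by rewrite addr_ge0 ?expR_ge0.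
set z := level psi v w in lZ *; set L : R := Lpair Q z v w.
have L0 : 0 <= L by apply: sumr_ge0 => q _; rewrite invr_ge0.
have [L2|L2] := leP L 2.
  by apply: ler_wpDr => //; rewrite ler_expR; lra.
apply: ler_wpDl; first exact: expR_ge0.
have /andP[k1 k2] := truncn_itv L0; set k := Num.trunc L in k1 k2.
have kk : (2 <= k)%N by rewrite truncn_ge_nat //; exact: ltW.
have kK : (k < 2 + K)%N.
  by rewrite -(ltr_nat R); apply: le_lt_trans k1 _; apply: le_lt_trans (Lpair_le z v w) LK.
have xin : (z, k) \in [seq (z, k) | z <- iota 3 Z, k <- iota 2 K].
  by apply/allpairsP; exists (z, k); rewrite !mem_iota kk kK lZ /= /z /level leq_maxl.
rewrite (bigD1_seq (z, k)) ?allpairs_uniq ?iota_uniq //=; last by move=> [? ?] [? ?].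
apply: ler_wpDr; first by apply: sumr_ge0 => x _; rewrite mulr_ge0 ?expR_ge0.
have -> : close z k v w.
  set g := gcdn v w; have g0 : (0 < g)%N by rewrite gcdn_gt0 v0.
  have gR : 0 < g%:R :> R by rewrite ltr0n.
  have vE : v%:R = (v %/ g)%:R * g%:R :> R by rewrite -natrM divnK // dvdn_gcdl.
  have wE : w%:R = (w %/ g)%:R * g%:R :> R by rewrite -natrM divnK // dvdn_gcdr.
  have XT : reach psi v w <= 16 ^+ z.+1.
    have /andP[_ /ltW h] := truncn_itv (reach_ge0 psi0 v w); apply: (le_trans h).
    rewrite -natrX ler_nat; apply: (@leq_trans (16 ^ (trunc_log 16 (steps psi v w)).+1)).
      exact: trunc_log_ltn.
    by rewrite leq_exp2l // ltnS leq_maxr.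
  move: XT; rewrite ge_max => /andP[XT1 XT2].
  by rewrite /close /close_pair -/g vE wE -/L k1 andbT !(mulrAC _ g%:R) !ler_pM2r // !(mulrC _%:R) XT1 XT2.
rewrite mulr1 ler_expR /=; move: k2; rewrite -natr1; lra.
Qed.

(** Summing over levels z and integer parts k, the weight e^(2k+2) and the square root 4^(z+1) of
    the threshold are beaten by the saving e^(-zk) of the overlap estimate, since z >= 3 and k >=
    2. *)
Lemma pair_sum : \sum_(v <- S) \sum_(w <- S) mu Q psi v * mu Q psi w * pair_weight Q psi v w <=
  expR 4 * M ^+ 2 + 100 * C * expR 8 * root4 M ^+ 6.
Proof.
have mu0 v : 0 <= mu Q psi v by apply: mu_ge0.
pose B := (\sum_(v <- S) v)%N.
pose Z := B.+3; pose K := (Num.trunc (\sum_(q <- Q) q%:R^-1 : R)).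
have inB v : v \in S -> (v <= B)%N by move=> vS; rewrite /B (big_rem v) //= leq_addr.
have lvl v w : v \in S -> w \in S -> (level psi v w < 3 + Z)%N.
  move=> vS wS; rewrite /level gtn_max /Z /=.
  have hX : (steps psi v w <= B)%N.
    have /andP[h _] := truncn_itv (reach_ge0 psi0 v w); rewrite -/(steps psi v w) in h.
    rewrite -(ler_nat R); apply: (le_trans h); rewrite ge_max; apply/andP; split.
      apply: (@le_trans _ _ (1 * w%:R)); last by rewrite mul1r ler_nat inB.
      by apply: ler_pM => //; rewrite ler_nat leq_div.
    apply: (@le_trans _ _ (1 * v%:R)); last by rewrite mul1r ler_nat inB.
    by apply: ler_pM => //; rewrite ler_nat leq_div.
  have tl : (trunc_log 16 (steps psi v w) <= steps psi v w)%N.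
    have [->|X0] := posnP (steps psi v w); first by rewrite trunc_log0.
    by apply: leq_trans (trunc_logP (isT : (1 < 16)%N) X0); exact/ltnW/ltn_expl.
  by move: (leq_trans tl hX) => h; lia.
pose P := [seq (z, k) | z <- iota 3 Z, k <- iota 2 K].
have step1 : \sum_(v <- S) \sum_(w <- S) mu Q psi v * mu Q psi w * pair_weight Q psi v w <=
   \sum_(v <- S) \sum_(w <- S) (expR 4 * (mu Q psi v * mu Q psi w) +
     \sum_(x <- P) expR (2 * (x.2%:R + 1)) * (mu Q psi v * mu Q psi w * (close x.1 x.2 v w)%:R)).
  rewrite big_seq [leRHS]big_seq; apply: ler_sum => v vS.
  rewrite big_seq [leRHS]big_seq; apply: ler_sum => w wS.
  apply: (le_trans (ler_wpM2l (mulr_ge0 (mu0 v) (mu0 w)) (pointwise (allP posS _ vS) (allP posS _ wS) (lvl _ _ vS wS) (_ : _ < (2 + K)%:R)))).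
    have s0 : 0 <= \sum_(q <- Q) q%:R^-1 :> R by apply: sumr_ge0 => q _; rewrite invr_ge0.
    by have /andP[_ h] := truncn_itv s0; apply: (lt_le_trans h); rewrite ler_nat -/K addSn ltnS leq_addl.
  rewrite mulrDr mulr_sumr le_eqVlt; apply/orP; left; apply/eqP; congr (_ + _); first by rewrite mulrC.
  by apply: eq_bigr => x _; rewrite mulrCA.
apply: (le_trans step1).
have -> : \sum_(v <- S) \sum_(w <- S) (expR 4 * (mu Q psi v * mu Q psi w) +
     \sum_(x <- P) expR (2 * (x.2%:R + 1)) * (mu Q psi v * mu Q psi w * (close x.1 x.2 v w)%:R)) =
   expR 4 * M ^+ 2 + \sum_(x <- P) expR (2 * (x.2%:R + 1)) * totS Q S psi xpredT xpredT (close x.1 x.2).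
  under eq_bigr do rewrite big_split /=.
  rewrite big_split /=; congr (_ + _).
    rewrite /M /massS expr2 mulr_suml mulr_sumr; apply: eq_bigr => v _.
    by rewrite mulr_sumr mulr_sumr; apply: eq_bigr => w _.
  under eq_bigr do rewrite exchange_big /=.
  rewrite exchange_big /=; apply: eq_bigr => x _; rewrite /totS mulr_sumr; apply: eq_bigr => v _.
  rewrite mulr_sumr [RHS]big_mkcond /=; apply: eq_bigr => w _.
  by case: (close _ _ _ _); rewrite ?mulr1 ?mulr0.
rewrite lerD2l.
have M0 : 0 <= root4 M ^+ 6 by rewrite exprn_ge0 ?root4_ge0.
have e1 := expR1_ge R; have e10 := expR_gt0 (1 : R).
pose i := (expR 1)^-1 : R.
have i0 : 0 < i by rewrite invr_gt0.
have i1 : i <= 5 / 12.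
  by rewrite -[leRHS]invrK lef_pV2 ?posrE ?invf_div //; lra.
have termle (x : nat * nat) : x \in P ->
    expR (2 * (x.2%:R + 1)) * totS Q S psi xpredT xpredT (close x.1 x.2) <=
    4 * C * expR 8 * root4 M ^+ 6 * ((25 / 36) ^+ x.1 * (5 / 12) ^+ x.2).
  case/allpairsP => [[z k] [zi ki ->]].
  have z3 : (3 <= z)%N by move: zi; rewrite [_ \in _]mem_iota => /andP[].
  have k2 : (2 <= k)%N by move: ki; rewrite [_ \in _]mem_iota => /andP[].
  rewrite [_.1]/= [_.2]/=.
  have T0 : 0 <= 16 ^+ z.+1 :> R by rewrite exprn_ge0.
  have O := overlap k%:R (leq_trans (isT : 0 < 3)%N z3) T0.
  apply: (le_trans (ler_wpM2l (expR_ge0 _) O)).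
  have -> : Num.sqrt (16 ^+ z.+1) = 4 * 4 ^+ z :> R.
    rewrite -exprS (_ : (16 : R) = 4 ^+ 2); last by ring.
    by rewrite -exprM mulnC exprM sqrtr_sqr ger0_norm // exprn_ge0.
  rewrite (_ : expR (2 * (k%:R + 1)) * (C * (4 * 4 ^+ z) * expR (- (z%:R * k%:R)) * root4 M ^+ 6) =
    4 * C * root4 M ^+ 6 * (4 ^+ z * (expR (2 * (k%:R + 1)) * expR (- (z%:R * k%:R))))); last by ring.
  rewrite (_ : 4 * C * expR 8 * root4 M ^+ 6 * ((25 / 36) ^+ z * (5 / 12) ^+ k) =
    4 * C * root4 M ^+ 6 * (expR 8 * ((25 / 36) ^+ z * (5 / 12) ^+ k))); last by ring.
  apply: ler_wpM2l; first by rewrite mulr_ge0 // mulr_ge0.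
  (* The comparison of exponents, 2k + 2 - zk <= 8 - 2z - k, is the inequality (z - 3)(k - 2) >= 0;
     then 4 e^(-2) <= 25/36 and e^(-1) <= 5/12 give two convergent geometric series. *)
  apply: (@le_trans _ _ (4 ^+ z * (expR 8 * (i ^+ 2) ^+ z * i ^+ k))).
    rewrite ler_wpM2l ?exprn_ge0 // -exprM /i !exprVn -!expRM_natl mulr1 -!expRN -!expRD ler_expR.
    have zR : 3 <= z%:R :> R by rewrite ler_nat.
    have kR : 2 <= k%:R :> R by rewrite ler_nat.
    rewrite mulnC natrM mulr1; nra.
  rewrite (_ : 4 ^+ z * (expR 8 * (i ^+ 2) ^+ z * i ^+ k) = expR 8 * ((4 * i ^+ 2) ^+ z * i ^+ k)); last first.
    by rewrite [(4 * _) ^+ z]exprMn; ring.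
  apply: ler_wpM2l; first exact: expR_ge0.
  apply: ler_pM; rewrite ?exprn_ge0 ?mulr_ge0 ?exprn_ge0 ?(ltW i0) //.
    by rewrite lerXn2r ?nnegrE ?mulr_ge0 ?exprn_ge0 ?(ltW i0) //; nra.
  by rewrite lerXn2r ?nnegrE ?(ltW i0) //; lra.
rewrite big_seq; apply: (le_trans (ler_sum _ termle)); rewrite -big_seq -mulr_sumr.
have -> : \sum_(x <- P) (25 / 36) ^+ x.1 * (5 / 12) ^+ x.2 =
   (\sum_(z <- iota 3 Z) (25 / 36) ^+ z) * (\sum_(k <- iota 2 K) (5 / 12) ^+ k) :> R.
  by rewrite /P big_allpairs mulr_suml; apply: eq_bigr => z _; rewrite mulr_sumr.
have g1 : \sum_(z <- iota 3 Z) (25 / 36) ^+ z <= (1 - 25 / 36)^-1 :> R by apply: geometric_sum_le; lra.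
have g2 : \sum_(k <- iota 2 K) (5 / 12) ^+ k <= (1 - 5 / 12)^-1 :> R by apply: geometric_sum_le; lra.
have g : (\sum_(z <- iota 3 Z) (25 / 36) ^+ z) * (\sum_(k <- iota 2 K) (5 / 12) ^+ k) <= 25 :> R.
  apply: (@le_trans _ _ ((1 - 25 / 36)^-1 * (1 - 5 / 12)^-1)).
    have ge0 (x : R) s : 0 <= x -> 0 <= \sum_(j <- s) x ^+ j.
      by move=> x0; apply: sumr_ge0 => j _; apply: exprn_ge0.
    by apply: ler_pM; [apply: ge0; lra | apply: ge0; lra | exact: g1 | exact: g2].
  rewrite -invfM (_ : (1 - 25 / 36) * (1 - 5 / 12) = (432 / 77)^-1 :> R) ?invrK; first lra.
  by rewrite invf_div; field.
apply: (le_trans (ler_wpM2l _ g)).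
  by apply: mulr_ge0 => //; rewrite !mulr_ge0 ?expR_ge0.
by rewrite le_eqVlt; apply/orP; left; apply/eqP; ring.
Qed.

End PairSum.

(** * Bonferroni inequality and the block theorem *)

Section Bonferroni.
Context d (T : measurableType d) (R : realType) (mu : {measure set T -> \bar R}).
Context (I : eqType) (F : I -> set T).
Hypothesis mF : forall i, measurable (F i).
Local Open Scope ereal_scope.

Lemma measurable_bigU (s : seq I) : measurable (\big[setU/set0]_(i <- s) F i).
Proof. by apply: bigsetU_measurable. Qed.

Lemma measure_setI_bigU (A : set T) (s : seq I) : measurable A ->
  mu (A `&` \big[setU/set0]_(i <- s) F i) <= \sum_(i <- s) mu (A `&` F i).
Proof.
move=> mA; elim: s => [|i s IH]; first by rewrite !big_nil setI0 measure0.
rewrite !big_cons setIUr; apply: le_trans (leeD2l _ IH).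
by apply: measureU2; apply: measurableI => //; exact: measurable_bigU.
Qed.

Hypothesis fF : forall i, mu (F i) < +oo.

Lemma bonferroni (s : seq I) : uniq s ->
  \sum_(i <- s) mu (F i) <= mu (\big[setU/set0]_(i <- s) F i) +
    \sum_(i <- s) \sum_(j <- s | j != i) mu (F i `&` F j).
Proof.
elim: s => [|i s IH]; first by move=> _; rewrite !big_nil adde0 measure0.
move=> /= /andP[iNs us]; rewrite !big_cons eqxx /=; have mU := measurable_bigU s.
apply: (le_trans (leeD2l _ (IH us))).
set U := \big[setU/set0]_(j <- s) F j in mU IH *; rewrite addeA.
have fi : mu (F i) \is a fin_num by rewrite ge0_fin_numE.
have fI : mu (F i `&` U) \is a fin_num.
  by rewrite ge0_fin_numE //; apply: le_lt_trans (fF i); apply: le_measure; rewrite ?inE //; exact: measurableI.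
have -> : mu (F i) + mu U = mu (F i `|` U) + mu (F i `&` U).
  by rewrite measureUfinl // subeK.
rewrite -addeA leeD2l //; apply: leeD.
  apply: (le_trans (measure_setI_bigU s (mF i))); rewrite [leRHS]big_mkcond /= big_seq [leRHS]big_seq.
  by apply: lee_sum => j js; case: eqP js => // -> js; rewrite js in iNs.
apply: lee_sum => k _; rewrite big_cons; case: ifP => // _.
by rewrite leeDr.
Qed.
End Bonferroni.

Lemma size_sols_sum (Q : seq nat) d e k : size (sols Q d e k) =
  (\sum_(p <- numer Q d) \sum_(r <- numer Q e)
    (p * (e %/ gcdn d e) == r * (d %/ gcdn d e) + k))%N.
Proof.
rewrite /sols size_filter -sum1_count big_mkcond /= big_allpairs /=.
by apply: eq_bigr => p _; apply: eq_bigr => r _; case: eqP.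
Qed.

Section Block.
Variable R : realType.
Local Notation mu_ := (@lebesgue_measure R).

(** One-sided, so that for numerators below d and [psi d <= 1/2] the arcs stay in [0, 1]. *)
Definition arc (psi : nat -> R) (d p : nat) : set R := `[p%:R / d%:R, (p%:R + psi d) / d%:R].
Definition arcs (Q : seq nat) (psi : nat -> R) (d : nat) : set R :=
  \big[setU/set0]_(p <- numer Q d) arc psi d p.

Section Arcs.
Variables (Q : seq nat) (psi : nat -> R).
Hypotheses (pQ : all prime Q) (uQ : uniq Q).
Hypotheses (psi0 : forall v, 0 <= psi v) (psi1 : forall v, psi v <= 2^-1).

Lemma arc_measurable d p : measurable (arc psi d p).
Proof. exact: measurable_itv. Qed.

Lemma arcs_measurable d : measurable (arcs Q psi d).
Proof. by apply: bigsetU_measurable => p _; exact: arc_measurable. Qed.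

Lemma arc_measure d p : (0 < d)%N -> mu_ (arc psi d p) = (psi d / d%:R)%:E.
Proof.
move=> d0; have dR : 0 < d%:R :> R by rewrite ltr0n.
rewrite lebesgue_measure_itv /= lte_fin; case: ifPn => [_|].
  by rewrite -EFinB -mulrBl addrC addKr.
rewrite -leNgt ler_pM2r ?invr_gt0 // gerDl => h.
have -> : psi d = 0 by apply: le_anti; rewrite h psi0.
by rewrite mul0r.
Qed.

Lemma arc_disjoint d p q : (0 < d)%N -> p != q -> arc psi d p `&` arc psi d q = set0.
Proof.
move=> d0; have dR : 0 < d%:R :> R by rewrite ltr0n.
wlog pq : p q / (p < q)%N.
  move=> H; rewrite neq_ltn => /orP[h|h]; first by apply: H => //; rewrite neq_ltn h.
  by rewrite setIC; apply: H => //; rewrite neq_ltn h.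
move=> _; apply/seteqP; split => // x []; rewrite /arc /= !in_itv /= => /andP[_ x1] /andP[x2 _].
have := le_trans x2 x1; rewrite ler_pM2r ?invr_gt0 //.
have : p.+1%:R <= q%:R :> R by rewrite ler_nat.
rewrite -natr1; have := psi1 d; lra.
Qed.

Lemma arcs_measure_ge d : (0 < d)%N -> ((mu Q psi d)%:E <= mu_ (arcs Q psi d))%E.
Proof.
move=> d0; have mE := arc_measure; have un : uniq (numer Q d) by rewrite filter_uniq ?iota_uniq.
have := @bonferroni _ _ R mu_ _ (arc psi d) (arc_measurable d) (fun p => _) _ un.
move=> /(_ (fun p => _)) B.
have {}B := B (fun p => eq_ind_r (fun x => (x < +oo)%E) (ltry _) (mE d p d0)).
move: B; rewrite [X in (_ <= _ + X)%E]big1 ?adde0 => [B|p _]; last first.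
  by apply: big1 => q pq; rewrite arc_disjoint ?measure0 // eq_sym.
apply: le_trans B; rewrite (eq_bigr (fun=> (psi d / d%:R)%:E)) => [|p _]; last exact: mE.
rewrite sumEFin lee_fin big_const_seq count_predT iter_addr_0 -(mulr_natl (psi d / d%:R)) (size_numer R pQ uQ d0).
have dR : d%:R != 0 :> R by rewrite pnatr_eq0 -lt0n.
by rewrite /mu le_eqVlt; apply/orP; left; apply/eqP; field.
Qed.

Lemma arcs_finite d : (0 < d)%N -> (mu_ (arcs Q psi d) < +oo)%E.
Proof.
move=> d0; apply: (@le_lt_trans _ _ (\sum_(p <- numer Q d) mu_ (arc psi d p))%E).
  have := @measure_setI_bigU _ _ R mu_ _ (arc psi d) (arc_measurable d) setT (numer Q d) measurableT.
  rewrite setTI => /le_trans; apply; apply: lee_sum => p _.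
  by rewrite setTI.
rewrite (eq_bigr (fun=> (psi d / d%:R)%:E)) => [|p _]; last exact: arc_measure.
by rewrite sumEFin ltry.
Qed.

(** If the arcs meet, the sign of p e' - r d' selects the one of the three counts in which the pair
    (p, r) occurs, and the intersection is no longer than the shorter arc. *)
Lemma arc_overlap d e p r : (0 < d)%N -> (0 < e)%N ->
  (mu_ (arc psi d p `&` arc psi e r) <= (Num.min (psi d / d%:R) (psi e / e%:R) *
    ((p * (e %/ gcdn d e) == r * (d %/ gcdn d e) + 0)%N +
     (\sum_(k <- iota 1 (steps psi d e)) (p * (e %/ gcdn d e) == r * (d %/ gcdn d e) + k)%N +
      \sum_(k <- iota 1 (steps psi d e)) (r * (d %/ gcdn d e) == p * (e %/ gcdn d e) + k)%N))%:R)%:E)%E.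
Proof.
move=> d0 e0; set g := gcdn d e; set d' := (d %/ g)%N; set e' := (e %/ g)%N.
set mn := Num.min _ _; set c := (_ + _)%N.
have mn0 : 0 <= mn by rewrite le_min !divr_ge0.
have g0 : 0 < g%:R :> R by rewrite ltr0n gcdn_gt0 d0.
have dR : 0 < d%:R :> R by rewrite ltr0n.
have eR : 0 < e%:R :> R by rewrite ltr0n.
have dE : d%:R = d'%:R * g%:R :> R by rewrite -natrM divnK // dvdn_gcdl.
have eE : e%:R = e'%:R * g%:R :> R by rewrite -natrM divnK // dvdn_gcdr.
have [I0|/set0P[x [/= xp xr]]] := eqVneq (arc psi d p `&` arc psi e r) set0.
  by rewrite I0 measure0 lee_fin mulr_ge0.
have c1 : (0 < c)%N.
  move: xp xr; rewrite /arc /= !in_itv /= => /andP[x1 x2] /andP[x3 x4].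
  have h1 := le_trans x1 x4; have h2 := le_trans x3 x2.
  move: h1; rewrite ler_pdivrMr // mulrAC ler_pdivlMr // dE eE !mulrA ler_pM2r // => h1.
  move: h2; rewrite ler_pdivrMr // mulrAC ler_pdivlMr // dE eE !mulrA ler_pM2r // => h2.
  have XE : reach psi d e <= (steps psi d e)%:R + 1.
    by have /andP[_ /ltW] := truncn_itv (reach_ge0 psi0 d e); rewrite -natr1.
  have r1 : psi d * e'%:R <= reach psi d e by rewrite le_max lexx.
  have r2 : psi e * d'%:R <= reach psi d e by rewrite le_max lexx orbT.
  have inX k : (0 < k)%N -> k%:R <= reach psi d e -> k \in iota 1 (steps psi d e).
    by move=> k0 kr; rewrite mem_iota k0 add1n ltnS truncn_ge_nat // reach_ge0.
  rewrite /c !addn_gt0 addn0; case: (ltngtP (p * e') (r * d')) => cmp //=.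
    apply/orP; right; have kin : (r * d' - p * e')%N \in iota 1 (steps psi d e).
      apply: inX; first by rewrite subn_gt0.
      apply: le_trans r1; rewrite natrB ?(ltnW cmp) // !natrM; lra.
    by rewrite (big_rem _ kin) /= subnKC ?(ltnW cmp) // eqxx.
  apply/orP; left; have kin : (p * e' - r * d')%N \in iota 1 (steps psi d e).
    apply: inX; first by rewrite subn_gt0.
    apply: le_trans r2; rewrite natrB ?(ltnW cmp) // !natrM; lra.
  by rewrite (big_rem _ kin) /= subnKC ?(ltnW cmp) // eqxx.
apply: (@le_trans _ _ mn%:E); last by rewrite lee_fin ler_peMr // ler1n.
rewrite /mn EFin_min le_min -!(arc_measure _ d0 : mu_ (arc psi d p) = _) -(arc_measure r e0).
by apply/andP; split; apply: le_measure; rewrite ?inE //; try exact: arc_measurable;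
  apply: measurableI; exact: arc_measurable.
Qed.

Lemma arcs_overlap d e : (0 < d)%N -> (0 < e)%N ->
  (mu_ (arcs Q psi d `&` arcs Q psi e) <=
    (Num.min (psi d / d%:R) (psi e / e%:R) * (over_count Q psi d e)%:R)%:E)%E.
Proof.
move=> d0 e0; apply: (@le_trans _ _ (\sum_(p <- numer Q d) \sum_(r <- numer Q e)
   mu_ (arc psi d p `&` arc psi e r))%E).
  have H := @measure_setI_bigU _ _ R mu_ _ (arc psi d) (arc_measurable d) _ (numer Q d) (arcs_measurable e).
  rewrite setIC; apply: (le_trans H); apply: lee_sum => p _; rewrite setIC.
  exact: (@measure_setI_bigU _ _ R mu_ _ (arc psi e) (arc_measurable e) _ (numer Q e) (arc_measurable d p)).
apply: (le_trans (lee_sum _ (fun p _ => lee_sum _ (fun r _ => arc_overlap p r d0 e0)))).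
under eq_bigr do rewrite sumEFin -mulr_sumr -natr_sum.
rewrite sumEFin -mulr_sumr -natr_sum lee_fin le_eqVlt; apply/orP; left; apply/eqP.
congr (_ * _%:R); rewrite /over_count size_sols_sum.
under eq_bigr do rewrite !big_split /=.
rewrite !big_split /=; congr (_ + (_ + _))%N.
  under eq_bigr do rewrite exchange_big /=.
  by rewrite exchange_big; apply: eq_bigr => k _; rewrite size_sols_sum.
under eq_bigr do rewrite exchange_big /=.
rewrite exchange_big; apply: eq_bigr => k _; rewrite size_sols_sum (gcdnC e d) exchange_big.
by [].
Qed.
End Arcs.

(** In Bonferroni's inequality the coincidences cost at most M/4 by the condition on (size S)^2, and
    [pair_sum] gives a multiple of M^(3/2), at most M/4 once M is small. The condition with 4096 =
    64^2 makes every prime beyond [Y] satisfy [64 * hp R p ^+ 2 <= rho]. *)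
Lemma block_theorem_small : exists eps0 : R, 0 < eps0 /\
  forall (Y : nat) (S : seq nat) (psi : nat -> R) (rho : R),
  let Q := [seq p <- iota 0 Y.+1 | prime p] in
  let M := massS Q S psi xpredT in
  (0 < Y)%N -> uniq S -> all (fun v => (0 < v)%N) S ->
  (forall v, 0 <= psi v) -> (forall v, psi v <= 2^-1) -> 0 <= rho ->
  0 < M -> M <= eps0 -> (forall v, v \in S -> rho * M <= mu Q psi v) ->
  4096 <= rho ^+ 2 * Y%:R -> 4 * (size S)%:R ^+ 2 <= Y%:R * M ->
  ((M / 2)%:E <= mu_ (\big[setU/set0]_(d <- S) arcs Q psi d))%E.
Proof.
have [C [C0 OP]] := overlap_prop R.
pose K : R := 4 * expR 10 * (expR 4 + 100 * C * expR 8).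
have K0 : 0 < K by rewrite mulr_gt0 ?mulr_gt0 ?addr_gt0 ?mulr_gt0 ?expR_gt0.
exists (Num.min 1 ((4 * K) ^-1 ^+ 2)); split.
  by rewrite lt_min ltr01 exprn_gt0 // invr_gt0 mulr_gt0.
move=> Y S psi rho Q M Y0 uS posS psi0 psi2 rho0 M0; rewrite le_min => /andP[M1 Meps] rhoM rhoY nY.
have pQ : all prime Q by apply/allP => q; rewrite mem_filter => /andP[].
have uQ : uniq Q by rewrite filter_uniq ?iota_uniq.
have bigQ p : prime p -> p \notin Q -> (Y < p)%N.
  by move=> pp; rewrite mem_filter pp mem_iota add0n ltnS -ltnNge.
have psi1 v : psi v <= 1 by apply: le_trans (psi2 v) _; lra.
have YR : 0 < Y%:R :> R by rewrite ltr0n.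
have hpQ p : prime p -> p \notin Q -> 64 * hp R p ^+ 2 <= rho.
  move=> pp pnQ; have Yp := bigQ p pp pnQ.
  have pR : 0 < p%:R :> R by rewrite ltr0n prime_gt0.
  have h0 := root4_ge0 (p%:R^-1 : R); rewrite -/(hp R p) in h0.
  rewrite -(@ler_pXn2r _ 2) ?nnegrE ?mulr_ge0 ?exprn_ge0 // exprMn -exprM hp4 -natrX.
  rewrite ler_pdivrMr //; apply: (@le_trans _ _ (rho ^+ 2 * Y%:R)).
    by rewrite (_ : (64 ^ 2 = 4096)%N).
  by rewrite ler_wpM2l ?exprn_ge0 // ler_nat ltnW.
have overlap z m T : (0 < z)%N -> 0 <= T -> totS Q S psi xpredT xpredT (close_pair Q z m T psi) <=
      C * Num.sqrt T * expR (- (z%:R * m)) * root4 M ^+ 6.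
  by move=> z0 T0; apply: (OP Q z m T rho).
have PS := pair_sum pQ uQ uS posS psi0 psi1 (ltW C0) overlap; rewrite -/M in PS.
have sq0 := sqrtr_ge0 M; have sqE : M = Num.sqrt M ^+ 2 by rewrite sqr_sqrtr // ltW.
set sM := Num.sqrt M in sq0 sqE.
have sMeps : K * sM <= 4^-1.
  have : sM <= (4 * K)^-1.
    have := ler_wsqrtr Meps; rewrite -/sM sqrtr_sqr ger0_norm // invr_ge0.
    by rewrite mulr_ge0 // ltW.
  rewrite -(ler_pM2l K0) => /le_trans; apply.
  by rewrite invfM mulrCA mulfV ?gt_eqF // mulr1.
have sM1 : sM <= 1 by rewrite -(sqrtr1 R) ler_wsqrtr.
have r6 : root4 M ^+ 6 = M * sM.
  by rewrite /root4 -/sM (exprM _ 2 3) sqr_sqrtr // exprSr -sqE.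
have total : \sum_(d <- S) \sum_(e <- S | e != d)
   (Num.min (psi d / d%:R) (psi e / e%:R) * (over_count Q psi d e)%:R) <= M / 2.
  apply: (@le_trans _ _ (\sum_(d <- S) \sum_(e <- S) (Y%:R^-1 + 4 * expR 10 *
     (mu Q psi d * mu Q psi e * pair_weight Q psi d e)))).
    rewrite big_seq [leRHS]big_seq; apply: ler_sum => d dS.
    rewrite big_mkcond big_seq [leRHS]big_seq; apply: ler_sum => e eS; case: ifP => [ed|_].
      by apply: pair_overlap => //; rewrite ?(allP posS) // eq_sym.
    apply: addr_ge0; first by rewrite invr_ge0.
    have pw : 0 <= pair_weight Q psi d e by rewrite /pair_weight; case: ifP => // _; exact: expR_ge0.
    by rewrite !mulr_ge0 ?expR_ge0 ?(ltW (phi_ratio_gt0 R pQ _)).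
  under eq_bigr do rewrite big_split /= -mulr_sumr.
  rewrite big_split /= -mulr_sumr; apply: (@le_trans _ _ (M / 4 + M / 4)); last by lra.
  apply: lerD.
    have sc (x : R) : \sum_(e <- S) x = x * (size S)%:R.
      by rewrite big_const_seq count_predT iter_addr_0 mulr_natr.
    rewrite !sc -mulrA -expr2.
    rewrite mulrC ler_pdivrMr // (_ : M / 4 * Y%:R = (Y%:R * M) / 4); last by ring.
    by rewrite ler_pdivlMr // mulrC.
  apply: (@le_trans _ _ (4 * expR 10 * ((expR 4 + 100 * C * expR 8) * (M * sM)))).
    rewrite ler_wpM2l ?mulr_ge0 ?expR_ge0 //; apply: (le_trans PS); rewrite r6 (mulrDl (expR 4)) lerD2r ler_wpM2l ?expR_ge0 //.
    by rewrite expr2 ler_wpM2l ?(ltW M0) // {1}sqE expr2 ler_piMl.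
  rewrite mulrA -/K mulrCA ler_wpM2l // ltW //.
have B := @bonferroni _ _ R mu_ _ (arcs Q psi) (arcs_measurable Q psi).
pose F d := if (0 < d)%N then arcs Q psi d else set0.
have mF d : measurable (F d) by rewrite /F; case: ifP => // _; exact: arcs_measurable.
have fF d : (mu_ (F d) < +oo)%E.
  by rewrite /F; case: ifP => [d0|_]; [apply: arcs_finite | rewrite measure0 ltry].
have {}B := @bonferroni _ _ R mu_ _ F mF fF S uS.
have FS d : d \in S -> F d = arcs Q psi d by move=> dS; rewrite /F (allP posS _ dS).
have U : \big[setU/set0]_(d <- S) arcs Q psi d = \big[setU/set0]_(d <- S) F d.
  by rewrite big_seq [RHS]big_seq; apply: eq_bigr => d dS; rewrite FS.
rewrite U; set W := mu_ _ in B *.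
have lo : (M%:E <= \sum_(d <- S) mu_ (F d))%E.
  rewrite /M /massS -sumEFin big_seq [leRHS]big_seq; apply: lee_sum => d dS.
  by rewrite FS //; apply: arcs_measure_ge => //; exact: (allP posS).
have hi : (\sum_(i <- S) \sum_(j <- S | j != i) mu_ (F i `&` F j) <= (M / 2)%:E)%E.
  apply: le_trans (_ : _ <= (\sum_(d <- S) \sum_(e <- S | e != d)
   (Num.min (psi d / d%:R) (psi e / e%:R) * (over_count Q psi d e)%:R))%:E)%E _; last by rewrite lee_fin.
  rewrite -sumEFin big_seq [leRHS]big_seq; apply: lee_sum => d dS.
  rewrite -sumEFin big_seq_cond [leRHS]big_seq_cond; apply: lee_sum => e /andP[eS _].
  by rewrite !FS //; apply: arcs_overlap => //; apply: (allP posS).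
have := le_trans lo (le_trans B (leeD2l _ hi)).
rewrite -leeBlDr // -EFinB => H; apply: le_trans H; rewrite lee_fin; lra.
Qed.

Theorem block_theorem : exists eps0 : R, 0 < eps0 /\
  forall (Y : nat) (S : seq nat) (psi : nat -> R) (rho s : R),
  let Q := [seq p <- iota 0 Y.+1 | prime p] in
  let M := massS Q S psi xpredT in
  (0 < Y)%N -> uniq S -> all (fun v => (0 < v)%N) S ->
  (forall v, 0 <= psi v) -> (forall v, psi v <= 2^-1) -> 0 <= rho ->
  0 < s -> s <= eps0 -> s <= M -> (forall v, v \in S -> rho * M <= mu Q psi v) ->
  4096 <= rho ^+ 2 * Y%:R -> 4 * (size S)%:R ^+ 2 <= Y%:R * s ->
  ((s / 2)%:E <= mu_ (\big[setU/set0]_(d <- S) arcs Q psi d))%E.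
Proof.
have [eps0 [e0 H]] := block_theorem_small; exists eps0; split=> //.
move=> Y S psi rho s Q M Y0 uS posS psi0 psi2 rho0 s0 se sM rhoM rhoY nY.
have M0 : 0 < M by apply: lt_le_trans sM.
have sM1 : s / M <= 1 by rewrite ler_pdivrMr // mul1r.
have sM0 : 0 <= s / M by rewrite divr_ge0 // ltW.
(* Shrinking every arc by the factor s / M makes the total mass equal to s. *)
pose psi' v := s / M * psi v.
have mass : massS Q S psi' xpredT = s.
  rewrite /massS (eq_bigr (fun v => s / M * mu Q psi v)) => [|v _]; last by rewrite /mu mulrA.
  by rewrite -mulr_sumr -/(massS Q S psi xpredT) -/M mulfVK // gt_eqF.
have le' v : psi' v <= psi v by rewrite ler_piMl.
apply: (@le_trans _ _ (mu_ (\big[setU/set0]_(d <- S) arcs Q psi' d))).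
  have := H Y S psi' rho Y0 uS posS; rewrite -/Q mass; apply => //.
  - by move=> v; rewrite mulr_ge0.
  - by move=> v; apply: le_trans (le' v) (psi2 v).
  - move=> v vS; have -> : rho * s = s / M * (rho * M) by field; exact: lt0r_neq0.
    by rewrite /mu /psi' -(mulrA (s / M)) -/(mu Q psi v) ler_wpM2l // rhoM.
apply: le_measure; rewrite ?inE; try exact: (measurable_bigU (arcs_measurable _ _)).
rewrite -!bigcup_seq; apply: subset_bigcup => d _; rewrite /arcs -!bigcup_seq.
apply: subset_bigcup => p _ x; rewrite /arc /= !in_itv /= => /andP[-> /le_trans -> //].
by rewrite ler_wpM2r ?invr_ge0 // lerD2l.
Qed.

End Block.

(** * Mertens bounds *)

Definition primes_upto (n : nat) : seq nat := [seq p <- iota 0 n.+1 | prime p].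

Lemma prime_primes_upto n : all prime (primes_upto n).
Proof. by apply/allP => q; rewrite mem_filter => /andP[]. Qed.

Lemma uniq_primes_upto n : uniq (primes_upto n).
Proof. by rewrite filter_uniq ?iota_uniq. Qed.

Lemma mem_primes_upto n q : (q \in primes_upto n) = prime q && (q <= n)%N.
Proof. by rewrite mem_filter mem_iota add0n ltnS. Qed.

Lemma big_primes_uptoS (R : realType) (n : nat) (f : nat -> R) :
  \sum_(q <- primes_upto n.+1) f q =
  \sum_(q <- primes_upto n) f q + (if prime n.+1 then f n.+1 else 0).
Proof.
rewrite /primes_upto -[in LHS]addn1 iotaD filter_cat big_cat /= add0n.
by case: ifP => _; rewrite ?big_seq1 ?big_nil.
Qed.

Lemma ln_prod_nat (R : realType) (I : eqType) (s : seq I) (f : I -> nat) :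
  (forall i, i \in s -> (0 < f i)%N) ->
  ln ((\prod_(i <- s) f i)%N)%:R = \sum_(i <- s) ln (f i)%:R :> R.
Proof.
elim: s => [|i s IH] fs; first by rewrite !big_nil ln1.
rewrite !big_cons natrM lnM ?IH ?posrE ?ltr0n ?fs ?mem_head //.
- by move=> j js; rewrite fs // inE js orbT.
- by rewrite big_seq prodn_cond_gt0 // => j js; rewrite fs // inE js orbT.
Qed.

Lemma prod_prime_powers_dvd (s : seq nat) (e : nat -> nat) (n : nat) : all prime s -> uniq s ->
  (forall q, q \in s -> (q ^ e q %| n)%N) -> (\prod_(q <- s) q ^ e q %| n)%N.
Proof.
elim: s => [|q s IH] /=; first by rewrite big_nil dvd1n.
move=> /andP[pq ps] /andP[qs us] sn; rewrite big_cons Gauss_dvd.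
  by rewrite sn ?mem_head //= IH // => r rs; rewrite sn // inE rs orbT.
rewrite big_seq; elim/big_rec: _ => [|r x rs IHx]; first by rewrite coprimen1.
rewrite coprimeMr IHx andbT coprimeXl // coprimeXr // prime_coprime //.
by rewrite (dvdn_prime2 pq (allP ps _ rs)); apply: contraNneq qs => ->.
Qed.

Section Mertens.
Variable R : realType.

Lemma ln2_ge : 2^-1 <= ln 2 :> R.
Proof.
rewrite -(expRK (2^-1 : R)) ler_ln ?posrE ?expR_gt0 //.
have h : expR (2^-1) ^+ 2 = expR 1 :> R by rewrite expr2 -expRD; congr expR; lra.
have := expR1_le3 R; rewrite -h; have := expR_gt0 (2^-1 : R); nra.
Qed.

(** The product of q^(n / q), with integer quotients, divides n!, which gives n log n; replacing n /
    q by its integer part costs at most the sum of log q, at most n log 4 by the primorial bound. *)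
Lemma sum_ln_primes n : (0 < n)%N ->
  \sum_(q <- primes_upto n) ln q%:R / q%:R <= ln n%:R + ln 4 :> R.
Proof.
move=> n0; have nR : 0 < n%:R :> R by rewrite ltr0n.
have pp q : q \in primes_upto n -> prime q by move=> /(allP (prime_primes_upto n)).
have lnq q : q \in primes_upto n -> 0 <= ln q%:R :> R.
  by move=> /pp qp; rewrite ln_ge0 // ler1n prime_gt0.
have fact_dvd : (\prod_(q <- primes_upto n) q ^ (n %/ q) %| n`!)%N.
  apply: prod_prime_powers_dvd; rewrite ?prime_primes_upto ?uniq_primes_upto // => q qn.
  rewrite pfactor_dvdn ?fact_gt0 ?pp // logn_fact ?pp // big_ltn // expn1.
  exact: leq_addr.
have up : ln (n`!)%:R <= n%:R * ln n%:R :> R.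
  rewrite mulr_natl -lnXn // ler_ln ?posrE ?ltr0n ?fact_gt0 ?exprn_gt0 //.
  rewrite -natrX ler_nat; elim: n {n0 nR pp lnq fact_dvd} => // n IH.
  by rewrite factS expnS leq_mul2l /=; apply: leq_trans IH _; case: n => // n; rewrite leq_exp2r.
have lo : \sum_(q <- primes_upto n) (n %/ q)%:R * ln q%:R <= ln (n`!)%:R :> R.
  have := dvdn_leq (fact_gt0 n) fact_dvd; rewrite -(ler_nat R) => h.
  apply: le_trans (_ : _ <= ln ((\prod_(q <- primes_upto n) q ^ (n %/ q))%N)%:R) _; last first.
    rewrite ler_ln ?posrE ?ltr0n ?fact_gt0 //; rewrite big_seq prodn_cond_gt0 // => q /pp qp.
    by rewrite expn_gt0 prime_gt0.
  rewrite ln_prod_nat => [|q /pp qp]; last by rewrite expn_gt0 prime_gt0.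
  rewrite big_seq [leRHS]big_seq; apply: ler_sum => q /pp qp.
  by rewrite natrX lnXn ?ltr0n ?prime_gt0 // mulr_natl.
have pr : \sum_(q <- primes_upto n) ln q%:R <= n%:R * ln 4 :> R.
  rewrite -(@ln_prod_nat R _ _ id) => [|q /pp /prime_gt0 //].
  rewrite mulr_natl -lnXn // ler_ln ?posrE ?exprn_gt0 //; last first.
    by rewrite ltr0n big_seq prodn_cond_gt0 // => q /pp /prime_gt0.
  by rewrite -natrX ler_nat /primes_upto big_filter primorial_le.
rewrite -(ler_pM2l nR) mulrDr.
have main : n%:R * (\sum_(q <- primes_upto n) ln q%:R / q%:R) <=
  \sum_(q <- primes_upto n) (n %/ q)%:R * ln q%:R + \sum_(q <- primes_upto n) ln q%:R :> R.
  rewrite mulr_sumr -big_split /= big_seq [leRHS]big_seq; apply: ler_sum => q qn.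
  have q0 : (0 < q)%N by rewrite prime_gt0 ?pp.
  rewrite (_ : n%:R * (ln q%:R / q%:R) = n%:R / q%:R * ln q%:R); last by ring.
  rewrite (_ : _ + ln q%:R = ((n %/ q)%:R + 1) * ln q%:R); last by ring.
  rewrite ler_wpM2r ?lnq // ler_pdivrMr ?ltr0n //.
  by rewrite natr1 -natrM ler_nat ltnW // ltn_ceil.
lra.
Qed.

Lemma lnln_step (x y : R) : 0 < x -> x <= y -> (y - x) / y <= ln y - ln x.
Proof.
move=> x0 xy; have y0 : 0 < y by apply: lt_le_trans xy.
have h : ln (x / y) <= x / y - 1.
  have E : 1 + (x / y - 1) = x / y by ring.
  rewrite -{1}E; apply: le_ln1Dx; have : 0 < x / y by exact: divr_gt0.
  lra.
move: h; rewrite ln_div ?posrE // mulrBl divff ?gt_eqF //; lra.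
Qed.

(** Partial summation as an induction: G - A / log is compared with the same expression in which A
    is replaced by its upper bound log + log 4. The final step puts A / log back. *)
Lemma sum_inv_primes n : (1 < n)%N ->
  \sum_(q <- primes_upto n) q%:R^-1 <= ln (ln n%:R) + 4 :> R.
Proof.
pose A n : R := \sum_(q <- primes_upto n) ln q%:R / q%:R.
pose G n : R := \sum_(q <- primes_upto n) q%:R^-1.
have l2 := ln2_ge.
have lnpos k : (1 < k)%N -> 0 < ln k%:R :> R by move=> k1; rewrite ln_gt0 // ltr1n.
have ln4 : ln 4 = 2 * ln 2 :> R.
  by rewrite (_ : 4 = 2 ^+ 2 :> R) ?lnXn ?mulr_natl // -natrX.
have key k : (1 < k)%N ->
    G k - A k / ln k%:R <= ln (ln k%:R) + 4 - (ln k%:R + ln 4) / ln k%:R.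
  elim: k => // k IH; rewrite ltnS leq_eqVlt => /orP[/eqP <-|k1].
    have G2 : G 2%N = 2^-1 by rewrite /G /primes_upto /= big_seq1.
    have A2 : A 2%N = ln 2 / 2 by rewrite /A /primes_upto /= big_seq1.
    have l0 : ln 2 != 0 :> R by rewrite gt_eqF // lnpos.
    rewrite G2 A2 ln4 (_ : (ln 2 + 2 * ln 2) / ln 2 = 3 :> R); last by field.
    rewrite (_ : ln 2 / 2 / ln 2 = 2^-1 :> R); last by field.
    have l1 : ln 2 <= 1 :> R by rewrite -[leRHS](expRK (1 : R)) ler_ln ?posrE ?expR_gt0 //; have := expR1_ge R; lra.
    have : ln (2^-1) <= ln (ln 2) :> R by rewrite ler_ln ?posrE ?lnpos.
    by rewrite lnV ?posrE //; lra.
  have {IH} := IH k1; set w := (ln k%:R)^-1; set w' := (ln k.+1%:R)^-1.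
  have x0 := lnpos k k1; have y0 := lnpos k.+1 (leqW k1).
  have xy : ln k%:R <= ln k.+1%:R :> R by rewrite ler_ln ?posrE ?ltr0n ?ler_nat // ltnW.
  have ww : w' <= w by rewrite lef_pV2 ?posrE.
  have Ak : A k <= ln k%:R + ln 4 by apply: sum_ln_primes; exact: ltnW.
  have st := lnln_step x0 xy.
  (* A new prime adds 1/(k+1) to [G] and also to [A] divided by log(k+1), so only the change of the
     weight is felt. *)
  have -> : G k.+1 - A k.+1 * w' = G k - A k * w'.
    rewrite /G /A !big_primes_uptoS; case: ifP => [pk|_]; last by rewrite !addr0.
    have z2 : k.+1%:R != 0 :> R by rewrite pnatr_eq0.
    have z1 := lt0r_neq0 y0; move: z1 z2; rewrite /w'.
    move: (ln k.+1%:R : R) => l; move: (k.+1%:R : R) => t l0 t0.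
    by field; rewrite l0.
  have e1 : ln k%:R * w = 1 by rewrite mulfV ?gt_eqF.
  have e2 : ln k.+1%:R * w' = 1 by rewrite mulfV ?gt_eqF.
  have AkW : A k * (w - w') <= (ln k%:R + ln 4) * (w - w') by rewrite ler_wpM2r // subr_ge0.
  move: st AkW; rewrite -/w' !mulrDl !mulrBr ?mulNr e1 e2; lra.
move=> n1; have := key n n1; have := sum_ln_primes (ltnW n1); rewrite -/(A n) -/(G n) => An.
have y0 := lnpos n n1.
have : A n / ln n%:R <= (ln n%:R + ln 4) / ln n%:R by rewrite ler_wpM2r // invr_ge0 ltW.
lra.
Qed.

Lemma one_sub_inv_ge q : prime q -> expR (- (q%:R^-1 + 2 * q%:R ^- 2)) <= 1 - q%:R^-1 :> R.
Proof.
move=> pq; have q2 : 2 <= q%:R :> R by rewrite ler_nat prime_gt1.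
have x2 : q%:R^-1 <= 2^-1 :> R by rewrite lef_pV2 ?posrE //; lra.
have x0 : 0 <= q%:R^-1 :> R by rewrite invr_ge0.
rewrite -exprVn expRN; move: (q%:R^-1 : R) x0 x2 => x x0 x2.
rewrite -[leRHS]invrK lef_pV2 ?posrE ?invr_gt0 ?expR_gt0 //; last lra.
apply: le_trans (expR_ge1Dx _); rewrite -[leLHS]mul1r ler_pdivrMr; last lra.
by nra.
Qed.

Lemma phi_prod_ge (s : seq nat) : all prime s -> uniq s ->
  expR (- (\sum_(q <- s) q%:R^-1 + 2)) <= \prod_(q <- s) (1 - q%:R^-1) :> R.
Proof.
move=> ps us; have sq : \sum_(q <- s) (q%:R ^- 2 : R) <= 1.
  have := @sum_inv_sq_tail R 1 s isT us; rewrite invr1; apply.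
  by apply/allP => q /(allP ps) /prime_gt1.
apply: (@le_trans _ _ (\prod_(q <- s) expR (- (q%:R^-1 + 2 * q%:R ^- 2)))).
  rewrite -expR_sum ler_expR sumrN lerN2 big_split /= -mulr_sumr lerD2l; lra.
rewrite big_seq [leRHS]big_seq; apply: ler_prod => q /(allP ps) pq.
by rewrite expR_ge0 one_sub_inv_ge.
Qed.

Lemma phi_upto_ge Y : (1 < Y)%N -> expR (- 6) / ln Y%:R <= \prod_(q <- primes_upto Y) (1 - q%:R^-1) :> R.
Proof.
move=> Y1; apply: le_trans (phi_prod_ge (prime_primes_upto Y) (uniq_primes_upto Y)).
have l0 : 0 < ln Y%:R :> R by rewrite ln_gt0 // ltr1n.
rewrite -[X in _ / X](@lnK R) ?posrE // -expRN -expRD ler_expR.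
have := sum_inv_primes Y1; lra.
Qed.

Lemma prod_sub_le (s t : seq nat) : all prime t -> uniq s -> uniq t -> {subset s <= t} ->
  \prod_(q <- t) (1 - q%:R^-1) <= \prod_(q <- s) (1 - q%:R^-1) :> R.
Proof.
move=> pt us ut st.
have b q : q \in t -> 0 < (1 : R) - q%:R^-1 <= 1 by exact: one_sub_inv_bounds.
have pe : perm_eq s [seq q <- t | q \in s].
  apply: uniq_perm; rewrite ?filter_uniq // => q; rewrite mem_filter.
  by case qs: (q \in s) => //=; rewrite st.
rewrite (perm_big _ pe) /= big_filter [leRHS]big_mkcond big_seq [leRHS]big_seq.
apply: ler_prod => q qt; have /andP[/ltW -> h] := b q qt; rewrite /=.
by case: ifP.
Qed.

(** Uniform in [d], at the price of log Y; this serves the stretches on which [theta] is large and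
    [d] may be enormous. *)
Lemma phi_ratio_upto_ge Y d : (1 < Y)%N -> expR (- 6) / ln Y%:R <= phi_ratio (primes_upto Y) d :> R.
Proof.
move=> Y1; apply: le_trans (phi_upto_ge Y1) _; rewrite /phi_ratio -[leRHS]big_filter.
apply: prod_sub_le; rewrite ?prime_primes_upto ?filter_uniq ?iota_uniq //.
by move=> q; rewrite mem_filter => /andP[].
Qed.

(** Split the primes at y of size log d. Those up to y cost 1 / log y by Mertens; there are at most
    2 y larger prime factors, as 2^count <= d, and their reciprocals sum to a constant. *)
Lemma phi_ratio_ge (Q : seq nat) (d : nat) : all prime Q -> uniq Q -> (0 < d)%N ->
  expR (- 10) / (3 * Log2 d%:R) <= phi_ratio Q d :> R.
Proof.
move=> pQ uQ d0; have dR : 0 < d%:R :> R by rewrite ltr0n.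
have L1 : 1 <= Log d%:R :> R by rewrite le_max lexx.
have LL1 : 1 <= Log2 d%:R :> R by rewrite le_max lexx.
have Ld : ln d%:R <= Log d%:R :> R by rewrite le_max lexx orbT.
have LLd : ln (Log d%:R) <= Log2 d%:R :> R by rewrite le_max lexx orbT.
pose y := (Num.trunc (Log d%:R : R)).+2.
have L0 : 0 <= Log d%:R :> R by lra.
have /andP[y1 y2] := truncn_itv L0.
have yL : Log d%:R <= y%:R :> R by rewrite /y -natr1; lra.
have yL3 : y%:R <= 3 * Log d%:R :> R by rewrite /y -2!natr1; lra.
have lny : ln y%:R <= 3 * Log2 d%:R :> R.
  have : ln y%:R <= ln (3 * Log d%:R) :> R by rewrite ler_ln ?posrE ?ltr0n // mulr_gt0 //; lra.
  rewrite lnM ?posrE //; last lra.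
  have : ln 3 <= 2 :> R.
    rewrite -[leRHS](expRK (2 : R)) ler_ln ?posrE ?expR_gt0 //.
    by have := expR_ge1Dx (2 : R); lra.
  lra.
pose s1 := [seq q <- Q | (q %| d)%N && (q <= y)%N].
pose s2 := [seq q <- Q | (q %| d)%N && (y < q)%N].
have ps2 : all prime s2 by apply/allP => q; rewrite mem_filter => /andP[_]; exact: (allP pQ).
have -> : phi_ratio Q d = (\prod_(q <- s1) (1 - q%:R^-1)) * \prod_(q <- s2) (1 - q%:R^-1) :> R.
  rewrite /phi_ratio (bigID (fun q => q <= y)%N) /= /s1 /s2 !big_filter; congr (_ * _).
  by apply: eq_bigl => q; rewrite -ltnNge.
have p1 : expR (- 6) / (3 * Log2 d%:R) <= \prod_(q <- s1) (1 - q%:R^-1) :> R.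
  apply: (@le_trans _ _ (expR (- 6) / ln y%:R)).
    rewrite ler_wpM2l ?expR_ge0 // lef_pV2 ?posrE ?mulr_gt0 ?ln_gt0 ?ltr1n //; lra.
  apply: le_trans (phi_upto_ge (isT : 1 < y)%N) _.
  apply: prod_sub_le; rewrite ?prime_primes_upto ?filter_uniq ?iota_uniq //.
  by move=> q; rewrite mem_filter mem_primes_upto => /andP[/andP[_ ->] /(allP pQ) ->].
have sz : (2 ^ size s2 <= d)%N.
  apply: leq_trans (_ : \prod_(q <- s2) q <= d)%N; last first.
    apply: dvdn_leq => //; apply: prod_primes_dvd; rewrite ?filter_uniq //.
    by apply/allP => q; rewrite mem_filter => /andP[/andP[]].
  elim: (s2) ps2 => [|q s IH] /=; first by rewrite big_nil.
  by move=> /andP[pq /IH h]; rewrite big_cons expnS leq_mul // prime_gt1.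
have szR : (size s2)%:R <= 2 * y%:R :> R.
  have : ln ((2 ^ size s2)%N)%:R <= ln d%:R :> R by rewrite ler_ln ?posrE ?ltr0n ?expn_gt0 // ler_nat.
  rewrite natrX lnXn // -[ln 2 *+ _]mulr_natl.
  have := ler_wpM2l (ler0n R (size s2)) ln2_ge; lra.
have p2 : expR (- 4) <= \prod_(q <- s2) (1 - q%:R^-1) :> R.
  have y0 : 0 < y%:R :> R by rewrite ltr0n.
  apply: (@le_trans _ _ (\prod_(q <- s2) expR (- (2 / y%:R)))).
    rewrite -expR_sum ler_expR big_const_seq count_predT iter_addr_0.
    rewrite -[- (2 / _) *+ _]mulr_natr mulNr lerN2 mulrAC ler_pdivrMr //; lra.
  rewrite big_seq [leRHS]big_seq; apply: ler_prod => q qs; rewrite expR_ge0 /=.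
  have pq := allP ps2 q qs; apply: le_trans (one_sub_inv_ge pq); rewrite ler_expR lerN2.
  have yq : y%:R <= q%:R :> R by move: qs; rewrite mem_filter ler_nat => /andP[/andP[_ /ltnW]].
  have q2 : 2 <= q%:R :> R by rewrite ler_nat prime_gt1.
  have i2 : q%:R^-1 <= 2^-1 :> R by rewrite lef_pV2 ?posrE //; lra.
  have iy : q%:R^-1 <= y%:R^-1 :> R by rewrite lef_pV2 ?posrE //; lra.
  have i0 : 0 <= q%:R^-1 :> R by rewrite invr_ge0.
  rewrite -exprVn; move: i2 iy i0; move: (q%:R^-1 : R) (y%:R^-1 : R) => a b; nra.
have e10 : expR (- 10) = expR (- 6) * expR (- 4) :> R by rewrite -expRD; congr expR; lra.
rewrite e10 mulrAC; apply: ler_pM => //; rewrite ?expR_ge0 ?divr_ge0 ?expR_ge0 //; lra.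
Qed.

End Mertens.

(** * Differences and mass *)

(** Subtraction of naturals is truncated: negative differences become 0 and are filtered out. *)
Definition posdiffs (a : nat -> nat) (N : nat) : seq nat :=
  undup [seq d <- [seq (a i - a j)%N | i <- iota 1 N, j <- iota 1 N] | (0 < d)%N].

Section Differences.
Variable a : nat -> nat.
Hypothesis apos : forall n, (1 <= n)%N -> (0 < a n)%N.
Hypothesis ainc : forall n, (1 <= n)%N -> (a n < a n.+1)%N.
Local Notation D := (posdiffs a).

Lemma uniq_posdiffs N : uniq (D N). Proof. exact: undup_uniq. Qed.

Lemma posdiffsP N d : reflect (exists i j, [/\ (1 <= i <= N)%N, (1 <= j <= N)%N, (0 < d)%N & d = (a i - a j)%N])
  (d \in D N).
Proof.
rewrite mem_undup mem_filter; apply: (iffP andP) => [[d0 /allpairsP[[i j] [/= iN jN dE]]]|[i [j [iN jN d0 dE]]]].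
  by exists i, j; move: iN jN; rewrite !mem_iota !add1n !ltnS.
by split=> //; apply/allpairsP; exists (i, j); rewrite !mem_iota !add1n !ltnS.
Qed.

Lemma a_mono i j : (1 <= i)%N -> (i <= j)%N -> (a i <= a j)%N.
Proof.
move=> i1 /subnKC <-; elim: (j - i)%N => [|k IH]; first by rewrite addn0.
by rewrite addnS; apply: leq_trans IH (ltnW (ainc _)); rewrite addn_gt0 i1.
Qed.

Lemma posdiffs_sub N M : (N <= M)%N -> {subset D N <= D M}.
Proof.
move=> NM d /posdiffsP[i [j [/andP[i1 iN] /andP[j1 jN] d0 dE]]]; apply/posdiffsP.
by exists i, j; rewrite i1 j1 !(leq_trans _ NM).
Qed.

Lemma posdiffs_gt0 N d : d \in D N -> (0 < d)%N.
Proof. by case/posdiffsP => i [j []]. Qed.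

Lemma posdiffs_le N d : d \in D N -> (d <= a N)%N.
Proof.
case/posdiffsP => i [j [/andP[i1 iN] _ _ ->]]; apply: leq_trans (leq_subr _ _) _.
exact: a_mono.
Qed.

Lemma C_N_posdiffs N : (1 <= N)%N -> C_N a N = (2 * size (D N)).+1.
Proof.
move=> N1; pose L := 0%Z :: [seq d%:Z | d <- D N] ++ [seq - d%:Z | d <- D N].
have -> : (2 * size (D N)).+1 = size L by rewrite /= size_cat !size_map addnn mul2n.
apply/perm_size/uniq_perm; first exact: undup_uniq.
  rewrite /L /= cat_uniq !map_inj_uniq ?uniq_posdiffs //; last 2 first.
  - by move=> x y /oppr_inj [].
  - by move=> x y [].
  rewrite mem_cat negb_or /= andbT -andbA; apply/and3P; split.
  - by apply/mapP => -[d /posdiffs_gt0 d0 []]; lia.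
  - by apply/mapP => -[d /posdiffs_gt0 d0]; lia.
  by apply/hasPn => x /mapP[d /posdiffs_gt0 d0 ->]; apply/mapP => -[e /posdiffs_gt0 e0]; lia.
move=> x; rewrite mem_undup inE mem_cat; apply/allpairsP/idP.
  case=> -[i j] [/= iN jN ->]; move: iN jN; rewrite !mem_iota !add1n !ltnS => iN jN.
  have [ij|ij|->] := ltngtP (a i) (a j); last by rewrite subrr eqxx.
    apply/orP; right; apply/orP; right; apply/mapP; exists (a j - a i)%N; last by lia.
    by apply/posdiffsP; exists j, i; rewrite subn_gt0.
  apply/orP; right; apply/orP; left; apply/mapP; exists (a i - a j)%N; last by lia.
  by apply/posdiffsP; exists i, j; rewrite subn_gt0.
case/or3P => [/eqP ->|/mapP[d dD ->]|/mapP[d dD ->]].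
- by exists (1, 1)%N; rewrite /= !mem_iota subrr; split => //; lia.
- have d0 := posdiffs_gt0 dD; case/posdiffsP: dD => i [j [iN jN _ dE]].
  by exists (i, j); rewrite /= !mem_iota !add1n !ltnS; split => //; lia.
have d0 := posdiffs_gt0 dD; case/posdiffsP: dD => i [j [iN jN _ dE]].
by exists (j, i); rewrite /= !mem_iota !add1n !ltnS; split => //; lia.
Qed.

Lemma size_posdiffsS_gt N : (1 <= N)%N -> (size (D N) < size (D N.+1))%N.
Proof.
move=> N1; have lt1 : (a 1 < a N.+1)%N by apply: leq_ltn_trans (a_mono _ N1) (ainc N1).
have := @uniq_leq_size _ ((a N.+1 - a 1)%N :: D N) (D N.+1); apply.
  rewrite /= uniq_posdiffs andbT; apply/negP => /posdiffsP[i [j [/andP[i1 iN] /andP[j1 jN] d0 dE]]].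
  by have := a_mono i1 iN; have := a_mono (leqnn 1) j1; have := ainc N1; lia.
move=> d; rewrite inE => /orP[/eqP ->|]; last exact: posdiffs_sub.
by apply/posdiffsP; exists N.+1, 1%N; rewrite subn_gt0 lt1 leqnn.
Qed.

Lemma size_posdiffsS_le N : (size (D N.+1) <= size (D N) + N)%N.
Proof.
have -> : (size (D N) + N = size (D N ++ [seq (a N.+1 - a j)%N | j <- iota 1 N]))%N.
  by rewrite size_cat size_map size_iota.
apply: uniq_leq_size (uniq_posdiffs _) _ => d /posdiffsP[i [j [/andP[i1 iN] /andP[j1 jN] d0 dE]]].
have ij : (j < i)%N.
  by rewrite ltnNge; apply/negP => ij; have := a_mono i1 ij; move: d0; rewrite dE; lia.
rewrite mem_cat; move: iN; rewrite leq_eqVlt => /orP[/eqP iE|iN].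
  apply/orP; right; apply/mapP; exists j; last by rewrite -iE.
  by rewrite mem_iota j1 add1n ltnS -ltnS -iE.
apply/orP; left; apply/posdiffsP; exists i, j; rewrite i1 j1 -ltnS iN; split => //.
by rewrite -ltnS (ltn_trans ij).
Qed.

Lemma C_NS_gt N : (1 <= N)%N -> (C_N a N + 2 <= C_N a N.+1)%N.
Proof. by move=> N1; rewrite !C_N_posdiffs //; have := size_posdiffsS_gt N1; lia. Qed.

Lemma C_N_ge N : (1 <= N)%N -> (2 * N - 1 <= C_N a N)%N.
Proof.
elim: N => // N IH _; have [->|N0] := posnP N; first by rewrite C_N_posdiffs.
by have := IH N0; have := C_NS_gt N0; lia.
Qed.

(** At most N positive differences are new, so C grows by at most 2N, and 2N <= C_N + 1. *)
Lemma C_NS_le N : (1 <= N)%N -> (C_N a N.+1 <= 3 * C_N a N)%N.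
Proof.
by move=> N1; have := C_N_ge N1; rewrite !C_N_posdiffs //; have := size_posdiffsS_le N; lia.
Qed.

Lemma C_N_le N : (1 <= N)%N -> (C_N a N <= N ^ 2)%N.
Proof.
elim: N => // N IH _; have [->|N0] := posnP N.
  by rewrite C_N_posdiffs //; have := size_posdiffsS_le 0; rewrite /posdiffs /= leqn0; lia.
by have := IH N0; rewrite !C_N_posdiffs //; have := size_posdiffsS_le N; nia.
Qed.

Lemma C_N_mono N M : (1 <= N)%N -> (N <= M)%N -> (C_N a N <= C_N a M)%N.
Proof.
move=> N1 /subnKC <-; elim: (M - N)%N => [|k IH]; first by rewrite addn0.
apply: leq_trans IH _; rewrite addnS; have := @C_NS_gt (N + k); rewrite addn_gt0 N1 => /(_ isT); lia.
Qed.

(** The stage at which [d] first occurs as a difference; 0 if it never does, which is no stage since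
    [posdiffs] is empty there. *)
Definition lab (d : nat) : nat :=
  if pselect (exists N, d \in D N) is left h then ex_minn h else 0.

Lemma labP N d : d \in D N -> d \in D (lab d) /\ (lab d <= N)%N.
Proof.
move=> dN; rewrite /lab; case: pselect => [h|[]]; last by exists N.
by case: ex_minnP => m dm mmin; split => //; exact: mmin.
Qed.

Lemma lab_gt N M d : d \in D M -> d \notin D N -> (N < lab d)%N.
Proof.
move=> dM; apply: contraR; rewrite -leqNgt => le; have [dl _] := labP dM.
exact: posdiffs_sub le _ dl.
Qed.

Definition newdiffs (N M : nat) : seq nat := [seq d <- D M | d \notin D N].

Lemma mem_newdiffs N M d : (d \in newdiffs N M) = (d \notin D N) && (d \in D M).
Proof. by rewrite mem_filter. Qed.

Section Sums.
Variables (R : realType) (f : nat -> R).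

Lemma sum_posdiffs_split N M (g : nat -> R) : (N <= M)%N ->
  \sum_(d <- D M) g d = \sum_(d <- D N) g d + \sum_(d <- newdiffs N M) g d.
Proof.
move=> NM; rewrite -big_cat /=; apply: perm_big; apply: uniq_perm.
- exact: uniq_posdiffs.
- rewrite cat_uniq uniq_posdiffs filter_uniq ?uniq_posdiffs // andbT /=.
  by apply/hasPn => d; rewrite mem_newdiffs => /andP[].
move=> d; rewrite mem_cat mem_newdiffs; case dN: (d \in D N) => //=.
exact: posdiffs_sub NM _ dN.
Qed.

Lemma sum_newdiffs_lab N : (1 <= N)%N ->
  \sum_(d <- newdiffs N N.+1) f (lab d) =
  ((C_N a N.+1)%:R - (C_N a N)%:R) / 2 * f N.+1.
Proof.
move=> N1; rewrite (eq_big_seq (fun=> f N.+1)) => [|d]; last first.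
  rewrite mem_newdiffs => /andP[dN dM]; congr f; apply/eqP; rewrite eqn_leq.
  by rewrite (labP dM).2 (lab_gt dM dN).
have := @sum_posdiffs_split N N.+1 (fun=> 1) (leqnSn N).
rewrite !big_const_seq !count_predT !iter_addr_0 => h.
have sz : (size (newdiffs N N.+1))%:R = ((C_N a N.+1)%:R - (C_N a N)%:R) / 2 :> R.
  by rewrite !C_N_posdiffs // -!natr1 !natrM h; field.
by rewrite -sz mulr_natl.
Qed.

End Sums.

(** Stage n contributes half of (C_n - C_(n-1)) / C_n, a Riemann sum of log C. Sampling at the right
    endpoint costs at most the factor 3 of [C_NS_le]. *)
Lemma block_sum_ge (R : realType) N M : (1 <= N)%N -> (N <= M)%N ->
  (ln (C_N a M)%:R - ln (C_N a N)%:R) / 6 <= \sum_(d <- newdiffs N M) (C_N a (lab d))%:R^-1 :> R.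
Proof.
move=> N1 /subnKC <-; elim: (M - N)%N => [|k IH].
  rewrite addn0 subrr mul0r; apply: sumr_ge0 => d _; by rewrite invr_ge0.
rewrite addnS; set P := (N + k)%N in IH *.
have P1 : (1 <= P)%N by rewrite addn_gt0 N1.
have NP : (N <= P)%N by exact: leq_addr.
pose g d : R := (C_N a (lab d))%:R^-1.
have -> : \sum_(d <- newdiffs N P.+1) (C_N a (lab d))%:R^-1 =
    \sum_(d <- newdiffs N P) g d + \sum_(d <- newdiffs P P.+1) g d.
  have h1 := sum_posdiffs_split g (leqW NP); have h2 := sum_posdiffs_split g NP.
  have h3 := sum_posdiffs_split g (leqnSn P).
  by rewrite -/(\sum_(d <- newdiffs N P.+1) g d); lra.
have cP : 0 < (C_N a P)%:R :> R by rewrite ltr0n; have := C_N_ge P1; lia.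
have c3 : (C_N a P.+1)%:R <= 3 * (C_N a P)%:R :> R by rewrite -natrM ler_nat C_NS_le.
have cc : (C_N a P)%:R <= (C_N a P.+1)%:R :> R by rewrite ler_nat C_N_mono.
rewrite (sum_newdiffs_lab (fun n => (C_N a n)%:R^-1) P1).
move: IH; rewrite -/(\sum_(d <- newdiffs N P) g d); move: cP c3 cc.
move: (C_N a P)%:R (C_N a P.+1)%:R => x y x0 y3 xy IH.
have y0 : 0 < y by lra.
have st : ln y - ln x <= (y - x) / x.
  have h : ln (y / x) <= y / x - 1.
    have E : 1 + (y / x - 1) = y / x by ring.
    by rewrite -{1}E; apply: le_ln1Dx; have : 0 < y / x by [exact: divr_gt0]; lra.
  by move: h; rewrite ln_div ?posrE // mulrBl divff ?gt_eqF.
have : (y - x) / x <= 3 * (y - x) / y.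
  rewrite ler_pdivrMr // mulrAC ler_pdivlMr //; nra.
rewrite (_ : 3 * (y - x) / y = 3 * ((y - x) / y)); last by ring.
rewrite (_ : (y - x) / 2 / y = (y - x) / y / 2); last by ring.
move: IH st; move: ((y - x) / y) ((y - x) / x) => t u; lra.
Qed.

End Differences.

Section Logs.
Variable R : realType.
Implicit Types x y : R.

Lemma Log_ge1 x : 1 <= Log x. Proof. by rewrite le_max lexx. Qed.
Lemma Log2_ge1 x : 1 <= Log2 x. Proof. exact: Log_ge1. Qed.
Lemma Log_gt0 x : 0 < Log x. Proof. exact: lt_le_trans (Log_ge1 x). Qed.
Lemma Log2_gt0 x : 0 < Log2 x. Proof. exact: Log_gt0. Qed.

Lemma Log_mono x y : 0 < x -> x <= y -> Log x <= Log y.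
Proof.
move=> x0 xy; rewrite ge_max !le_max lexx /=; apply/orP; right.
by rewrite ler_ln ?posrE // (lt_le_trans x0).
Qed.

Lemma Log2_mono x y : 0 < x -> x <= y -> Log2 x <= Log2 y.
Proof. by move=> x0 xy; apply: Log_mono (Log_gt0 x) (Log_mono x0 xy). Qed.

Lemma ln_le_sub1 x : 0 < x -> ln x <= x - 1.
Proof.
move=> x0; have E : 1 + (x - 1) = x by ring.
by rewrite -{1}E; apply: le_ln1Dx; lra.
Qed.

Lemma Log_pow4 (N M : nat) : (0 < M)%N -> (M <= N ^ 4)%N -> Log (M%:R : R) <= 4 * Log (N%:R : R).
Proof.
move=> M0 MN; have N0 : (0 < N)%N by case: N MN => [|n _] //; rewrite exp0n // leqNgt M0.
have h1 := Log_ge1 (N%:R : R).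
apply: (le_trans (@Log_mono _ ((N ^ 4)%N%:R) _ _)); rewrite ?ltr0n ?ler_nat //.
rewrite ge_max; apply/andP; split; first lra.
rewrite natrX lnXn ?ltr0n // -[ln _ *+ _]mulr_natl ler_wpM2l //.
by rewrite le_max lexx orbT.
Qed.

Lemma Log2_pow4 (N M : nat) : (0 < M)%N -> (M <= N ^ 4)%N -> Log2 (M%:R : R) <= Log2 (N%:R : R) + 2.
Proof.
move=> M0 MN; have h := Log_pow4 M0 MN; have L1 := Log_ge1 (N%:R : R).
have L2 := Log2_ge1 (N%:R : R); have LL : ln (Log N%:R) <= Log2 N%:R :> R by rewrite le_max lexx orbT.
rewrite /Log2 {1}/Log ge_max; apply/andP; split; first by rewrite -/(Log2 _); lra.
apply: (@le_trans _ _ (ln (4 * Log N%:R))).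
  by rewrite ler_ln ?posrE ?mulr_gt0 ?Log_gt0.
rewrite lnM ?posrE ?Log_gt0 //.
have : ln 4 <= 2 :> R.
  rewrite (_ : 4 = 2 ^+ 2 :> R) ?lnXn //; last by rewrite -natrX.
  by have := @ln_le_sub1 2 (ltr0n _ 2); rewrite -[ln 2 *+ 2]mulr_natl; lra.
by rewrite -/(Log2 _); lra.
Qed.

Lemma harmonic_unbounded (B : R) : exists J, B <= \sum_(j <- iota 0 J) (j.+1%:R)^-1.
Proof.
have key J : ln J.+1%:R <= \sum_(j <- iota 0 J) (j.+1%:R)^-1 :> R.
  elim: J => [|J IH]; first by rewrite big_nil ln1.
  rewrite -[X in iota 0 X]addn1 iotaD big_cat big_seq1 add0n /=.
  have x0 : 0 < J.+1%:R :> R by rewrite ltr0n.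
  have y0 : 0 < J.+2%:R / J.+1%:R :> R by rewrite divr_gt0 ?ltr0n.
  have E : J.+2%:R / J.+1%:R - 1 = J.+1%:R^-1 :> R.
    by rewrite -[J.+2%:R]natr1 mulrDl mulfV ?lt0r_neq0 // mul1r addrAC subrr add0r.
  have := ln_le_sub1 y0; rewrite E ln_div ?posrE ?ltr0n // => st.
  by apply: (le_trans _ (lerD IH (lexx _))); rewrite -lerBlDl.
exists (Num.trunc (expR B)); apply: le_trans (key _).
rewrite -[leLHS](expRK B) ler_ln ?posrE ?expR_gt0 ?ltr0n //.
by apply: ltW; have /andP[] := truncn_itv (expR_ge0 B).
Qed.

End Logs.

(** * Lower bound for the measure of the arcs beyond any stage *)

Section LowerBound.
Variables (R : realType) (a : nat -> nat).
Hypothesis apos : forall n, (1 <= n)%N -> (0 < a n)%N.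
Hypothesis ainc : forall n, (1 <= n)%N -> (a n < a n.+1)%N.
Local Notation D := (posdiffs a).
Local Notation C N := ((C_N a N)%:R : R).

Definition theta (N : nat) : R := Log2 (a N)%:R / (Log (N%:R : R) * Log2 (N%:R : R)).
(** With the minimum, one limsup set serves both upper bounds of the theorem, and [tau N <= 1/2]
    from N = 2 on keeps the arcs of a denominator disjoint. *)
Definition tau (N : nat) : R := Num.min 1 (theta N) / C N.

Lemma C_gt0 N : (1 <= N)%N -> 0 < C N.
Proof. by move=> N1; rewrite ltr0n; have := C_N_ge ainc N1; lia. Qed.

Lemma C_N_ge_self N : (1 <= N)%N -> (N <= C_N a N)%N.
Proof. by move=> N1; have := C_N_ge ainc N1; lia. Qed.

Lemma theta_gt0 N : 0 < theta N.
Proof. by rewrite divr_gt0 ?mulr_gt0 ?Log2_gt0 ?Log_gt0. Qed.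

Lemma tau_le N : (2 <= N)%N -> tau N <= 2^-1.
Proof.
move=> N2; have c2 : 2 <= C N by rewrite ler_nat; have := C_N_ge ainc (ltnW N2); lia.
rewrite ler_pdivrMr; last lra.
by apply: (@le_trans _ _ 1); [rewrite ge_min lexx | lra].
Qed.

Lemma newdiffs_lab N M d : (1 <= N)%N -> d \in newdiffs a N M ->
  [/\ (N < lab a d)%N, (lab a d <= M)%N, d \in D (lab a d) & (0 < d)%N].
Proof.
move=> N1; rewrite mem_newdiffs => /andP[dN dM]; have [dl lM] := labP dM.
by split => //; [exact: lab_gt dM dN | exact: posdiffs_gt0 dM].
Qed.

Lemma size_newdiffs_le N M : (1 <= M)%N -> (size (newdiffs a N M) <= C_N a M)%N.
Proof.
move=> M1; rewrite (C_N_posdiffs a M1); apply: leq_trans (_ : size (D M) <= _)%N; last by lia.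
by rewrite size_filter count_size.
Qed.

Lemma sum_newdiffs_cat (g : nat -> R) N P M : (N <= P)%N -> (P <= M)%N ->
  \sum_(d <- newdiffs a N M) g d = \sum_(d <- newdiffs a N P) g d + \sum_(d <- newdiffs a P M) g d.
Proof.
move=> NP PM; have h1 := sum_posdiffs_split a g (leq_trans NP PM).
have h2 := sum_posdiffs_split a g NP; have h3 := sum_posdiffs_split a g PM; lra.
Qed.

(** From C_N <= N^2 and C_(N^4) >= N^4: a stretch up to the fourth power captures at least half of
    log C, while log changes only by a factor 4 and log log by a bounded amount. *)
Lemma C_pow4 N : (1 <= N)%N -> 2 * ln N%:R <= ln (C (N ^ 4)) - ln (C N) /\ ln (C (N ^ 4)) <= 2 * (ln (C (N ^ 4)) - ln (C N)).
Proof.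
move=> N1; have N4 : (1 <= N ^ 4)%N by rewrite expn_gt0 N1.
have NR : 0 < N%:R :> R by rewrite ltr0n.
have c0 := C_gt0 N1.
have h1 : ln (C N) <= 2 * ln N%:R.
  rewrite mulr_natl -lnXn // ler_ln ?posrE ?exprn_gt0 // -natrX ler_nat; exact: (C_N_le ainc).
have h2 : 4 * ln N%:R <= ln (C (N ^ 4)).
  rewrite mulr_natl -lnXn // ler_ln ?posrE ?exprn_gt0 // -?natrX ?ler_nat ?ltr0n; have := C_N_ge ainc N4; lia.
lra.
Qed.

Definition big_union (S : seq nat) (Q : seq nat) (psi : nat -> R) : set R :=
  \big[setU/set0]_(d <- S) arcs Q psi d.

(** Every difference has mass at least [m0] and the total is at most [C M], so [m0 / C M] can serve
    as [rho]. *)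
Lemma block_apply (eps0 : R) : 0 < eps0 ->
  (forall (Y : nat) (S : seq nat) (psi : nat -> R) (rho s : R),
  let Q := primes_upto Y in
  let M := massS Q S psi xpredT in
  (0 < Y)%N -> uniq S -> all (fun v => (0 < v)%N) S ->
  (forall v, 0 <= psi v) -> (forall v, psi v <= 2^-1) -> 0 <= rho ->
  0 < s -> s <= eps0 -> s <= M -> (forall v, v \in S -> rho * M <= mu Q psi v) ->
  4096 <= rho ^+ 2 * Y%:R -> 4 * (size S)%:R ^+ 2 <= Y%:R * s ->
  ((s / 2)%:E <= @lebesgue_measure R (\big[setU/set0]_(d <- S) arcs Q psi d))%E) ->
  forall (N M Y : nat) (h : nat -> R) (m0 s : R), (1 <= N)%N -> (N <= M)%N -> (0 < Y)%N ->
  (forall n, (N < n <= M)%N -> 0 <= h n <= tau n) -> 0 < m0 -> 0 < s -> s <= eps0 ->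
  (forall d, d \in newdiffs a N M -> m0 <= h (lab a d) * phi_ratio (primes_upto Y) d) ->
  s <= \sum_(d <- newdiffs a N M) h (lab a d) * phi_ratio (primes_upto Y) d ->
  4096 * C M ^+ 2 <= m0 ^+ 2 * Y%:R -> 4 * C M ^+ 2 <= Y%:R * s ->
  exists Q S psi, [/\ forall d, d \in S -> (N < lab a d)%N /\ d \in D (lab a d),
    forall d, d \in S -> psi d <= tau (lab a d) &
    ((s / 2)%:E <= @lebesgue_measure R (big_union S Q psi))%E].
Proof.
move=> e0 B N M Y h m0 s N1 NM Y0 hb m00 s0 se mlow smass c1 c2.
pose S := newdiffs a N M; pose Q := primes_upto Y.
pose psi d := if d \in S then h (lab a d) else 0.
have M1 : (1 <= M)%N by apply: leq_trans NM.
have cM := C_gt0 M1.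
have hS d : d \in S -> 0 <= h (lab a d) <= tau (lab a d).
  by move=> dS; have [l1 l2 _ _] := newdiffs_lab N1 dS; rewrite hb // l1.
have psi0 v : 0 <= psi v by rewrite /psi; case: ifP => // /hS /andP[].
have psi2 v : psi v <= 2^-1.
  rewrite /psi; case: ifP => [vS|_]; last by rewrite invr_ge0.
  have /andP[_ h2] := hS v vS; apply: (le_trans h2); apply: tau_le.
  by have [l1 _ _ _] := newdiffs_lab N1 vS; apply: leq_ltn_trans N1 l1.
have muE d : d \in S -> mu Q psi d = h (lab a d) * phi_ratio Q d by move=> dS; rewrite /mu /psi dS.
have massE : massS Q S psi xpredT = \sum_(d <- S) h (lab a d) * phi_ratio Q d.
  by apply: eq_big_seq => d dS; exact: muE.
have pQ := prime_primes_upto Y.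
have massC : massS Q S psi xpredT <= C M.
  apply: (@le_trans _ _ (\sum_(d <- S) 1)).
    apply: ler_sum => d _; rewrite /mu; apply: (@le_trans _ _ (1 * 1)); last by rewrite mulr1.
    apply: ler_pM => //; first exact/ltW/phi_ratio_gt0.
      by apply: le_trans (psi2 d) _; lra.
    exact: phi_ratio_le1.
  by rewrite big_const_seq count_predT iter_addr_0 ler_nat size_newdiffs_le.
exists Q, S, psi; split.
- by move=> d dS; have [l1 _ l3 _] := newdiffs_lab N1 dS.
- by move=> d dS; rewrite /psi dS; have /andP[] := hS d dS.
apply: (B Y S psi (m0 / C M) s) => //.
- by rewrite filter_uniq ?uniq_posdiffs.
- by apply/allP => d dS; have [] := newdiffs_lab N1 dS.
- by rewrite divr_ge0 // ltW.
- by rewrite massE.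
- move=> v vS; rewrite muE //; apply: le_trans (mlow v vS).
  rewrite -mulrA ler_piMr ?(ltW m00) // mulrC ler_pdivrMr // mul1r //.
- by rewrite expr_div_n mulrAC ler_pdivlMr // exprn_gt0.
apply: le_trans c2; rewrite ler_wpM2l // lerXn2r ?nnegrE ?(ltW cM) // ler_nat.
exact: size_newdiffs_le.
Qed.

Theorem arcs_lower_bound : exists s : R, 0 < s /\ forall n0 : nat,
  exists Q S psi, [/\ forall d, d \in S -> (n0 <= lab a d)%N /\ d \in D (lab a d),
    forall d, d \in S -> psi d <= tau (lab a d) &
    (s%:E <= @lebesgue_measure R (big_union S Q psi))%E].
Proof.
have [eps0 [e0 B]] := block_theorem R; have {B}BA := block_apply e0 B.
have mono_n0 n0 N s : (n0 <= N)%N ->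
  (exists Q S psi, [/\ forall d, d \in S -> (N < lab a d)%N /\ d \in D (lab a d),
    forall d, d \in S -> psi d <= tau (lab a d) &
    (s%:E <= @lebesgue_measure R (big_union S Q psi))%E]) ->
  exists Q S psi, [/\ forall d, d \in S -> (n0 <= lab a d)%N /\ d \in D (lab a d),
    forall d, d \in S -> psi d <= tau (lab a d) &
    (s%:E <= @lebesgue_measure R (big_union S Q psi))%E].
  move=> nN [Q [S [psi [h1 h2 h3]]]]; exists Q, S, psi; split => // d /h1 [l dl].
  by split => //; apply: ltnW (leq_ltn_trans nN l).
have Cpos := C_gt0.
have [often|rare] := pselect (forall n0, exists2 N, (n0 <= N)%N & 1 <= theta N).
  (* The mass of one stretch: (ln X) / 12 from [block_sum_ge], 1/12 from [h], and e^(-6) / (8 ln X)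
     from the sieved numerators. *)
  pose sA : R := expR (- 6) / (96 * 12).
  have sA0 : 0 < sA by rewrite divr_gt0 ?expR_gt0.
  pose s := Num.min sA eps0; have s0 : 0 < s by rewrite lt_min sA0.
  have se : s <= eps0 by rewrite ge_min lexx orbT.
  exists (s / 2); split=> [|n0]; first by rewrite divr_gt0.
  pose K : R := 64 * (96 * expR 6) + 4 / s.
  have [N NK thN] := often (maxn n0 (Num.trunc K).+2).
  have [n0N KN] : (n0 <= N)%N /\ ((Num.trunc K).+2 <= N)%N by move: NK; rewrite geq_max => /andP[].
  have K0 : 0 <= K by rewrite addr_ge0 ?divr_ge0 ?mulr_ge0 ?expR_ge0 // ltW.
  have N1 : (1 < N)%N by apply: leq_trans KN.
  have N4 : (N <= N ^ 4)%N by rewrite -{1}(expn1 N) leq_exp2l.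
  apply: mono_n0 n0N _; set X := C_N a (N ^ 4).
  have XN : (N <= X)%N.
    by apply: (leq_trans N4); apply: C_N_ge_self; exact: leq_trans (ltnW N1) N4.
  have KX : K <= X%:R.
    have /andP[_ /ltW h] := truncn_itv K0; apply: (le_trans h); rewrite ler_nat.
    by apply: leq_trans XN; apply: ltnW.
  have XR : 0 < X%:R :> R by rewrite ltr0n (leq_trans _ XN) // ltnW.
  have X1 : 1 <= X%:R :> R by rewrite ler1n (leq_trans _ XN) // ltnW.
  have lnX : 0 < ln X%:R :> R by rewrite ln_gt0 // ltr1n (leq_trans N1).
  have lnXX : ln X%:R <= X%:R :> R by have := ln_le_sub1 XR; lra.
  (* The cutoff is a power of [X], so ln Y is comparable to the mass ln X. The exponent 8 exceeds
     the order 6 of 4096 X^2 / m0^2, as [m0] is of order X^(-2). *)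
  have Y1 : (1 < X ^ 8)%N by rewrite -(exp1n 8) ltn_exp2r // (leq_trans N1).
  have lnY : ln (X ^ 8)%:R = 8 * ln X%:R :> R by rewrite natrX lnXn // -[ln _ *+ _]mulr_natl.
  have e6 := expR_gt0 (- 6 : R).
  have phiY d : expR (- 6) / (8 * ln X%:R) <= phi_ratio (primes_upto (X ^ 8)) d :> R.
    by rewrite -lnY; apply: phi_ratio_upto_ge.
  (* Up to N^4, [Log] grows at most by a factor 4 and [Log2] by a factor 3, so 1 <= theta N gives
     1/12 <= theta n. *)
  pose h n : R := (12 * C n)^-1; pose m0 : R := expR (- 6) / (96 * X%:R ^+ 2).
  apply: (BA N (N ^ 4)%N (X ^ 8)%N h m0 s) => //; rewrite ?expn_gt0 ?(ltnW Y1) //; try exact: ltnW.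
  - by rewrite (leq_trans _ XN) // ltnW.
  - move=> n /andP[Nn nN4]; have n1 : (1 <= n)%N by apply: leq_trans Nn.
    have c0 := Cpos n n1; rewrite /h invr_ge0 mulr_ge0 ?(ltW c0) //= /tau invfM ler_wpM2r ?invr_ge0 ?(ltW c0) //.
    rewrite le_min; apply/andP; split; first lra.
    have l1 := Log_pow4 R n1 nN4; have l2 := Log2_pow4 R n1 nN4.
    have g1 := Log_ge1 (N%:R : R); have g2 := Log2_ge1 (N%:R : R).
    have g3 := Log_ge1 (n%:R : R); have g4 := Log2_ge1 (n%:R : R).
    have aN : Log2 (a N)%:R <= Log2 (a n)%:R :> R.
      by apply: Log2_mono; rewrite ?ltr0n ?ler_nat ?apos ?a_mono ?(ltnW N1) // ltnW.
    move: thN; rewrite /theta !ler_pdivlMr ?mulr_gt0 ?Log_gt0 ?Log2_gt0 //.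
    move: l1 l2 g1 g2 g3 g4 aN; move: (Log N%:R) (Log2 N%:R) (Log n%:R) (Log2 n%:R) (Log2 (a N)%:R) (Log2 (a n)%:R).
    move=> A1 A2 B1 B2 T1 T2 l1 l2 g1 g2 g3 g4 TT; rewrite mul1r => thN.
    have l3 : B2 <= 3 * A2 by clear -l2 g2; lra.
    have := ler_pM (le_trans ler01 g3) (le_trans ler01 g4) l1 l3.
    by clear -thN TT; lra.
  - by rewrite /m0 divr_gt0 ?mulr_gt0 ?exprn_gt0.
  - move=> d /(newdiffs_lab (ltnW N1)) [l1 l2 _ _]; have c0 := Cpos _ (leq_trans (ltnW N1) (ltnW l1)).
    have cX : C (lab a d) <= X%:R by rewrite ler_nat; apply: (C_N_mono ainc) => //; exact: leq_trans (ltnW N1) (ltnW l1).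
    apply: (@le_trans _ _ ((12 * X%:R)^-1 * (expR (- 6) / (8 * X%:R)))).
      rewrite le_eqVlt; apply/orP; left; apply/eqP; rewrite /m0; field; exact: lt0r_neq0.
    apply: ler_pM; rewrite ?invr_ge0 ?mulr_ge0 ?divr_ge0 ?invr_ge0 ?mulr_ge0 ?(ltW e6) ?(ltW XR) //.
      by rewrite /h lef_pV2 ?posrE ?mulr_gt0 // ler_wpM2l.
    apply: le_trans (phiY d); rewrite ler_wpM2l ?(ltW e6) // lef_pV2 ?posrE ?mulr_gt0 // ler_wpM2l //.
  - apply: (@le_trans _ _ sA); first by rewrite ge_min lexx.
    apply: (@le_trans _ _ (\sum_(d <- newdiffs a N (N ^ 4)) (C (lab a d))^-1 * (12^-1 * (expR (- 6) / (8 * ln X%:R))))); last first.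
      rewrite big_seq [leRHS]big_seq; apply: ler_sum => d dS.
      have -> : h (lab a d) = (C (lab a d))^-1 * 12^-1 by rewrite /h invfM mulrC.
      by rewrite -(mulrA (C _)^-1) ler_wpM2l ?invr_ge0 // ler_wpM2l ?invr_ge0.
    rewrite -mulr_suml; have := block_sum_ge ainc R (ltnW N1) N4.
    have [_] := C_pow4 (ltnW N1); rewrite -/X => hX hS.
    have {}hS : ln X%:R / 12 <= \sum_(d <- newdiffs a N (N ^ 4)) (C (lab a d))^-1 by lra.
    have w0 : 0 <= 12^-1 * (expR (- 6) / (8 * ln X%:R)) :> R.
      by rewrite mulr_ge0 ?invr_ge0 ?divr_ge0 ?mulr_ge0 ?(ltW e6) ?(ltW lnX).
    apply: le_trans (ler_wpM2r w0 hS); rewrite le_eqVlt; apply/orP; left; apply/eqP.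
    by rewrite /sA; field; exact: lt0r_neq0.
  - have KX1 : 64 * (96 * expR 6) <= X%:R :> R.
      by apply: le_trans KX; rewrite lerDl divr_ge0 // ltW.
    rewrite natrX /m0 expRN.
    have -> : ((expR 6)^-1 / (96 * X%:R ^+ 2)) ^+ 2 * X%:R ^+ 8 = X%:R ^+ 2 * (X%:R / (96 * expR 6)) ^+ 2 :> R.
      by field; rewrite lt0r_neq0 ?expR_gt0 //= lt0r_neq0.
    rewrite mulrC ler_wpM2l ?exprn_ge0 ?(ltW XR) //.
    have -> : 4096 = 64 ^+ 2 :> R by rewrite -natrX.
    by rewrite lerXn2r ?nnegrE ?divr_ge0 ?mulr_ge0 ?expR_ge0 ?(ltW XR) // ler_pdivlMr ?mulr_gt0 ?expR_gt0.
  - have sX : 4 <= X%:R * s.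
      rewrite -ler_pdivrMr //; apply: le_trans KX; rewrite lerDr ?mulr_ge0 ?expR_ge0 //.
    rewrite natrX (_ : X%:R ^+ 8 * s = (X%:R * s) * X%:R ^+ 5 * X%:R ^+ 2); last by ring.
    rewrite ler_wpM2r ?exprn_ge0 ?(ltW XR) //; apply: (le_trans sX).
    by rewrite ler_peMr ?mulr_ge0 ?(ltW XR) ?(ltW s0) // exprn_ege1.
have [n1 rare1] : exists n1, forall N, (n1 <= N)%N -> theta N < 1.
  apply: contrapT => H; apply: rare => n0; apply: contrapT => H2; apply: H; exists n0 => N nN.
  by rewrite ltNge; apply/negP => th; apply: H2; exists N.
exists (eps0 / 2); split=> [|n0]; first by rewrite divr_gt0.
pose N0 := maxn n0 (maxn n1 16).
apply: (@mono_n0 n0 N0); first exact: leq_maxl.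
have N16 : (16 <= N0)%N by rewrite /N0 !leq_max leqnn !orbT.
have n1N : (n1 <= N0)%N by rewrite /N0 !leq_max leqnn !orbT.
pose blk j := iter j (fun n => n ^ 4)%N N0.
have blk_ge j : (N0 <= blk j)%N.
  elim: j => // j IH; apply: (leq_trans IH); rewrite /= -{1}(expn1 (blk j)) leq_exp2l //.
  by apply: leq_trans IH; apply: leq_trans N16.
pose w d : R := (C (lab a d) * (Log (lab a d)%:R * Log2 (lab a d)%:R))^-1.
(* The stretch beginning at [blk j] has mass at least 1 / (36 Log2 (blk j)), and [Log2 (blk j)] is
   at most (Log2 N0 + 2)(j + 1). *)
pose c : R := (36 * (Log2 N0%:R + 2))^-1.
have L20 := Log2_ge1 (N0%:R : R).
have c0 : 0 < c by rewrite invr_gt0; lra.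
have L2blk j : Log2 (blk j)%:R <= Log2 N0%:R + 2 * j%:R :> R.
  elim: j => [|j IH]; first by rewrite mulr0 addr0.
  have b0 : (0 < blk j.+1)%N by apply: leq_trans (blk_ge _); apply: leq_trans N16.
  by have := Log2_pow4 R b0 (leqnn _); rewrite -/(blk j) -natr1; lra.
have mass J : c * \sum_(j <- iota 0 J) (j.+1%:R)^-1 <= \sum_(d <- newdiffs a N0 (blk J)) w d.
  elim: J => [|J IH].
    rewrite big_nil mulr0; apply: sumr_ge0 => d _.
    by rewrite invr_ge0 !mulr_ge0 // ltW ?Log_gt0 ?Log2_gt0.
  have bb : (blk J <= blk J.+1)%N.
    by rewrite /= -{1}(expn1 (blk J)) leq_exp2l //; apply: leq_trans (blk_ge J); apply: leq_trans N16.
  rewrite (sum_newdiffs_cat _ (blk_ge J) bb) -[X in iota 0 X]addn1 iotaD big_cat big_seq1 add0n mulrDr.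
  apply: lerD IH _; set N := blk J in bb *.
  have N1 : (16 <= N)%N by apply: leq_trans (blk_ge J).
  have Np : (1 <= N)%N by apply: leq_trans N1.
  have lnN : Log N%:R = ln N%:R :> R.
    rewrite /Log max_r // -[leLHS](expRK (1 : R)) ler_ln ?posrE ?expR_gt0 ?ltr0n //.
    apply: (@le_trans _ _ 3); first exact: expR1_le3.
    by rewrite ler_nat (leq_trans _ N1).
  have g1 := Log_ge1 (N%:R : R); have g2 := Log2_ge1 (N%:R : R).
  set u : R := (12 * (Log N%:R * Log2 N%:R))^-1.
  have u0 : 0 < u by rewrite invr_gt0 mulr_gt0 // mulr_gt0; lra.
  apply: (@le_trans _ _ (\sum_(d <- newdiffs a N (blk J.+1)) (C (lab a d))^-1 * u)); last first.
    rewrite big_seq [leRHS]big_seq; apply: ler_sum => d /(newdiffs_lab Np) [l1 l2 _ _].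
    have l0 : (0 < lab a d)%N by apply: leq_ltn_trans l1.
    rewrite /w invfM ler_wpM2l ?invr_ge0 // lef_pV2 ?posrE ?mulr_gt0 ?Log_gt0 ?Log2_gt0 //.
    rewrite (_ : 12 * (Log N%:R * Log2 N%:R) = (4 * Log N%:R) * (3 * Log2 N%:R)); last by ring.
    apply: ler_pM; rewrite ?(ltW (Log_gt0 _)) ?(ltW (Log2_gt0 _)) ?Log_pow4 //.
    by have := Log2_pow4 R l0 l2; lra.
  rewrite -mulr_suml; have hS := block_sum_ge ainc R Np bb; have [hX _] := C_pow4 Np.
  have {}hS : ln N%:R / 3 <= \sum_(d <- newdiffs a N (blk J.+1)) (C (lab a d))^-1.
    by apply: le_trans hS; move: hX; rewrite -/N /= -/(blk J) -/N; lra.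
  apply: le_trans (ler_wpM2r (ltW u0) hS).
  have -> : ln N%:R / 3 * u = (36 * Log2 N%:R)^-1 :> R.
    rewrite /u lnN; have z1 : ln N%:R != 0 :> R by rewrite -lnN lt0r_neq0 ?Log_gt0.
    have z2 : Log2 N%:R != 0 :> R by rewrite lt0r_neq0 ?Log2_gt0.
    by field; rewrite ?z1 ?z2.
  have p1 : 0 < 36 * (Log2 N0%:R + 2) * J.+1%:R :> R by apply: mulr_gt0; [lra | rewrite ltr0n].
  have p2 : 0 < 36 * Log2 N%:R :> R by rewrite mulr_gt0 ?Log2_gt0.
  rewrite /c -invfM lef_pV2 ?posrE //.
  rewrite -mulrA ler_wpM2l //; have := L2blk J; rewrite -/N -natr1.
  have : 0 <= J%:R :> R by []. nra.
have [J HJ] := harmonic_unbounded (3 * expR 10 * eps0 / c).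
set M := blk J; have NM : (N0 <= M)%N by exact: blk_ge.
have N0p : (1 <= N0)%N by apply: leq_trans N16.
have M1 : (1 <= M)%N by apply: leq_trans NM.
have massM : 3 * expR 10 * eps0 <= \sum_(d <- newdiffs a N0 M) w d.
  by apply: le_trans (mass J); rewrite [leRHS]mulrC -ler_pdivrMr.
(* Here [theta] is not truncated: its numerator [Log2 (a (lab d))] dominates the [Log2 d] lost by
   [phi_ratio_ge]. The bound is uniform in [Y], so [Y] can be chosen after [M]. *)
have thw d : d \in newdiffs a N0 M -> forall Y,
    w d * (expR (- 10) / 3) <= tau (lab a d) * phi_ratio (primes_upto Y) d.
  move=> /(newdiffs_lab N0p) [l1 l2 dl d0] Y.
  have tE : tau (lab a d) = w d * Log2 (a (lab a d))%:R.
    rewrite /tau min_r; last by apply/ltW/rare1; apply: leq_trans n1N (ltnW l1).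
    by rewrite /theta /w [in RHS]invfM; ring.
  have ph := phi_ratio_ge R (prime_primes_upto Y) (uniq_primes_upto Y) d0.
  have w0 : 0 <= w d by rewrite invr_ge0 !mulr_ge0 // ltW ?Log_gt0 ?Log2_gt0.
  rewrite tE -mulrA ler_wpM2l //.
  have la := Log2_gt0 ((a (lab a d))%:R : R).
  apply: le_trans (ler_wpM2l (ltW la) ph).
  have ld : Log2 d%:R <= Log2 (a (lab a d))%:R :> R.
    by apply: Log2_mono; rewrite ?ltr0n // ler_nat; apply: (posdiffs_le ainc).
  have ld0 := Log2_gt0 (d%:R : R).
  have -> : Log2 (a (lab a d))%:R * (expR (- 10) / (3 * Log2 d%:R)) =
     expR (- 10) / 3 * (Log2 (a (lab a d))%:R / Log2 d%:R) :> R by rewrite invfM; ring.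
  rewrite ler_peMr ?divr_ge0 ?expR_ge0 //.
  by rewrite ler_pdivlMr // mul1r.
pose m0 : R := (C M * (Log M%:R * Log2 M%:R))^-1 * (expR (- 10) / 3).
have CM := Cpos M M1.
have m00 : 0 < m0 by rewrite mulr_gt0 ?invr_gt0 ?divr_gt0 ?expR_gt0 // !mulr_gt0 // ?Log_gt0 ?Log2_gt0.
pose Y := (Num.trunc (4096 * C M ^+ 2 / m0 ^+ 2 + 4 * C M ^+ 2 / eps0)).+1.
have t1 : 0 <= 4096 * C M ^+ 2 / m0 ^+ 2.
  by apply: divr_ge0; [apply: mulr_ge0; [exact: ler0n | exact: exprn_ge0 (ltW CM)] | exact: exprn_ge0 (ltW m00)].
have t2 : 0 <= 4 * C M ^+ 2 / eps0.
  by apply: divr_ge0; [apply: mulr_ge0; [exact: ler0n | exact: exprn_ge0 (ltW CM)] | exact: ltW].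
have Yge : 4096 * C M ^+ 2 / m0 ^+ 2 + 4 * C M ^+ 2 / eps0 <= Y%:R.
  by apply: ltW; have /andP[] := truncn_itv (addr_ge0 t1 t2).
apply: (BA N0 M Y tau m0 eps0) => //.
- by move=> n /andP[nN _]; rewrite lexx andbT divr_ge0 // le_min ler01 (ltW (theta_gt0 n)).
- move=> d dS; apply: le_trans (thw d dS Y); rewrite ler_wpM2r ?divr_ge0 ?expR_ge0 //.
  have [l1 l2 _ _] := newdiffs_lab N0p dS.
  have l0 : (0 < lab a d)%N by apply: leq_ltn_trans l1.
  rewrite lef_pV2 ?posrE ?mulr_gt0 ?Log_gt0 ?Log2_gt0 ?Cpos //.
  apply: ler_pM; rewrite ?ler_nat ?(C_N_mono ainc) ?mulr_ge0 ?(ltW (Log_gt0 _)) ?(ltW (Log2_gt0 _)) //.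
  apply: ler_pM; rewrite ?(ltW (Log_gt0 _)) ?(ltW (Log2_gt0 _)) //.
    by apply: Log_mono; rewrite ?ltr0n ?ler_nat.
  by apply: Log2_mono; rewrite ?ltr0n ?ler_nat.
- apply: le_trans (_ : _ <= \sum_(d <- newdiffs a N0 M) w d * (expR (- 10) / 3)) _; last first.
    by rewrite big_seq [leRHS]big_seq; apply: ler_sum => d dS; exact: thw.
  rewrite -mulr_suml; apply: le_trans (ler_wpM2r _ massM); last by rewrite divr_ge0 ?expR_ge0.
  rewrite expRN le_eqVlt; apply/orP; left; apply/eqP; field.
  by rewrite lt0r_neq0 ?expR_gt0.
- by rewrite [leRHS]mulrC -ler_pdivrMr ?exprn_gt0 //; apply: le_trans Yge; rewrite lerDl.
by rewrite -ler_pdivrMr //; apply: le_trans Yge; rewrite lerDr.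
Qed.

End LowerBound.

(** * Density points and the zero-one law *)

Section LebesgueFacts.
Variable R : realType.
Local Notation lam := (@lebesgue_measure R).

(** [A] has density zero at [x]; the balls are measured by their radius. *)
Definition thin_at (A : set R) (x : R) : Prop :=
  forall e : R, 0 < e -> exists2 del : R, 0 < del &
    forall r, 0 < r < del -> (lam (A `&` ball x r) <= (e * r)%:E)%E.

Lemma thin_complement (A : set R) : measurable A ->
  {ae lam, forall x, ~ A x -> thin_at A x}.
Proof.
move=> mA; have := lebesgue_density mA; apply: filterS; first exact: (ae_filter_ringOfSetsType lam).
move=> x cx nAx e e0.
move: cx; rewrite indicE memNset // => /fine_cvgP[_ cx].
have [del /= del0 H] := cvgr_lt _ cx _ (divr_gt0 e0 (ltr0n R 2)).
exists del => // r /andP[r0 rdel].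
have /= := H r _ r0; rewrite sub0r normrN gtr0_norm // => /(_ rdel).
rewrite lebesgue_measure_ball ?(ltW r0) //.
have fin : lam (A `&` ball x r) \is a fin_num.
  rewrite ge0_fin_numE //; apply: (@le_lt_trans _ _ (lam (ball x r))).
    by apply: le_measure; rewrite ?inE //; [apply: measurableI => //|]; exact: measurable_realfun.measurable_ball.
  by rewrite lebesgue_measure_ball ?(ltW r0) // ltry.
have lamE : lam (A `&` ball x r) = (fine (lam (A `&` ball x r)))%:E by rewrite fineK.
rewrite lamE; move: (fine (lam (A `&` ball x r))) => X.
have r2 : 0 < r *+ 2 by rewrite pmulrn_lgt0.
rewrite inver gt_eqF //= lee_fin ltr_pdivrMr //.
by rewrite (_ : e / 2 * (r *+ 2) = e * r) ?[r *+ 2]mulr2n; [exact: ltW | field].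
Qed.

Lemma lebesgue_null_sub (A B : set R) : measurable A -> measurable B -> lam B = 0%E -> A `<=` B -> lam A = 0%E.
Proof.
move=> mA mB B0 AB; apply/eqP; rewrite eq_le measure_ge0 andbT -B0.
by apply: le_measure; rewrite ?inE.
Qed.

Lemma measurable_affine (M b : R) : measurable_fun setT (fun x : R => M * x + b).
Proof.
by apply: measurable_realfun.measurable_funD => //; apply: measurable_realfun.measurable_funM.
Qed.

(** The right-hand side is a measure agreeing with Lebesgue measure on half-open intervals, so
    uniqueness applies. *)
Lemma lebesgue_affine (M b : R) (A : set R) : 0 < M -> measurable A ->
  lam A = (M%:E * lam ((fun x => M * x + b)%R @^-1` A))%E.
Proof.
move=> M0 mA; pose f : R -> measurableTypeR R := fun x => M * x + b.
have mf : measurable_fun setT f by exact: measurable_affine.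
pose nu := mscale (NngNum (ltW M0)) (pushforward lam f).
suff H : forall X, ocitv X -> lam X = nu mf X by exact: (lebesgue_measure_unique H mA).
move=> _ [[u v] _ <-] /=; rewrite /nu /mscale /= /pushforward.
have -> : f @^-1` [set` `]u, v]] = [set` `](u - b) / M, (v - b) / M]].
  apply/seteqP; split => x /=; rewrite !in_itv /= /f => /andP[h1 h2].
    by rewrite ltr_pdivrMr // ler_pdivlMr // ltrBlDr lerBrDr mulrC h1 h2.
  by move: h1 h2; rewrite ltr_pdivrMr // ler_pdivlMr // ltrBlDr lerBrDr mulrC => -> ->.
rewrite !lebesgue_measure_itv /= !lte_fin ltr_pM2r ?invr_gt0 // ltrD2r.
case: ifP => _; last by rewrite mule0.
by rewrite -!EFinB -EFinM; congr EFin; field; exact: lt0r_neq0.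
Qed.

End LebesgueFacts.

Section LimsupSets.
Variables (R : realType) (D : nat -> seq nat) (tau : nat -> R).
Local Notation lam := (@lebesgue_measure R).
Hypothesis Dpos : forall N d, d \in D N -> (0 < d)%N.
Hypothesis tau_gt0 : forall N d, d \in D N -> 0 < tau N.
Hypothesis tau_cvg0 : forall e : R, 0 < e -> exists n, forall N d, (n <= N)%N -> d \in D N -> tau N < e.

Definition near_int (d : nat) (t : R) : set R :=
  [set x | exists p : int, `|d%:R * x - p%:~R| <= t].

(** A difference is tested at every later stage as well, not only where it first occurs. *)
Definition some_close (c : R) (n : nat) : set R :=
  [set x | exists N d, [/\ (n <= N)%N, d \in D N & near_int d (c * tau N) x]].

Definition often_close (c : R) : set R := [set x | forall n, some_close c n x].

Lemma measurable_near_int d t : (0 < d)%N -> measurable (near_int d t).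
Proof.
move=> d0; have dR : 0 < d%:R :> R by rewrite ltr0n.
have -> : near_int d t = \bigcup_(p : int) [set` `[(p%:~R - t) / d%:R, (p%:~R + t) / d%:R]].
  apply/seteqP; split => x /=.
    move=> [p hp]; exists p => //=; rewrite in_itv /= ler_pdivrMr // ler_pdivlMr //.
    by move: hp; rewrite ler_norml mulrC => /andP[h1 h2]; apply/andP; split; lra.
  move=> [p _] /=; rewrite in_itv /= ler_pdivrMr // ler_pdivlMr // => /andP[h1 h2].
  by exists p; rewrite ler_norml mulrC; apply/andP; split; lra.
by apply: countable_bigcupT_measurable => // p; exact: measurable_itv.
Qed.

Lemma some_closeE c n : some_close c n =
  \bigcup_(N in [set N | (n <= N)%N]) \bigcup_(d in [set d | d \in D N]) near_int d (c * tau N).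
Proof.
apply/seteqP; split => x /=.
  by move=> [N [d [nN dN xd]]]; exists N => //; exists d.
by move=> [N nN [d dN xd]]; exists N, d.
Qed.

Lemma measurable_some_close c n : measurable (some_close c n).
Proof.
rewrite some_closeE; apply: bigcup_measurable => N _; apply: bigcup_measurable => d /= dN.
by apply: measurable_near_int; exact: Dpos dN.
Qed.

Lemma often_closeE c : often_close c = \bigcap_n some_close c n.
Proof. by apply/seteqP; split => x /= h n; [move=> _|]; apply: h. Qed.

Lemma measurable_often_close c : measurable (often_close c).
Proof. by rewrite often_closeE; apply: bigcapT_measurable => n; exact: measurable_some_close. Qed.

Lemma often_close_shift c (k : int) x : often_close c (x + k%:~R) -> often_close c x.
Proof.
move=> h n; have [N [d [nN dN [p hp]]]] := h n; exists N, d; split => //.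
exists (p - d%:Z * k); move: hp.
by rewrite rmorphB rmorphM /= mulrDr -addrA (_ : d%:Z%:~R = d%:R) // opprB.
Qed.

Lemma often_close_scale c (M : nat) x : often_close c x -> often_close (M%:R * c) (M%:R * x).
Proof.
move=> h n; have [N [d [nN dN [p hp]]]] := h n; exists N, d; split => //.
exists (M%:Z * p); rewrite rmorphM /= (_ : M%:Z%:~R = M%:R) // mulrCA -mulrBr normrM ger0_norm //.
by rewrite -mulrA ler_wpM2l.
Qed.

(* If x is c-close infinitely often but avoids [some_close 1 n], that union still fills a fixed proportion of
   arbitrarily small balls around x, which fails for almost every such x. *)
Lemma cassels c : 1 <= c -> {ae lam, forall x, often_close c x -> often_close 1 x}.
Proof.
move=> c1; have c0 : 0 < c by apply: lt_le_trans c1.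
have H n : {ae lam, forall x, ~ some_close 1 n x -> thin_at (some_close 1 n) x}.
  by apply: thin_complement; exact: measurable_some_close.
have := ae_foralln H; apply: negligibleS => x /= nW thin.
apply: nW => xc n; apply: contrapT => nx.
have e0 : 0 < (6 * c)^-1 by rewrite invr_gt0 mulr_gt0.
have [del del0 hdel] := thin n nx _ e0.
have [n1 hn1] := tau_cvg0 (divr_gt0 del0 (mulr_gt0 (ltr0n _ 3) c0) : 0 < del / (3 * c)).
have [N [d [nN dN [p hp]]]] := xc (maxn n n1).
move: nN; rewrite geq_max => /andP[nN n1N].
have d0 := Dpos dN; have dR : 0 < d%:R :> R by rewrite ltr0n.
have d1 : 1 <= d%:R :> R by rewrite ler1n.
have t0 := tau_gt0 dN; set t := tau N in t0 hp.
have tdel : t < del / (3 * c) by exact: hn1 n1N dN.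
(* The interval [J] of half-width t/d around the fraction lies in the union, and inside the ball
   because (c + 1) t <= 2 c t < 3 c t. Its length 2t/d exceeds r / (6c) = t / (2d), contradicting
   thinness. *)
pose r := 3 * (c * t / d%:R).
have ct : 0 < c * t by rewrite mulr_gt0.
have r0 : 0 < r by rewrite !mulr_gt0 ?invr_gt0.
have rdel : r < del.
  apply: (@le_lt_trans _ _ (3 * (c * t))); first by rewrite ler_wpM2l // ler_pdivrMr // ler_peMr // ltW.
  by move: tdel; rewrite ltr_pdivlMr ?mulr_gt0 // mulrC mulrA.
have := hdel r; rewrite r0 rdel => /(_ isT); apply/negP; rewrite -ltNge.
pose J : set R := [set` `[(p%:~R - t) / d%:R, (p%:~R + t) / d%:R]].
apply: (@lt_le_trans _ _ (lam J)).
  rewrite lebesgue_measure_itv /= lte_fin ltr_pM2r ?invr_gt0 //.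
  rewrite (_ : (p%:~R - t < p%:~R + t) = true); last by lra.
  rewrite -EFinB lte_fin /r; rewrite (_ : _ - _ = 2 * (t / d%:R)); last by ring.
  rewrite (_ : (6 * c)^-1 * _ = (t / d%:R) / 2); last by field; rewrite !lt0r_neq0.
  have : 0 < t / d%:R by rewrite divr_gt0.
  by move: (t / d%:R) => u; lra.
apply: le_measure; rewrite ?inE; first exact: measurable_itv.
  by apply: measurableI; [exact: measurable_some_close | exact: measurable_realfun.measurable_ball].
move=> y; rewrite /J /= in_itv /= ler_pdivrMr // ler_pdivlMr // => /andP[y1 y2]; split.
  exists N, d; split => //; exists p; rewrite mul1r -/t ler_norml mulrC; apply/andP; split; lra.
have hy : `|d%:R * y - p%:~R| <= t by rewrite ler_norml mulrC; apply/andP; split; lra.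
rewrite /ball /= -(ltr_pM2l dR) (_ : d%:R * `|x - y| = `|d%:R * (x - y)|); last by rewrite normrM gtr0_norm.
rewrite (_ : d%:R * (x - y) = (d%:R * x - p%:~R) - (d%:R * y - p%:~R)); last by ring.
apply: (le_lt_trans (ler_normB _ _)); rewrite (_ : d%:R * r = 3 * (c * t)); last first.
  by rewrite /r; field; exact: lt0r_neq0.
have : t <= c * t by rewrite ler_peMl // ltW.
by move: hp hy ct; move: (c * t) `|_| `|_| => ? ? ?; lra.
Qed.

(** At a density point x of the limsup set, the ball of radius 2/M has a relatively small
    exceptional part. Multiplication by M blows it up to radius 2, enlarges the tolerance to M,
    which [cassels] ignores up to a null set, and an integer translation moves the result over
    [0, 1]. *)
Theorem zero_one : (0 < lam (often_close 1))%E ->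
  lam ([set` `[0, 1]] `&` ~` often_close 1) = 0%E.
Proof.
move=> pos; set W := often_close 1 in pos *; set Z := ~` W.
have mW : measurable W by exact: measurable_often_close.
have mZ : measurable Z by exact: measurableC.
have [x Wx thin] : exists2 x, W x & thin_at Z x.
  apply: contrapT => H; have := thin_complement mZ => /negligibleS H2.
  have : lam.-negligible W.
    by apply: H2 => x Wx /= h; apply: H; exists x => //; apply: h => /(_ Wx).
  by move=> [B [mB B0 WB]]; move: pos; rewrite (lebesgue_null_sub mW mB B0 WB) ltxx.
have small e : 0 < e -> (lam ([set` `[0%R, 1%R]] `&` Z) <= e%:E)%E.
  move=> e0; have [del del0 hdel] := thin (e / 2) (divr_gt0 e0 (ltr0n _ 2)).
  pose M := (Num.trunc (2 / del)).+1.
  have M0 : 0 < M%:R :> R by rewrite ltr0n.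
  have rdel : 0 < (2 / M%:R : R) < del.
    apply/andP; split; first exact: divr_gt0.
    rewrite ltr_pdivrMr // mulrC -ltr_pdivrMr //.
    by have /andP[] := truncn_itv (divr_ge0 (ler0n R 2) (ltW del0)).
  have {}hdel := hdel _ rdel.
  (* The ball of radius 2 around y contains the unit interval starting at the integer part k of
     y. *)
  pose y : R := M%:R * x; pose k := Num.floor y; pose B := ball y (2 : R).
  have mB : measurable B by exact: measurable_realfun.measurable_ball.
  have mZM : measurable (~` often_close M%:R) by apply: measurableC; exact: measurable_often_close.
  apply: (@le_trans _ _ (lam (Z `&` B))).
    rewrite [leRHS](@lebesgue_affine _ 1 k%:~R) ?mul1e //; last exact: measurableI.
    apply: le_measure; rewrite ?inE; first by apply: measurableI.
      by rewrite -[X in measurable X]setTI; apply: measurable_affine => //; exact: measurableI.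
    move=> u /= []; rewrite in_itv /= => /andP[u0 u1] Zu; rewrite mul1r; split.
      by move=> Wu; apply: Zu; exact: often_close_shift Wu.
    have /andP[f1 f2] := floor_itv y; rewrite -/k intrD in f1 f2.
    by rewrite /B /ball /= ltr_norml; apply/andP; split; lra.
  apply: (@le_trans _ _ (lam (~` often_close M%:R `&` B))).
    have sub : Z `&` B `<=` (~` often_close M%:R `&` B) `|` (often_close M%:R `&` Z).
      move=> u [Zu Bu]; have [h|h] := pselect (often_close M%:R u); [by right | by left].
    have mU : measurable (often_close M%:R `&` Z) by apply: measurableI => //; exact: measurable_often_close.
    have N0 : lam (often_close M%:R `&` Z) = 0%E.
      have := @cassels M%:R; rewrite ler1n => /(_ isT) [B' [mB' B0 sB]].
      by apply: (lebesgue_null_sub mU mB' B0) => u [h1 h2]; apply: sB => /= h; exact: h2 (h h1).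
    have mV : measurable (~` often_close M%:R `&` B) by exact: measurableI.
    apply: (@le_trans _ _ (lam ((~` often_close M%:R `&` B) `|` (often_close M%:R `&` Z)))).
      by apply: le_measure; rewrite ?inE //; [exact: measurableI | exact: measurableU].
    apply: (@le_trans _ _ (lam (~` often_close M%:R `&` B) + lam (often_close M%:R `&` Z))%E).
      by apply: measureU2.
    by rewrite [X in (_ + X)%E]N0 adde0.
  rewrite (@lebesgue_affine _ M%:R 0) //; last exact: measurableI.
  apply: (@le_trans _ _ (M%:R%:E * lam (Z `&` ball x (2 / M%:R)))%E).
    apply: lee_wpmul2l; first by rewrite lee_fin ltW.
    apply: le_measure; rewrite ?inE.
    - by rewrite -[X in measurable X]setTI; apply: measurable_affine => //; exact: measurableI.
    - by apply: measurableI => //; exact: measurable_realfun.measurable_ball.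
    move=> u /= []; rewrite addr0 => nW Bu; split.
      by move=> Wu; apply: nW; rewrite -[X in often_close X]mulr1; exact: often_close_scale.
    move: Bu; rewrite /B /ball /= /y -mulrBr normrM ger0_norm ?(ltW M0) // => h.
    by rewrite ltr_pdivlMr // mulrC.
  apply: (le_trans (lee_wpmul2l _ hdel)); first by rewrite lee_fin ltW.
  rewrite -EFinM lee_fin le_eqVlt; apply/orP; left; apply/eqP; field.
  by rewrite lt0r_neq0.
apply/eqP; rewrite eq_le measure_ge0 andbT; apply/lee_addgt0Pr => e e0.
by rewrite add0e; exact: small.
Qed.

End LimsupSets.

(** * Distance to the nearest integer *)

Section DeltaMin.
Variables (R : realType) (a : nat -> nat).
Hypothesis ainc : forall n, (1 <= n)%N -> (a n < a n.+1)%N.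
Implicit Types (x : R).

Lemma dist_int_le x (p : int) : dist_int x <= `|x - p%:~R|.
Proof.
have /andP[f1 f2] := floor_itv x; rewrite /dist_int.
have [pf|pf] := leP p (Num.floor x).
  apply: (@le_trans _ _ (x - (Num.floor x)%:~R)); first by rewrite ge_min lexx.
  have h : p%:~R <= (Num.floor x)%:~R :> R by rewrite ler_int.
  by rewrite ger0_norm; lra.
apply: (@le_trans _ _ ((Num.floor x + 1)%:~R - x)); first by rewrite ge_min lexx orbT.
have h : (Num.floor x + 1)%:~R <= p%:~R :> R by rewrite ler_int lezD1.
by rewrite ler0_norm; lra.
Qed.

Lemma dist_int_near x : exists p : int, dist_int x = `|x - p%:~R|.
Proof.
have /andP[f1 f2] := floor_itv x; rewrite /dist_int /Num.min; case: ifP => _.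
  by exists (Num.floor x); rewrite ger0_norm // subr_ge0.
by exists (Num.floor x + 1); rewrite ler0_norm ?opprB //; lra.
Qed.

Lemma dist_int_opp_ge x : dist_int x <= dist_int (- x).
Proof.
have [p ->] := dist_int_near (- x); apply: le_trans (dist_int_le x (- p)) _.
by rewrite rmorphN /= opprK -normrN opprD.
Qed.

Lemma bigmin_le_mem (I : eqType) (s : seq I) (P : pred I) (F : I -> R) (y : R) (i : I) :
  i \in s -> P i -> \big[Num.min/y]_(j <- s | P j) F j <= F i.
Proof.
elim: s => // j s IH; rewrite inE big_cons => /orP[/eqP <- ->|/IH h /h {}h].
  by rewrite ge_min lexx.
by case: ifP => // _; rewrite ge_min h orbT.
Qed.

Lemma delta_min_le N d (alpha : R) : d \in posdiffs a N -> delta_min a alpha N <= dist_int (d%:R * alpha).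
Proof.
case/posdiffsP => i [j [iN jN d0 dE]].
have ij : (a j < a i)%N by rewrite -subn_gt0 -dE.
have -> : d%:R * alpha = ((a i)%:Z - (a j)%:Z)%:~R * alpha.
  by rewrite dE subzn ?(ltnW ij).
have iNm : i \in index_iota 1 N.+1 by rewrite mem_index_iota ltnS.
have jNm : j \in index_iota 1 N.+1 by rewrite mem_index_iota ltnS.
apply: (le_trans (bigmin_le_mem _ _ iNm _)) => //.
by apply: (bigmin_le_mem _ _ jNm); apply: contraTneq ij => ->; rewrite ltnn.
Qed.

(** The condition [t <= 1] is there for the default value of the minimum; negative differences
    reduce to positive ones by symmetry of the distance. *)
Lemma delta_min_ge N t (alpha : R) : t <= 1 ->
  (forall d, d \in posdiffs a N -> t <= dist_int (d%:R * alpha)) -> t <= delta_min a alpha N.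
Proof.
move=> t1 H; rewrite /delta_min.
have ge_min2 (u v : R) : t <= u -> t <= v -> t <= Num.min u v by rewrite le_min => -> ->.
rewrite big_seq; elim/big_ind: _ => // i; rewrite mem_index_iota ltnS => iN.
rewrite big_seq_cond; elim/big_ind: _ => // j; rewrite mem_index_iota ltnS => /andP[jN ij].
have cast m n : (n <= m)%N -> (m%:Z - n%:Z)%:~R = (m - n)%:R :> R.
  by move=> nm; rewrite subzn.
have [lt|lt|eq] := ltngtP (a i) (a j).
- have -> : ((a i)%:Z - (a j)%:Z)%:~R * alpha = - ((a j - a i)%:R * alpha).
    by rewrite -(cast _ _ (ltnW lt)) -mulNr -rmorphN opprB.
  apply: (le_trans _ (dist_int_opp_ge _)); apply: H; apply/posdiffsP; exists j, i.
  by split => //; rewrite subn_gt0.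
- rewrite cast ?(ltnW lt) //; apply: H; apply/posdiffsP; exists i, j; split => //; by rewrite subn_gt0.
suff : i = j by move=> e; rewrite e eqxx in ij.
have inj u v : (1 <= u)%N -> (u < v)%N -> (a u < a v)%N.
  by move=> u1 uv; apply: leq_trans (ainc u1) (a_mono ainc _ uv).
move: iN jN => /andP[i1 _] /andP[j1 _].
have [h|h|//] := ltngtP i j; [have := inj _ _ i1 h | have := inj _ _ j1 h]; by rewrite eq ltnn.
Qed.

End DeltaMin.

Section UpperBound.
Variables (R : realType) (a : nat -> nat).
Hypothesis apos : forall n, (1 <= n)%N -> (0 < a n)%N.
Hypothesis ainc : forall n, (1 <= n)%N -> (a n < a n.+1)%N.
Local Notation D := (posdiffs a).
Local Notation C N := ((C_N a N)%:R : R).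
Local Notation lam := (@lebesgue_measure R).

Lemma posdiffs_index_ge2 N d : d \in D N -> (2 <= N)%N.
Proof.
case/posdiffsP => i [j [/andP[i1 iN] /andP[j1 jN] d0 dE]]; rewrite ltnNge; apply/negP => N1.
have e1 : i = 1%N by lia.
have e2 : j = 1%N by lia.
by move: d0; rewrite dE e1 e2 subnn.
Qed.

Lemma tau_gt0 N d : d \in D N -> 0 < tau R a N.
Proof.
move=> /posdiffs_index_ge2 N2; rewrite divr_gt0 ?(C_gt0 R ainc) ?(ltnW N2) //.
by rewrite lt_min ltr01 theta_gt0.
Qed.

Lemma tau_cvg0 (e : R) : 0 < e ->
  exists n, forall N d, (n <= N)%N -> d \in D N -> tau R a N < e.
Proof.
move=> e0; exists (Num.trunc e^-1).+1 => N d nN /posdiffs_index_ge2 N2.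
have NC := C_N_ge_self ainc (ltnW N2); have c0 := C_gt0 R ainc (ltnW N2).
rewrite ltr_pdivrMr //; apply: (@le_lt_trans _ _ 1); first by rewrite ge_min lexx.
rewrite mulrC -ltr_pdivrMr // mul1r; apply: (@lt_le_trans _ _ N%:R); last by rewrite ler_nat.
apply: (@lt_le_trans _ _ (Num.trunc e^-1).+1%:R); last by rewrite ler_nat.
have ei : 0 <= e^-1 by rewrite invr_ge0 ltW.
by have /andP[] := truncn_itv ei.
Qed.

Let W := often_close D (tau R a) 1.

(** The sets [V n] decrease inside [0, 1] and each has measure at least [s], hence so has their
    intersection; the zero-one law then applies. *)
Lemma often_close_full : lam ([set` `[0, 1]] `&` ~` W) = 0%E.
Proof.
have Dpos N d : d \in D N -> (0 < d)%N by exact: posdiffs_gt0.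
apply: (zero_one Dpos tau_gt0 tau_cvg0).
have [s [s0 H]] := arcs_lower_bound R apos ainc.
pose V n := some_close D (tau R a) 1 n `&` ([set` `[0, 1]] : set R).
have mV n : measurable (V n).
  by apply: measurableI => //; exact: measurable_some_close.
have Vs n : (s%:E <= lam (V n))%E.
  have [Q [S [psi [h1 h2 h3]]]] := H n; apply: (le_trans h3).
  apply: le_measure; rewrite ?inE //.
    by apply: bigsetU_measurable => d _; exact: arcs_measurable.
    exact: mV.
  rewrite /big_union -bigcup_seq => x [d /= dS]; rewrite /arcs -bigcup_seq => -[p /= pd].
  have [nl dl] := h1 d dS; have d0 := Dpos _ _ dl; have dR : 0 < d%:R :> R by rewrite ltr0n.
  rewrite /arc /= in_itv /= ler_pdivrMr // ler_pdivlMr // => /andP[x1 x2].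
  have pt := h2 d dS; have t2 := tau_le R ainc (posdiffs_index_ge2 dl).
  split; last first.
    have pd1 : p%:R + 1 <= d%:R :> R by rewrite natr1 ler_nat; exact: numer_lt pd.
    rewrite /= in_itv /= -(ler_pM2r dR) mul0r -[X in _ && X](ler_pM2r dR) mul1r; apply/andP; split.
      by apply: le_trans x1.
    by apply: (le_trans x2); move: pt t2 pd1; move: (psi d) (tau _ _ _) => ? ?; lra.
  exists (lab a d), d; split => //; exists p%:Z; rewrite mul1r -pmulrn mulrC.
  by rewrite ler_norml; apply/andP; split; move: pt (tau_gt0 dl); move: (psi d) (tau _ _ _) x2 => ? ?; lra.
have VW : (s%:E <= lam (\bigcap_n V n))%E.
  have mcap : measurable (\bigcap_n V n) by exact: bigcapT_measurable.
  have fin : (lam (V 0%N) < +oo)%E.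
    apply: (@le_lt_trans _ _ (lam [set` `[0%R, 1%R]])).
      by apply: le_measure; rewrite ?inE; [exact: mV | exact: measurable_itv | move=> x []].
    by rewrite lebesgue_measure_itv /= lte_fin ltr01 -EFinB ltry.
  have dec : {homo V : n m / (n <= m)%N >-> (m <= n)%O}.
    move=> n m nm; apply/subsetPset => x [[N [d [mN dN xd]]] x01]; split => //.
    by exists N, d; split => //; exact: leq_trans mN.
  have cv := nonincreasing_cvg_mu fin mV mcap dec.
  rewrite -(cvg_lim _ cv) //; apply: lime_ge; first by apply/cvg_ex; exists (lam (\bigcap_n V n)).
  by apply: nearW => n /=; exact: Vs.
apply: (@lt_le_trans _ _ s%:E); first by rewrite lte_fin.
apply: (le_trans VW); apply: le_measure; rewrite ?inE.
- exact: bigcapT_measurable.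
- exact: measurable_often_close.
by move=> x Vx n; have [] := Vx n I.
Qed.

Lemma measurable_not_often_close : measurable (([set` `[0, 1]] : set R) `&` ~` W).
Proof.
apply: measurableI; first exact: measurable_itv.
by apply: measurableC; apply: measurable_often_close => N d; exact: posdiffs_gt0.
Qed.

Lemma often_close_delta_min alpha : W alpha -> forall M : nat, exists N : nat,
  [/\ (M <= N)%N, (2 <= N)%N & delta_min a alpha N <= tau R a N].
Proof.
move=> h M; have [N [d [MN dN [p hp]]]] := h M; exists N; split => //.
  exact: posdiffs_index_ge2 dN.
apply: (le_trans (delta_min_le alpha dN)); apply: (le_trans (dist_int_le _ p)).
by rewrite -[leRHS]mul1r.
Qed.

End UpperBound.

(** * The convergence part *)

Lemma powR_expR (R : realType) (x r : R) : 0 < x -> x `^ r = expR (r * ln x).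
Proof. by move=> x0; rewrite /powR gt_eqF. Qed.

(** The potential is a primitive of max(1, y)^(-1-eps), and the integrand decreases, so its value at
    the right endpoint is dominated by the increment. *)
Lemma potential_step (R : realType) (eps x y : R) : 0 < eps -> x <= y ->
  (y - x) / (Num.max 1 y * expR (eps * ln (Num.max 1 y))) <=
  (Num.min y 1 - eps^-1 * expR (- (eps * ln (Num.max 1 y)))) -
  (Num.min x 1 - eps^-1 * expR (- (eps * ln (Num.max 1 x)))).
Proof.
move=> e0 xy; set X := Num.max 1 x; set Y := Num.max 1 y.
have X1 : 1 <= X by rewrite le_max lexx.
have Y1 : 1 <= Y by rewrite le_max lexx.
have [split1 mm XY] : [/\ y - x = (Num.min y 1 - Num.min x 1) + (Y - X), Num.min x 1 <= Num.min y 1 & X <= Y].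
  rewrite /X /Y /Num.min /Num.max; case: (ltP y 1) => y1; case: (ltP x 1) => x1; case: (ltP 1 y) => y1'; case: (ltP 1 x) => x1'; split; lra.
have lY : 0 <= ln Y by apply: ln_ge0.
have ex1 : 1 <= expR (eps * ln Y) by rewrite -expR0 ler_expR mulr_ge0 // ltW.
have W1 : 1 <= Y * expR (eps * ln Y) by rewrite -[leLHS]mulr1; apply: ler_pM.
have W0 : 0 < Y * expR (eps * ln Y) by apply: lt_le_trans W1.
rewrite split1 mulrDl.
have h1 : (Num.min y 1 - Num.min x 1) / (Y * expR (eps * ln Y)) <= Num.min y 1 - Num.min x 1.
  by rewrite ler_pdivrMr // ler_peMr // subr_ge0.
have h2 : (Y - X) / (Y * expR (eps * ln Y)) <= eps^-1 * (expR (- (eps * ln X)) - expR (- (eps * ln Y))).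
  have st := lnln_step (lt_le_trans ltr01 X1) XY.
  have e1 : expR (- (eps * ln X)) = expR (- (eps * ln Y)) * expR (eps * (ln Y - ln X)).
    by rewrite -expRD; congr expR; ring.
  have g := expR_ge1Dx (eps * (ln Y - ln X)).
  rewrite e1 invfM mulrA -expRN (_ : _ * _ - _ = expR (- (eps * ln Y)) * (expR (eps * (ln Y - ln X)) - 1)); last by ring.
  rewrite mulrCA mulrC ler_wpM2l ?expR_ge0 //; apply: (le_trans st).
  rewrite mulrC ler_pdivlMr // mulrC; lra.
by rewrite mulrBr in h2; lra.
Qed.

Lemma telescope_step (R : realType) (p' p q k c b t t2 : R) :
  c * b <= k * (p' - p) -> t <= t2 + k / 2 * (p - q) -> t + c / 2 * b <= t2 + k / 2 * (p' - q).
Proof.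
move=> h1 h2; rewrite (_ : c / 2 * b = c * b / 2); last by ring.
rewrite (_ : k / 2 * (p' - q) = k * (p' - p) / 2 + k / 2 * (p - q)); last by ring.
move: h1 h2; move: (c * b) (k * (p' - p)) (k / 2 * (p - q)) => u v w; lra.
Qed.

Section LowerBoundAE.
Variables (R : realType) (a : nat -> nat) (eps : R).
Hypothesis ainc : forall n, (1 <= n)%N -> (a n < a n.+1)%N.
Hypothesis eps0 : 0 < eps.
Local Notation D := (posdiffs a).
Local Notation C N := ((C_N a N)%:R : R).
Local Notation lam := (@lebesgue_measure R).

Definition beta (N : nat) : R := (C N * Log (N%:R : R) * (Log2 (N%:R : R)) `^ (1 + eps))^-1.

Let L N : R := Log N%:R.
Let L2 N : R := Log2 N%:R.

Lemma beta_den_gt0 N : (1 <= N)%N -> 0 < C N * Log (N%:R : R) * (Log2 (N%:R : R)) `^ (1 + eps).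
Proof. by move=> N1; rewrite !mulr_gt0 ?powR_gt0 ?Log_gt0 ?Log2_gt0 ?(C_gt0 R ainc). Qed.

Lemma beta_gt0 N : (1 <= N)%N -> 0 < beta N.
Proof. by move=> N1; rewrite invr_gt0 beta_den_gt0. Qed.

Lemma powR_Log2_ge1 (x : R) : 1 <= (Log2 x) `^ (1 + eps).
Proof.
rewrite powR_expR ?Log2_gt0 // -expR0 ler_expR mulr_ge0 ?ln_ge0 ?Log2_ge1 //.
by rewrite addr_ge0 // ltW.
Qed.

Lemma beta_mono N M : (1 <= N)%N -> (N <= M)%N -> beta M <= beta N.
Proof.
move=> N1 NM; have M1 := leq_trans N1 NM.
rewrite lef_pV2 ?posrE ?beta_den_gt0 //.
have NR : 0 < N%:R :> R by rewrite ltr0n.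
have NMR : N%:R <= M%:R :> R by rewrite ler_nat.
apply: ler_pM; rewrite ?powR_ge0 ?mulr_ge0 ?(ltW (Log_gt0 _)) //.
  by apply: ler_pM; rewrite ?(ltW (Log_gt0 _)) ?Log_mono // ler_nat C_N_mono.
rewrite !powR_expR ?Log2_gt0 // ler_expR ler_wpM2l //; first by rewrite addr_ge0 // ltW.
by rewrite ler_ln ?posrE ?Log2_gt0 // Log2_mono.
Qed.

Lemma beta_le_inv N : (1 <= N)%N -> beta N <= N%:R^-1.
Proof.
move=> N1; have NR : 0 < N%:R :> R by rewrite ltr0n.
rewrite lef_pV2 ?posrE ?beta_den_gt0 //; apply: (@le_trans _ _ (C N * 1 * 1)).
  by rewrite !mulr1 ler_nat C_N_ge_self.
apply: ler_pM; rewrite ?mulr1 ?powR_Log2_ge1 //.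
by rewrite -[leLHS]mulr1 ler_wpM2l // Log_ge1.
Qed.

(* The first term carries the sum while log log C_N <= 1, where [Log2] is constant, and the second one afterwards. *)
Let pot N : R := Num.min (ln (Log (C N))) 1 - eps^-1 * expR (- (eps * ln (Log2 (C N)))).
(** From C_N <= N^2 both logarithms of C_N are at most twice those of N: a factor 2 from [Log] and
    2^(1+eps) from the power of [Log2]. *)
Let K0 : R := 4 * expR (eps * ln 2).

(** Substituting y = log log C turns dC / (C log C (log log C)^(1+eps)) into dy / y^(1+eps); two
    uses of [lnln_step] make the substitution discrete. *)
Lemma beta_step N : (2 <= N)%N -> (C N.+1 - C N) * beta N.+1 <= K0 * (pot N.+1 - pot N).
Proof.
move=> N2; have N1 := ltnW N2; set x := C N; set y := C N.+1; set M := N.+1.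
have x3 : 3 <= x by rewrite ler_nat; have := C_N_ge ainc N1; lia.
have xy : x <= y by rewrite ler_nat C_N_mono.
have x0 : 0 < x by lra. have y0 : 0 < y by lra.
have LnE (z : R) : 3 <= z -> Log z = ln z.
  move=> z3; rewrite /Log max_r // -[leLHS](expRK (1 : R)) ler_ln ?posrE ?expR_gt0 //; last lra.
  by apply: le_trans z3; exact: expR1_le3.
have yM : y <= M%:R ^+ 2 by rewrite -natrX ler_nat C_N_le.
have MR : 0 < M%:R :> R by rewrite ltr0n.
have LM1 := Log_ge1 (M%:R : R); have LLM1 := Log2_ge1 (M%:R : R).
have Ly : Log y <= 2 * Log M%:R.
  apply: (le_trans (Log_mono y0 yM)); rewrite ge_max; apply/andP; split; first lra.
  by rewrite lnXn // -[ln _ *+ _]mulr_natl ler_wpM2l // le_max lexx orbT.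
have LLy : Log2 y <= 2 * Log2 M%:R.
  rewrite /Log2; apply: (le_trans (Log_mono (Log_gt0 y) Ly)); rewrite ge_max; apply/andP; split.
    by rewrite -/(Log2 _); lra.
  rewrite lnM ?posrE ?Log_gt0 //; have := @ln_le_sub1 _ (2 : R) (ltr0n _ 2).
  have : ln (Log M%:R) <= Log (Log M%:R) :> R by rewrite le_max lexx orbT.
  by rewrite -/(Log2 _); lra.
set u := ln x; set u' := ln y.
have u1 : 1 <= u by rewrite /u -LnE // Log_ge1.
have uu : u <= u' by rewrite ler_ln ?posrE.
have s1 : (y - x) / y <= u' - u by exact: lnln_step.
have s2 : (u' - u) / u' <= ln u' - ln u by apply: lnln_step => //; lra.
have u'0 : 0 < u' by lra.
have s3 := potential_step eps0 (_ : ln u <= ln u').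
have {}s3 := s3 (_ : _); have lnuu : ln u <= ln u' by rewrite ler_ln ?posrE //; lra.
have {s3} := s3 lnuu.
have E1 : Num.max 1 (ln u') = Log2 y by rewrite /Log2 (LnE y) //; lra.
have E2 : Num.max 1 (ln u) = Log2 x by rewrite /Log2 (LnE x).
rewrite E1 E2 => s3.
have potE (z : R) : 3 <= z -> Num.min (ln (Log z)) 1 = Num.min (ln (ln z)) 1 by move=> z3; rewrite LnE.
set v := Log2 y in E1 LLy s3 *.
have v0 : 0 < v by exact: Log2_gt0.
have den : y * u' * (v * expR (eps * ln v)) / K0 <= y * Log M%:R * (Log2 M%:R) `^ (1 + eps).
  rewrite powR_expR ?Log2_gt0 // mulrDl mul1r expRD lnK ?posrE ?Log2_gt0 //.
  have e2 : expR (eps * ln v) <= expR (eps * ln 2) * expR (eps * ln (Log2 M%:R)).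
    rewrite -expRD -mulrDr ler_expR ler_wpM2l ?(ltW eps0) // -lnM ?posrE ?Log2_gt0 //.
    by rewrite ler_ln ?posrE // mulr_gt0 ?Log2_gt0.
  have K00 : 0 < K0 by rewrite mulr_gt0 ?expR_gt0.
  rewrite ler_pdivrMr //.
  apply: (@le_trans _ _ (y * (2 * Log M%:R) * ((2 * Log2 M%:R) * (expR (eps * ln 2) * expR (eps * ln (Log2 M%:R)))))).
    apply: ler_pM; rewrite ?mulr_ge0 ?expR_ge0 ?(ltW y0) ?(ltW u'0) ?(ltW v0) //.
      by rewrite ler_wpM2l ?(ltW y0) // /u' -LnE //; lra.
    by apply: ler_pM; rewrite ?expR_ge0 ?(ltW v0).
  by rewrite le_eqVlt; apply/orP; left; apply/eqP; rewrite /K0; ring.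
have K00 : 0 < K0 by rewrite mulr_gt0 ?expR_gt0.
have dpos : 0 < y * u' * (v * expR (eps * ln v)) by rewrite !mulr_gt0 ?expR_gt0.
have b1 : beta M <= K0 / (y * u' * (v * expR (eps * ln v))).
  by rewrite -invf_div lef_pV2 ?posrE ?beta_den_gt0 ?divr_gt0.
apply: (@le_trans _ _ ((y - x) * (K0 / (y * u' * (v * expR (eps * ln v)))))).
  by rewrite ler_wpM2l // subr_ge0.
have -> : (y - x) * (K0 / (y * u' * (v * expR (eps * ln v)))) =
   K0 * ((y - x) / y / u' / (v * expR (eps * ln v))) by rewrite !invfM; ring.
rewrite ler_wpM2l ?(ltW K00) //.
have ve0 : 0 < v * expR (eps * ln v) by rewrite mulr_gt0 ?expR_gt0.
apply: (@le_trans _ _ ((ln u' - ln u) / (v * expR (eps * ln v)))).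
  rewrite ler_wpM2r ?invr_ge0 ?(ltW ve0) //; apply: le_trans s2.
  by rewrite ler_wpM2r ?invr_ge0 ?(ltW u'0).
apply: (le_trans s3); rewrite /pot -/x -/y -/v !potE //; lra.
Qed.

Lemma sum_beta_bounded : exists B : R, forall N, (2 <= N)%N -> \sum_(d <- D N) beta (lab a d) <= B.
Proof.
pose T N : R := \sum_(d <- D N) beta (lab a d).
exists (T 2%N + K0 / 2 * (1 + eps^-1)) => N N2.
have main : T N <= T 2%N + K0 / 2 * (pot N - pot 2).
  elim: N N2 => // N IH; rewrite ltnS leq_eqVlt => /orP[/eqP <-|N2].
    by rewrite subrr mulr0 addr0.
  have TE : T N.+1 = T N + (C N.+1 - C N) / 2 * beta N.+1.
    by rewrite /T (sum_posdiffs_split a _ (leqnSn N)) (sum_newdiffs_lab a beta (ltnW N2)).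
  by rewrite TE; exact: telescope_step (beta_step N2) (IH N2).
apply: (le_trans main); rewrite lerD2l ler_wpM2l ?divr_ge0 ?(mulr_ge0 (ler0n _ 4) (expR_ge0 _)) //.
have i0 : 0 < eps^-1 by rewrite invr_gt0.
have q0 n : 0 <= eps^-1 * expR (- (eps * ln (Log2 (C n)))) by rewrite mulr_ge0 ?expR_ge0 // ltW.
have p1 : pot N <= 1.
  by rewrite /pot lerBlDr; apply: (@le_trans _ _ 1); rewrite ?ge_min ?lexx ?orbT // lerDl.
have p2 : - eps^-1 <= pot 2.
  rewrite /pot lerBrDr; apply: (@le_trans _ _ 0); last by rewrite le_min ler01 ln_ge0 ?Log_ge1.
  rewrite addrC subr_le0 ler_piMr ?(ltW i0) // -[leRHS]expR0 ler_expR oppr_le0.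
  by rewrite mulr_ge0 ?ln_ge0 ?Log2_ge1 ?(ltW eps0).
by rewrite -[eps^-1]opprK; exact: lerB p1 p2.
Qed.

Local Notation I01 := ([set` `[0%R, 1%R]] : set R).

(** As [t < 1], only the numerators 0 to d matter: d + 1 intervals of length 2t/d, and d + 1 <=
    2d. *)
Lemma near_int_measure (d : nat) (t : R) : (0 < d)%N -> 0 <= t -> t < 1 ->
  (lam (I01 `&` near_int d t) <= (4 * t)%:E)%E.
Proof.
move=> d0 t0 t1; have dR : 0 < d%:R :> R by rewrite ltr0n.
pose J (p : nat) : set R := [set` `[(p%:R - t) / d%:R, (p%:R + t) / d%:R]].
have mJ p : measurable (J p) by exact: measurable_itv.
have mI : measurable I01 by exact: measurable_itv.
have sub : I01 `&` near_int d t `<=` I01 `&` \big[setU/set0]_(p <- iota 0 d.+1) J p.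
  move=> x [x01 [p hp]]; split => //; move: x01; rewrite /= in_itv /= => /andP[x0 x1].
  have dx0 : 0 <= d%:R * x by rewrite mulr_ge0.
  have dx1 : d%:R * x <= d%:R by rewrite ler_piMr.
  move: hp; rewrite ler_norml => /andP[h1 h2].
  have p0 : (0 <= p)%R.
    by rewrite -ltzD1 -(ltr_int R) intrD; move: h1 h2; lra.
  have pd : (p <= d%:Z)%R.
    by rewrite -ltzD1 -(ltr_int R) intrD; move: h1 h2; lra.
  case: p p0 pd h1 h2 => // p _ pd h1 h2; rewrite -bigcup_seq; exists p.
    by change (is_true (p \in iota 0 d.+1)); rewrite mem_iota add0n ltnS -lez_nat.
  by rewrite /J /= in_itv /= ler_pdivrMr // ler_pdivlMr // mulrC; apply/andP; split; move: h1 h2; rewrite -pmulrn; lra.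
have mN : measurable (near_int d t : set R) by exact: measurable_near_int.
apply: (@le_trans _ _ (lam (I01 `&` \big[setU/set0]_(p <- iota 0 d.+1) J p))).
  apply: le_measure; rewrite ?inE; first exact: measurableI.
    by apply: measurableI => //; apply: bigsetU_measurable => p _; exact: mJ.
  exact: sub.
have B := @measure_setI_bigU _ _ R lam _ J mJ _ (iota 0 d.+1) mI.
apply: (le_trans B); apply: (@le_trans _ _ (\sum_(p <- iota 0 d.+1) (2 * t / d%:R)%:E)%E).
  apply: lee_sum => p _; apply: (@le_trans _ _ (lam (J p))).
    by apply: le_measure; rewrite ?inE; [apply: measurableI; [exact: mI | exact: mJ] | exact: mJ | move=> x []].
  rewrite lebesgue_measure_itv /= lte_fin; case: ifP => _; last by rewrite lee_fin divr_ge0 ?mulr_ge0.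
  by rewrite -EFinB lee_fin le_eqVlt; apply/orP; left; apply/eqP; ring.
rewrite sumEFin lee_fin big_const_seq count_predT iter_addr_0 size_iota -[_ *+ d.+1]mulr_natl mulrA ler_pdivrMr //.
have : 1 <= d%:R :> R by rewrite ler1n.
rewrite -natr1; move: (d%:R : R) dR => z z0 z1; nra.
Qed.

Lemma beta_lt1 N : (2 <= N)%N -> beta N < 1.
Proof.
move=> N2; apply: (le_lt_trans (beta_le_inv (ltnW N2))).
by rewrite invf_lt1 ?ltr1n ?ltr0n // ltnW.
Qed.

Let F (d : nat) : set R := if d \in D (lab a d) then I01 `&` near_int d (beta (lab a d)) else set0.

Let mF d : measurable (F d).
Proof.
rewrite /F; case: ifP => // dl; apply: measurableI; first exact: measurable_itv.
by apply: measurable_near_int; exact: posdiffs_gt0 dl.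
Qed.

(** Borel-Cantelli indexed by the differences themselves, each counted once with the tolerance of
    its first stage. The differences below n all belong to one [posdiffs a N], so [sum_beta_bounded]
    bounds every partial sum. *)
Lemma limsup_null : lam (lim_sup_set F) = 0%E.
Proof.
apply: lim_sup_set_cvg0 => //; have [B HB] := sum_beta_bounded.
apply: (@le_lt_trans _ _ (4 * B)%:E); last exact: ltry.
apply: lime_le; first by apply: is_cvg_nneseries => n _ _; exact: measure_ge0.
apply: nearW => n; pose N := (\max_(d < n) lab a d).+2.
apply: (@le_trans _ _ (\sum_(d <- [seq d <- iota 0 n | d \in D (lab a d)]) (4 * beta (lab a d))%:E)%E).
  rewrite big_filter [leRHS]big_mkcond /= /index_iota subn0; apply: lee_sum => d _; rewrite /F.
  case: ifP => dl; last by rewrite measure0.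
  have l2 := posdiffs_index_ge2 dl.
  by apply: near_int_measure; [exact: posdiffs_gt0 dl | exact/ltW/beta_gt0/ltnW | exact: beta_lt1].
rewrite sumEFin lee_fin -mulr_sumr ler_wpM2l //; apply: le_trans (HB N _) => //.
apply: sum_uniq_sub; rewrite ?filter_uniq ?iota_uniq ?uniq_posdiffs //.
  move=> d; rewrite mem_filter mem_iota add0n => /andP[dl /= dn].
  apply: (posdiffs_sub _ dl); rewrite /N !leqW //.
  exact: (leq_bigmax (F := fun d : 'I_n => lab a d) (Ordinal dn)).
move=> d dD; have [dl _] := labP dD; have l2 := posdiffs_index_ge2 dl.
exact/ltW/beta_gt0/ltnW.
Qed.

Let G (d : nat) : set R := if (0 < d)%N then I01 `&` near_int d 0 else set0.

Let mG d : measurable (G d).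
Proof.
rewrite /G; case: ifP => // d0; apply: measurableI; first exact: measurable_itv.
exact: measurable_near_int.
Qed.

(** Needed for the finitely many differences that Borel-Cantelli does not control: outside this set
    their distances to the integers are positive. *)
Lemma rational_null : lam (\bigcup_d G d) = 0%E.
Proof.
apply/eqP; rewrite eq_le measure_ge0 andbT.
have mU : measurable (\bigcup_d G d) by exact: bigcupT_measurable.
have H := @generalized_Boole_inequality _ _ R lam G mG mU; apply: (le_trans H).
rewrite eseries0 // => d _ _; apply/eqP; rewrite eq_le measure_ge0 andbT /G.
case: ifP => [d0|_]; last by rewrite measure0.
by have := near_int_measure d0 (lexx 0) ltr01; rewrite mulr0.
Qed.

(** As [beta] decreases, a difference d at distance below [beta N] is also below its own tolerance
    [beta (lab d)], so d < n0. The finitely many such d keep a distance at least 1/M, which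
    [beta N <= 1/N] cannot exceed for N >= M. *)
Theorem lower_bound_ae : exists Z : set R, [/\ measurable Z, lam Z = 0%E &
  forall alpha, alpha \in `[0, 1] -> ~ Z alpha -> exists M : nat, forall N : nat, (M <= N)%N -> (2 <= N)%N ->
    beta N <= delta_min a alpha N].
Proof.
have mL : measurable (lim_sup_set F).
  by apply: bigcapT_measurable => n; apply: bigcup_measurable => k _; exact: mF.
have mU : measurable (\bigcup_d G d) by exact: bigcupT_measurable.
exists (lim_sup_set F `|` \bigcup_d G d); split; first exact: measurableU.
  by apply: null_set_setU => //; [exact: limsup_null | exact: rational_null].
move=> al al01 nZ; have I01al : I01 al by exact: al01.
have [n0 Hn0] : exists n0, forall d, (n0 <= d)%N -> ~ F d al.
  apply: contrapT => H; apply: nZ; left => n _; apply: contrapT => H2; apply: H.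
  by exists n => d nd Fd; apply: H2; exists d.
have dpos d : (0 < d)%N -> 0 < dist_int (d%:R * al).
  move=> d0; have [p pE] := dist_int_near (d%:R * al); rewrite pE normr_gt0 -normr_gt0.
  rewrite lt0r normr_ge0 andbT; apply/eqP => z; apply: nZ; right; exists d => //.
  by rewrite /G d0; split => //; exists p; rewrite z.
(* Positivity of [M] is asserted only along with some d: if no d lies below n0, the value 0 is
   taken. *)
have [M HM] : exists M : nat, forall d, (0 < d < n0)%N -> M%:R^-1 <= dist_int (d%:R * al) /\ (0 < M)%N.
  elim: n0 {Hn0} => [|n [M HM]]; first by exists 0%N => d; rewrite ltn0 andbF.
  pose K := (Num.trunc (dist_int (n%:R * al))^-1).+1.
  exists (maxn M K) => d /andP[d0]; rewrite ltnS leq_eqVlt => /orP[/eqP dn|dn].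
    split; last by rewrite leq_max orbT.
    rewrite dn in d0 *; have p0 := dpos n d0; have pi : 0 <= (dist_int (n%:R * al))^-1 by rewrite invr_ge0 ltW.
    have KM : (0 < maxn M K)%N by rewrite leq_max orbT.
    rewrite -[leRHS]invrK lef_pV2 ?posrE ?invr_gt0 ?ltr0n //.
    have /andP[_ /ltW h] := truncn_itv pi; apply: (le_trans h); rewrite ler_nat leq_maxr //.
  have := HM d; rewrite d0 dn => /(_ isT) [h M0]; split; last by rewrite leq_max M0.
  by apply: le_trans h; rewrite lef_pV2 ?posrE ?ltr0n ?leq_max ?M0 // ler_nat leq_maxl.
exists M => N MN N2; have N1 := ltnW N2.
apply: delta_min_ge => //; first exact/ltW/beta_lt1.
move=> d dN; rewrite leNgt; apply/negP => lt.
have d0 := posdiffs_gt0 dN; have [dl lN] := labP dN.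
have l1 : (1 <= lab a d)%N by exact: ltnW (posdiffs_index_ge2 dl).
have Fd : F d al.
  rewrite /F dl; split => //; have [p pE] := dist_int_near (d%:R * al); exists p.
  by rewrite -pE; apply: (le_trans (ltW lt)); exact: beta_mono.
have dn : (d < n0)%N by rewrite ltnNge; apply/negP => /Hn0; exact.
have := HM d; rewrite d0 dn => /(_ isT) [h M0].
have := lt_le_trans lt (beta_le_inv N1).
apply/negP; rewrite -leNgt; apply: le_trans h.
by rewrite lef_pV2 ?posrE ?ltr0n // ler_nat.
Qed.

End LowerBoundAE.

Theorem theorem1 (R : realType) (a : nat -> nat)
  (apos : forall n, (1 <= n)%N -> (0 < a n)%N)
  (ainc : forall n, (1 <= n)%N -> (a n < a n.+1)%N)
  (eps : R) (heps : 0 < eps) :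
  {ae (@lebesgue_measure R), forall alpha : R, alpha \in `[0, 1] ->
    [/\ (forall M : nat, exists N : nat, [/\ (M <= N)%N, (2 <= N)%N &
          delta_min a alpha N <=
            (C_N a N)%:R^-1 * (Log2 (a N)%:R / (Log (N%:R : R) * Log2 (N%:R : R))) ]),
        (exists M : nat, forall N : nat, (M <= N)%N -> (2 <= N)%N ->
          ((C_N a N)%:R * Log (N%:R : R) * (Log2 (N%:R : R)) `^ (1 + eps))^-1
            <= delta_min a alpha N)
      & (forall M : nat, exists N : nat, [/\ (M <= N)%N, (2 <= N)%N &
          delta_min a alpha N <= (C_N a N)%:R^-1 ]) ] }.
Proof.
have [Z [mZ Z0 HZ]] := lower_bound_ae ainc heps.
pose W := often_close (posdiffs a) (tau R a) 1.
have mW := @measurable_not_often_close R a.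
pose B : set R := (([set` `[0%R, 1%R]] : set R) `&` ~` W `|` Z).
have mB : measurable B := measurableU _ _ mW mZ.
have B0 : lebesgue_measure B = 0%E by apply: null_set_setU => //; exact: often_close_full.
exists B; split; [exact: mB | exact: B0 |].
move=> alpha nP; apply: contrapT => nB; apply: nP => al01.
have nZ : ~ Z alpha by move=> h; apply: nB; right.
have Wal : W alpha by apply: contrapT => h; apply: nB; left.
have upper := often_close_delta_min Wal.
split; last 2 first.
- exact: HZ al01 nZ.
- move=> M; have [N [MN N2 h]] := upper M; exists N; split => //; apply: (le_trans h).
  by rewrite /tau ler_piMl ?invr_ge0 // ge_min lexx.
move=> M; have [N [MN N2 h]] := upper M; exists N; split => //; apply: (le_trans h).
by rewrite /tau mulrC ler_wpM2l ?invr_ge0 // ge_min lexx orbT.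
Qed.
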